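(* Let $\ell,m\in\mathbb{N}$ and let $\mathbb{A}=\mathcal{A}_1\times\cdots\times\mathcal{A}_m$ with $\mathcal{A}_n\in\Delta(\ell)$ for all $n=1,\ldots,m$. For a cell $\mathcal{A}\in\Delta(\ell)$ put $\mathbb{I}_\ell(\mathcal{A})=\{i\in\mathbb{I}(\ell)\,;\,\mathcal{B}_{\ell,i}\subset\mathcal{A}\}$, and put $\mathbb{I}_\ell(\mathbb{A})=\mathbb{I}_\ell(\mathcal{A}_1)\times\cdots\times\mathbb{I}_\ell(\mathcal{A}_m)$. Let $\rho_{\mathfrak{G}_\ell}^m$ be the $m$-point correlation function of $\mu|_{\mathfrak{G}_\ell}$ with respect to $\lambda$, and let $\rho_{\mathbb{F}(\ell)}^m$ be the $m$-point correlation function of $\nu_{\mathbb{F}(\ell)}$ with respect to the counting measure $\lambda_{\mathbb{I}(\ell)}$. Then $$\int_{\mathbb{A}}\rho_{\mathfrak{G}_\ell}^m(\mathbf{x})\,\lambda^m(d\mathbf{x})=\sum_{\bm{i}\in\mathbb{I}_\ell(\mathbb{A})}\rho_{\mathbb{F}(\ell)}^m(\bm{i}).$$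
   Context: **Space and process.** $S$ is a locally compact Hausdorff space with countable basis, and $\lambda$ is a Radon measure on $S$ with $\lambda(\mathcal{O})>0$ for every non-empty open $\mathcal{O}\subset S$. The configuration space $\mathsf{S}$ over $S$ is the set of measures $\mathsf{s}=\sum_i\delta_{s_i}$ with $s_i\in S$ and $\mathsf{s}(K)<\infty$ for every compact $K$, with the vague topology. A point process on $S$ is a probability measure on $(\mathsf{S},\mathfrak{B}(\mathsf{S}))$. A symmetric function $\rho^m$ on $S^m$ is the $m$-point correlation function of a point process $\mu$ with respect to $\lambda$ if $$\int_{\mathsf{S}}\prod_{i=1}^{j}\frac{\mathsf{s}(A_i)!}{(\mathsf{s}(A_i)-k_i)!}\,\mu(d\mathsf{s})=\int_{A_1^{k_1}\times\cdots\times A_j^{k_j}}\rho^m(\mathbf{x})\,\lambda^m(d\mathbf{x})$$ for all disjoint $A_1,\ldots,A_j\in\mathfrak{B}(S)$ and $k_1,\ldots,k_j\in\mathbb{N}$ with $k_1+\cdots+k_j=m$, where a factor is $0$ if $\mathsf{s}(A_i)-k_i<0$. For an $m\times m$ matrix $A=(a_{i,j})$ and real $\alpha$, $\det_\alpha A=\sum_{\sigma\in\mathfrak{S}_m}\alpha^{m-\nu(\sigma)}\prod_{i=1}^m a_{i,\sigma(i)}$, where $\nu(\sigma)$ is the number of cycles of $\sigma$. Given a measurable kernel $\mathsf{K}:S\times S\to\mathbb{C}$, the $\alpha$-determinantal point process associated with $(\mathsf{K},\lambda)$ is the point process with $m$-point correlation functions $\rho^m(\mathbf{x})=\det_\alpha[\mathsf{K}(x_i,x_j)]_{i,j=1}^m$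 with respect to $\lambda$, for all $m$. The same definitions are used for a countable discrete space with counting measure. **Standing assumptions on $(\mathsf{K},\alpha)$.** $\mathsf{K}$ is also regarded as the operator $\mathsf{K}f(x)=\int_S\mathsf{K}(x,y)f(y)\lambda(dy)$ on $L^2(S,\lambda)$. Assume $\alpha\in\{2/m;m\in\mathbb{N}\}\cup\{-1/m;m\in\mathbb{N}\}$; $\mathsf{K}$ is Hermitian symmetric and of locally trace class (that is, $1_A\mathsf{K}1_A$ is trace class for every compact $A$); $\mathrm{Spec}(\mathsf{K})\subset[0,\infty)$, and $\mathrm{Spec}(\mathsf{K})\subset[0,-1/\alpha]$ if $\alpha<0$. As usual, the version of the kernel is such that $\int_A\mathsf{K}(x,x)\lambda(dx)=\mathrm{Tr}(1_A\mathsf{K}1_A)$ for relatively compact measurable $A$. Then the $\alpha$-determinantal point process $\mu$ associated with $(\mathsf{K},\lambda)$ exists and is unique. **Partitions.** A $\lambda$-partition of $S$ is a countable collection of disjoint, relatively compact, measurable sets of positive $\lambda$-measure with union $S$. Assume given $\lambda$-partitions $\Delta(\ell)=\{\mathcal{A}_{\ell,i}\}_{i\in I(\ell)}$, $\ell\in\mathbb{N}$, such that every cell of $\Delta(\ell+1)$ is contained in a cell of $\Delta(\ell)$, each cell of $\Delta(\ell)$ contains exactly two cells of $\Delta(\ell+1)$, and, with $\mathfrak{F}_\ell=\sigma[\mathcal{A}_{\ell,i};i\in I(\ell)]$, $\sigma[\bigcup_\ell\mathfrak{F}_\ell]=\mathfrak{B}(S)$. The index sets are $I(\ell)=I\times\{0,1\}^{\ell-1}$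 with $I=I(1)$, labelled so that for $\ell<\ell'$, $i\in I(\ell)$, $i'\in I(\ell')$: $\mathcal{A}_{\ell,i}\supset\mathcal{A}_{\ell',i'}$ iff $i=(j_1,\ldots,j_\ell)$ and $i'=(j_1,\ldots,j_\ell,\ldots,j_{\ell'})$. **Basis.** Let $\mathbb{I}=I\cup\bigcup_{\ell\ge2}\{(j_1,\ldots,j_\ell)\in I(\ell);j_\ell=0\}$, with $\mathrm{rank}(i)=\ell$ for $i\in I(\ell)$. For rank $1$ put $\mathcal{B}_i=\mathcal{A}_{1,i}$; for $i=(j_1,\ldots,j_\ell)$ with $\ell\ge2$ put $\mathcal{B}_i=\mathcal{A}_{\ell-1,(j_1,\ldots,j_{\ell-1})}$. Fix an orthonormal basis $\{f_i\}_{i\in\mathbb{I}}$ of $L^2(S,\lambda)$ of real-valued functions with $\sigma[f_i;i\in\mathbb{I},\mathrm{rank}(i)=\ell]=\mathfrak{F}_\ell$ for each $\ell$, $\mathrm{supp}(f_i)=\{f_i\ne0\}=\mathcal{B}_i$, and $f_i=1_{\mathcal{A}_{1,i}}/\sqrt{\lambda(\mathcal{A}_{1,i})}$ for rank $1$. **Level $\ell$ objects.** $\mathbb{I}(\ell)$ is the disjoint union of $I(\ell)$ (elements of rank $1$) and, for $r\ge2$, the set of $i=(\mathbf{j}_\ell,j_{\ell+1},\ldots,j_{\ell+r-1})\in I(\ell)\times\{0,1\}^{r-1}$ with $j_{\ell+r-1}=0$ (elements of rank $r$), where $\mathbf{j}_\ell=(j_1,\ldots,j_\ell)\in I(\ell)$.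 For $i$ of rank $1$: $f_{\ell,i}=1_{\mathcal{A}_{\ell,i}}/\sqrt{\lambda(\mathcal{A}_{\ell,i})}$ and $\mathcal{B}_{\ell,i}=\mathcal{A}_{\ell,i}$. For $i$ of rank $r\ge2$, with $j=(j_1,\ldots,j_{\ell+r-1})\in\mathbb{I}$ the flattened sequence: $f_{\ell,i}=f_j$ and $\mathcal{B}_{\ell,i}=\mathcal{B}_j$. Then $\mathbb{F}(\ell)=\{f_{\ell,i}\}_{i\in\mathbb{I}(\ell)}$ is an orthonormal basis of $L^2(S,\lambda)$ with $\mathrm{supp}(f_{\ell,i})=\mathcal{B}_{\ell,i}$. Define $$\mathsf{K}_{\mathbb{F}(\ell)}(i,j)=\int_{S\times S}\mathsf{K}(x,y)f_{\ell,i}(x)f_{\ell,j}(y)\,\lambda(dx)\lambda(dy),\quad i,j\in\mathbb{I}(\ell).$$ Let $\lambda_{\mathbb{I}(\ell)}$ be the counting measure on $\mathbb{I}(\ell)$ and let $\nu_{\mathbb{F}(\ell)}$ be the $\alpha$-determinantal point process on $\mathbb{I}(\ell)$ associated with $(\mathsf{K}_{\mathbb{F}(\ell)},\lambda_{\mathbb{I}(\ell)})$ (it exists and is unique). **Restriction of $\mu$.** $\mathfrak{G}_\ell=\sigma[\{\mathsf{s}\in\mathsf{S};\mathsf{s}(\mathcal{A}_{\ell,i})=n\};i\in I(\ell),n\in\mathbb{N}]$, and $\mu|_{\mathfrak{G}_\ell}$ is the restriction of $\mu$ to $\mathfrak{G}_\ell$. Let $\mathfrak{F}_\ell^m=\sigma[\mathcal{A}_{\ell,i_1}\times\cdots\times\mathcal{A}_{\ell,i_m};i_n\in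 I(\ell)]$. An $\mathfrak{F}_\ell^m$-measurable symmetric function $\rho_{\mathfrak{G}_\ell}^m$ on $S^m$ is the $m$-point correlation function of $\mu|_{\mathfrak{G}_\ell}$ with respect to $\lambda$ if it satisfies the displayed correlation identity above (with $\rho_{\mathfrak{G}_\ell}^m$ in place of $\rho^m$) for all disjoint $A_1,\ldots,A_j\in\mathfrak{F}_\ell$ and $k_1+\cdots+k_j=m$. *)

(* Defs.v *)
From HB Require Import structures.
From mathcomp Require Import all_boot all_order all_algebra all_fingroup.
From mathcomp Require Import all_classical all_reals all_analysis.
From mathcomp Require Import complex.

Set Implicit Arguments.
Unset Strict Implicit.
Unset Printing Implicit Defensive.

Import Order.TTheory GRing.Theory Num.Theory.
Import numFieldNormedType.Exports.
Local Notation normc := ComplexField.Normc.normc.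

Local Open Scope classical_set_scope.
Local Open Scope ring_scope.
Local Open Scope complex_scope.

Notation borel S := (g_sigma_algebraType (@open S)).

Section Measures.
Context {R : realType}.

Definition radon_measure (S : ptopologicalType)
    (lam : {measure set (borel S) -> \bar R}) : Prop :=
  (forall K : set S, compact K -> (lam K < +oo)%E) /\
  (forall B : set (borel S), measurable B ->
    lam B = ereal_sup [set lam K | K in [set K : set S | compact K /\ K `<=` B]]).

(* The m-fold product measure on m-tuples.  As with the library's product
   [\x], this is a set function for any [mu]; it is the product measure as soon
   as [mu] is sigma-finite, which Radon measures on a locally compact
   second-countable space and counting measures on countable sets are. *)
Fixpoint power_measure d (T : measurableType d) (mu : set T -> \bar R)
    (m : nat) {struct m} : set (m.-tuple T) -> \bar R :=
  match m with
  | 0%N => \d_([tuple] : 0.-tuple T)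
  | m'.+1 => pushforward (mu \x @power_measure d T mu m')%E
               (fun p : T * m'.-tuple T => [tuple of p.1 :: p.2])
  end.

Definition Cintegrable d (T : measurableType d) (mu : set T -> \bar R)
    (D : set T) (f : T -> R[i]) : Prop :=
  mu.-integrable D (fun x => (complex.Re (f x))%:E) /\
  mu.-integrable D (fun x => (complex.Im (f x))%:E).

Definition Cintegral d (T : measurableType d) (mu : set T -> \bar R)
    (D : set T) (f : T -> R[i]) : R[i] :=
  fine (\int[mu]_(x in D) (complex.Re (f x))%:E)%E +i*
  fine (\int[mu]_(x in D) (complex.Im (f x))%:E)%E.

End Measures.
Arguments power_measure {R d T} mu m _.

(* The sum formula is required on every subset, not only on the Borel sets, so
   that a configuration is determined by its values on Borel sets. *)
Record config (S : ptopologicalType) (R : realType) := Config {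
  config_measure :> {measure set (borel S) -> \bar R} ;
  config_sum_dirac : exists (J : countType) (x : J -> borel S),
    forall B : set (borel S),
      config_measure B = \esum_(j in [set: J]) \d_(x j) B ;
  config_locally_finite :
    forall K : set S, compact K -> (config_measure K < +oo)%E }.

Section ZeroConfig.
Variables (S : ptopologicalType) (R : realType).

Let zero_sum : exists (J : countType) (x : J -> borel S),
  forall B : set (borel S),
    (@mzero _ (borel S) R) B = \esum_(j in [set: J]) \d_(x j) B.
Proof.
exists void, (of_void _) => B.
rewrite /mzero (_ : [set: void] = set0) ?esum_set0 //.
by apply/seteqP; split => -[].
Qed.

Let zero_lf (K : set S) : compact K -> (@mzero _ (borel S) R K < +oo)%E.
Proof. by move=> _; rewrite /mzero ltry. Qed.

Definition config0 : config S R := Config zero_sum zero_lf.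

HB.instance Definition _ := gen_eqMixin (config S R).
HB.instance Definition _ := gen_choiceMixin (config S R).
HB.instance Definition _ := isPointed.Build (config S R) config0.

End ZeroConfig.

Section Vague.
Variables (S : ptopologicalType) (R : realType).

Definition test_fun : Type :=
  {f : S -> R | continuous f /\ compact (closure [set x | f x != 0])}.

Definition vague_eval (s : config S R) : {ptws test_fun -> R} :=
  fun f => (\int[s]_(x in [set: borel S]) (sval f x))%R.

Definition vague_config : Type := initial_topology vague_eval.

HB.instance Definition _ := Topological.on vague_config.
HB.instance Definition _ := isPointed.Build vague_config (config0 S R).

End Vague.

Notation config_space S R := (borel (vague_config S R)).

Section Correlation.
Variables (S : ptopologicalType) (R : realType).

(* x (x - 1) ... (x - k + 1), which is x! / (x - k)! for x a natural number,
   with the value 0 when x < k. *)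
Definition falling_fact (x : \bar R) (k : nat) : \bar R :=
  (\prod_(l < k) (x - l%:R%:E))%E.

(* A_1^{k_1} x ... x A_j^{k_j}, as a set of m-tuples when m = k_1 + ... + k_j. *)
Definition blocks m j (A : 'I_j -> set S) (k : 'I_j -> nat) : set (m.-tuple S) :=
  [set x | forall n : 'I_m,
    nth set0 (flatten [seq nseq (k i) (A i) | i <- enum 'I_j]) n (tnth x n)].

(* P lives on the sigma-algebra generated by G, and the sets A_i are taken from
   the class E, so that the identity makes sense for restrictions of a point
   process to sub-sigma-algebras. *)
Definition correlation_identity (lam : set (borel S) -> \bar R)
    (G : set (set (config S R))) (P : set (g_sigma_algebraType G) -> \bar R)
    (E : set (set S)) (m : nat) (rho : m.-tuple S -> R) : Prop :=
  forall (j : nat) (A : 'I_j -> set S) (k : 'I_j -> nat),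
    (forall i, E (A i)) -> trivIset [set: 'I_j] A ->
    (forall i, (0 < k i)%N) -> (\sum_(i < j) k i)%N = m ->
    (\int[P]_s \prod_(i < j) falling_fact ((s : config S R) (A i)) (k i) =
     \int[power_measure lam m]_(x in (blocks A k : set (m.-tuple (borel S))))
        (rho x)%:E)%E.

Definition symmetric_fun m (rho : m.-tuple S -> R) : Prop :=
  forall (s : 'S_m) (x : m.-tuple S),
    rho [tuple tnth x (s i) | i < m] = rho x.

Definition correlation_function (lam : set (borel S) -> \bar R)
    (mu : set (config_space S R) -> \bar R) (m : nat)
    (rho : m.-tuple S -> R) : Prop :=
  [/\ measurable_fun setT (rho : m.-tuple (borel S) -> R),
      symmetric_fun rho &
      @correlation_identity lam (@open (vague_config S R)) mu
        (measurable : set (set (borel S))) m rho].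

End Correlation.

Definition det_alpha (R : realType) (alpha : R) m (A : 'M[R[i]]_m) : R[i] :=
  \sum_(s : 'S_m)
    (alpha ^+ (m - #|porbits s|))%:C * \prod_(i < m) A i (s i).

Definition alpha_determinantal (S : ptopologicalType) (R : realType) (alpha : R)
    (K : S -> S -> R[i]) (lam : set (borel S) -> \bar R)
    (mu : probability (config_space S R) R) : Prop :=
  forall m : nat, (0 < m)%N ->
    exists2 rho : m.-tuple S -> R, correlation_function lam mu rho &
      forall x, (rho x)%:C =
        det_alpha alpha (\matrix_(i < m, j < m) K (tnth x i) (tnth x j)).

(* Elements of L^2 are represented by functions, and equalities in L^2 are
   expressed through the norm. *)
Section L2.
Context {R : realType} {d : measure_display} {T : measurableType d}.
Variable lam : {measure set T -> \bar R}.

Definition Cmeasurable (f : T -> R[i]) : Prop :=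
  measurable_fun setT ((fun x => complex.Re (f x))) /\ measurable_fun setT ((fun x => complex.Im (f x))).

Definition L2norm (f : T -> R[i]) : \bar R :=
  Lnorm lam 2%:E (fun x => (normc (f x))%:E).

Definition L2 (f : T -> R[i]) : Prop := Cmeasurable f /\ (L2norm f < +oo)%E.

Definition inner (f g : T -> R[i]) : R[i] :=
  Cintegral lam setT (fun x => f x * (g x)^*).

Definition orthonormal_family (J : choiceType) (D : set J)
    (e : J -> T -> R[i]) : Prop :=
  (forall i, D i -> L2 (e i)) /\
  (forall i j, D i -> D j -> inner (e i) (e j) = (i == j)%:R).

Definition orthonormal_basis (J : choiceType) (D : set J)
    (e : J -> T -> R[i]) : Prop :=
  orthonormal_family D e /\
  forall g, L2 g -> forall eps : R, 0 < eps ->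
    exists (r : seq J) (c : J -> R[i]),
      (forall j, j \in r -> D j) /\
      (L2norm (fun x => (g x - \sum_(j <- r) c j * e j x)%R) < eps%:E)%E.

(* Not necessarily bounded, hence the domain. *)
Record operator := Operator {
  op_dom : set (T -> R[i]) ;
  op_app :> (T -> R[i]) -> (T -> R[i]) }.

(* z belongs to the resolvent set when A - z is a bijection of the domain onto
   L^2 with bounded inverse. *)
Definition resolvent_set (A : operator) : set R[i] := [set z |
  (exists M : R, forall f, op_dom A f ->
     (L2norm f <= M%:E * L2norm (fun x => (A f x - z * f x)%R))%E) /\
  (forall h, L2 h -> exists2 f, op_dom A f &
     L2norm (fun x => A f x - z * f x - h x) = 0%E)].

Definition spectrum (A : operator) : set R[i] := ~` resolvent_set A.

(* Trace class: summable singular values s, with singular vectors phi, psi. *)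
Definition trace_class (A : operator) : Prop :=
  (forall f, L2 f -> op_dom A f) /\
  exists (s : nat -> R) (phi psi : nat -> T -> R[i]),
    [/\ forall n, 0 <= s n,
        cvg (series s @ \oo),
        orthonormal_family [set n | s n != 0] phi,
        orthonormal_family [set n | s n != 0] psi &
        forall f, L2 f ->
          (fun N => L2norm (fun x =>
             A f x - \sum_(n < N) (s n)%:C * inner f (phi n) * psi n x))
          @ \oo --> 0%E].

(* t is the sum of <A e_n, e_n> for every orthonormal basis; bases are indexed
   by subsets of nat so that finite-dimensional L^2 is covered too. *)
Definition has_trace (A : operator) (t : R[i]) : Prop :=
  forall (D : set nat) (e : nat -> T -> R[i]), orthonormal_basis D e ->
    (fun N => normc (t - \sum_(n < N | (n : nat) \in D) inner (A (e n)) (e n)))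
    @ \oo --> (0 : R).

(* The domain is maximal: it is all of L^2 when K defines a bounded operator. *)
Definition kernel_operator (K : T -> T -> R[i]) : operator :=
  let app f := fun x => Cintegral lam setT (fun y => K x y * f y) in
  Operator
    [set f | [/\ L2 f,
       {ae lam, forall x, Cintegrable lam setT (fun y => K x y * f y)} &
       L2 (app f)]]
    app.

End L2.

Definition cut_kernel (R : realType) (T : Type) (A : set T)
    (K : T -> T -> R[i]) : T -> T -> R[i] :=
  fun x y => (\1_A x)%:C * K x y * (\1_A y)%:C.

Definition admissible_alpha (R : realType) (alpha : R) : Prop :=
  exists2 m : nat, (0 < m)%N & alpha = 2 / m%:R \/ alpha = - 1 / m%:R.

Section Kernel.
Context {R : realType} {S : ptopologicalType}.
Variable lam : {measure set (borel S) -> \bar R}.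
Implicit Types K : S -> S -> R[i].

Definition kernel_measurable K : Prop :=
  Cmeasurable (fun p : borel S * borel S => K p.1 p.2).

Definition hermitian_kernel K : Prop := forall x y, K x y = (K y x)^*.

Definition locally_trace_class K : Prop :=
  forall A : set S, compact A ->
    trace_class lam (kernel_operator lam (cut_kernel A K : borel S -> borel S -> R[i])).

(* In R[i], [0 <= z] says that z is real and nonnegative. *)
Definition spectral_condition (alpha : R) K : Prop :=
  forall z, spectrum lam (kernel_operator lam K) z ->
    0 <= z /\ (alpha < 0 -> z <= (- 1 / alpha)%:C).

Definition trace_formula K : Prop :=
  forall A : set (borel S), measurable A -> compact (closure (A : set S)) ->
    Cintegrable lam A (fun x => K x x) /\
    has_trace lam (kernel_operator lam (cut_kernel A K : borel S -> borel S -> R[i]))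
      (Cintegral lam A (fun x => K x x)).

End Kernel.

(* The index (j_1, ..., j_l) of a cell of level l is the pair of
   j_1 and [:: j_2; ...; j_l]. *)
Notation node I := (I * seq bool)%type.

Definition level (I : Type) (n : node I) : nat := (size n.2).+1.


Section Partitions.
Context {R : realType} {S : ptopologicalType} {I : pointedType}.
Variable lam : {measure set (borel S) -> \bar R}.
Variable cell : node I -> set S.

Definition lambda_partition (D : set (node I)) : Prop :=
  [/\ countable (cell @` D), trivIset D cell,
      \bigcup_(n in D) cell n = [set: S] &
      forall n, D n -> [/\ (measurable : set (set (borel S))) (cell n),
                           compact (closure (cell n)) &
                           (0 < lam (cell n))%E]].

Definition Delta (l : nat) : set (set S) := cell @` [set n | level n = l].

Definition calF (l : nat) : set (set S) := <<s Delta l >>.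

(* The labelling condition, with I x {0,1}^(l-1) as the whole index set of level
   l, contains that every cell of level l+1 lies in a cell of level l and that
   every cell of level l contains exactly two cells of level l+1. *)
Definition nested_partitions : Prop :=
  [/\ forall l, (0 < l)%N -> lambda_partition [set n | level n = l],
      forall n n', (level n < level n')%N ->
        (cell n' `<=` cell n <-> n.1 = n'.1 /\ prefix n.2 n'.2) &
      <<s \bigcup_(l in [set l | (0 < l)%N]) calF l >> =
        (measurable : set (set (borel S)))].

(* The sigma-algebra on S^m generated by the products of m cells of level l. *)
Definition cell_products (l m : nat) : set (set (m.-tuple S)) :=
  [set B | exists2 A : 'I_m -> set S, (forall n, Delta l (A n)) &
             B = [set x | forall n, A n (tnth x n)]].

Definition bigI : set (node I) := [set n | ~~ last false n.2].

Definition basis_supp (n : node I) : set S :=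
  if n.2 is [::] then cell n else cell (n.1, take (size n.2).-1 n.2).

Definition normalized_indicator (A : set S) : S -> R :=
  fun x => \1_A x / Num.sqrt (fine (lam A)).

Definition adapted_basis (f : node I -> S -> R) : Prop :=
  [/\ orthonormal_basis lam bigI (fun n (x : borel S) => (f n x)%:C),
      forall l, (0 < l)%N ->
        <<s [set C | exists n (B : set R), [/\ bigI n, level n = l,
                       measurable B & C = f n @^-1` B]] >> = calF l,
      forall n, bigI n -> [set x | f n x != 0] = basis_supp n &
      forall i, f (i, [::]) = normalized_indicator (cell (i, [::]))].

End Partitions.
Arguments cell_products {S I} cell l m _.

Section LevelIndex.
Variables (I : pointedType) (l : nat).

(* An index is a pair of (j_1, ..., j_l) and (j_(l+1), ..., j_(l+r-1)), where r is
   its rank and the second component ends with 0 if it is not empty. *)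
Definition level_index_pred (p : node I * seq bool) : bool :=
  (size p.1.2 == l.-1) && ~~ last false p.2.

Definition level_index : Type := {p : node I * seq bool | level_index_pred p}.

HB.instance Definition _ := Choice.on level_index.

Let level_index0_subproof :
  level_index_pred ((point : I, nseq l.-1 false), [::]).
Proof. by rewrite /level_index_pred /= size_nseq eqxx. Qed.

Definition level_index0 : level_index :=
  exist (fun p => is_true (level_index_pred p)) _ level_index0_subproof.

HB.instance Definition _ := isPointed.Build level_index level_index0.

Definition base_node (i : level_index) : node I := (sval i).1.
Definition flat_node (i : level_index) : node I :=
  ((base_node i).1, (base_node i).2 ++ (sval i).2).

End LevelIndex.

Definition level_space (I : pointedType) (l : nat) : Type :=
  discrete_topology (level_index I l).

HB.instance Definition _ (I : pointedType) (l : nat) :=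
  Topological.on (level_space I l).
HB.instance Definition _ (I : pointedType) (l : nat) :=
  isPointed.Build (level_space I l) (level_index0 I l).

Section LevelBasis.
Context {R : realType} {S : ptopologicalType} {I : pointedType}.
Variable lam : {measure set (borel S) -> \bar R}.
Variable cell : node I -> set S.
Variable f : node I -> S -> R.
Variable l : nat.

Definition level_basis (i : level_index I l) : S -> R :=
  if (sval i).2 is [::] then normalized_indicator lam (cell (base_node i))
  else f (flat_node i).

Definition level_supp (i : level_index I l) : set S :=
  if (sval i).2 is [::] then cell (base_node i)
  else basis_supp cell (flat_node i).

Definition level_kernel (K : S -> S -> R[i]) (i j : level_space I l) : R[i] :=
  Cintegral (lam \x lam)%E setT (fun p : borel S * borel S =>
    K p.1 p.2 * (level_basis i p.1)%:C * (level_basis j p.2)%:C).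

End LevelBasis.

Section Restriction.
Context {R : realType} {S : ptopologicalType} {I : pointedType}.
Variable cell : node I -> set S.

Definition cell_counts (l : nat) : set (set (config S R)) :=
  [set B | exists (n : node I) (k : nat), level n = l /\
             B = [set s : config S R | s (cell n) = k%:R%:E]].

Definition restrict_to (G : set (set (config S R)))
    (mu : set (config_space S R) -> \bar R) :
    set (g_sigma_algebraType G) -> \bar R := mu.

Definition restricted_correlation_function (lam : set (borel S) -> \bar R)
    (mu : set (config_space S R) -> \bar R) (l m : nat)
    (rho : m.-tuple S -> R) : Prop :=
  [/\ measurable_fun setT
        (rho : g_sigma_algebraType (cell_products cell l m) -> R),
      symmetric_fun rho &
      correlation_identity lam (restrict_to (G := cell_counts l) mu)
        (calF cell l) rho].

End Restriction.

(* Main.v *)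
(* Both sides are integrals of alpha-determinants: once the factors are sorted into
   blocks, the correlation identities turn the left side into the integral of
   det_alpha [K (x_i, x_j)] over A, and the right side into the sum of
   det_alpha [K_F (i, j)] over the indices supported in A.  On a compact set that
   contains the cells, the trace class kernel is almost everywhere
     K (x, y) = sum_n s_n psi_n(x) (phi_n(y))^*,
   and taking coefficients in the basis gives the same expansion of K_F, with psi_n
   and phi_n replaced by the sequences <psi_n, f_i> and <phi_n, f_i>.  The integral of
   a product of K (x_i, x_(sigma i)) over A is then a limit of expressions in s, in the
   diagonal integrals of K (x, x) over A_i for the fixed points i of sigma, and in the
   Gram integrals of psi_n phi_n'^* over A_i for the other i.  As every basis function
   lives in one cell, the diagonal integrals agree on both sides by the trace formula,
   and the Gram integrals by Parseval. *)

(* The hypotheses speak of operators, the correlation functions of pointwise values of kernels, and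
   an expansion that converges in norm does not by itself converge under an integral of a product of
   kernels. What makes every exchange of limits possible is the function q = sum_n s_n (|psi_n|^2 +
   |phi_n|^2): it is integrable since the s_n are summable, and by Cauchy-Schwarz every partial sum
   of the expansion at (x, y) is at most sqrt (q x) sqrt (q y). In a product along a permutation
   each coordinate occurs once as first and once as second argument, so the square roots pair up to
   a product of the q (x_i), integrable on the power space. The limit formula is proved for an
   arbitrary sigma-finite measure and for psi_n, phi_n of norm at most 1 instead of orthonormal
   ones. In this form it applies both to [lam] and to counting measure on the indices, where
   Bessel's inequality provides the norm bound. The two sequences of approximants then agree term by
   term, so that no limit has to be computed. *)
Require Import Defs.
From HB Require Import structures.
From mathcomp Require Import all_boot all_order all_algebra all_fingroup.
From mathcomp Require Import all_classical all_reals all_analysis.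
From mathcomp Require Import measurable_realfun complex.
From mathcomp Require Import ring lra.

Set Implicit Arguments.
Unset Strict Implicit.
Unset Printing Implicit Defensive.

Import Order.TTheory GRing.Theory Num.Theory.
Import numFieldNormedType.Exports.

Local Open Scope classical_set_scope.
Local Open Scope ring_scope.

Local Notation normc := ComplexField.Normc.normc.
Local Notation Re := complex.Re.
Local Notation Im := complex.Im.
Local Notation "x %:C" := (real_complex _ x) : ring_scope.

(** * Complex-valued integration *)

Section ComplexParts.
Variable R : realType.
Implicit Types z w : R[i].

Lemma Re_conj z : Re z^* = Re z. Proof. by case: z. Qed.
Lemma Im_conj z : Im z^* = - Im z. Proof. by case: z. Qed.
Lemma ReD z w : Re (z + w) = Re z + Re w. Proof. by case: z w => a b []. Qed.
Lemma ImD z w : Im (z + w) = Im z + Im w. Proof. by case: z w => a b []. Qed.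
Lemma ReN z : Re (- z) = - Re z. Proof. by case: z. Qed.
Lemma ImN z : Im (- z) = - Im z. Proof. by case: z. Qed.
Lemma ReM z w : Re (z * w) = Re z * Re w - Im z * Im w.
Proof. by case: z w => a b []. Qed.
Lemma ImM z w : Im (z * w) = Re z * Im w + Im z * Re w.
Proof. by case: z w => a b []. Qed.

Lemma complex_eq z w : Re z = Re w -> Im z = Im w -> z = w.
Proof. by case: z w => a b [c d] /= -> ->. Qed.

Lemma Re_sum I (r : seq I) (P : pred I) (F : I -> R[i]) :
  Re (\sum_(i <- r | P i) F i) = \sum_(i <- r | P i) Re (F i).
Proof. exact: (big_morph (@complex.Re R) ReD). Qed.

Lemma Im_sum I (r : seq I) (P : pred I) (F : I -> R[i]) :
  Im (\sum_(i <- r | P i) F i) = \sum_(i <- r | P i) Im (F i).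
Proof. exact: (big_morph (@complex.Im R) ImD). Qed.

Lemma conj_realC (x : R) : (x%:C)^* = x%:C.
Proof. exact: conjc_real. Qed.

Lemma normc_sqr z : normc z ^+ 2 = Re z ^+ 2 + Im z ^+ 2.
Proof. by case: z => a b /=; rewrite sqr_sqrtr// addr_ge0 ?sqr_ge0. Qed.

Lemma normc_ge0 z : 0 <= normc z. Proof. by case: z => a b; exact: sqrtr_ge0. Qed.

Lemma Re_le_normc z : `|Re z| <= normc z.
Proof.
by case: z => a b /=; rewrite -sqrtr_sqr ler_sqrt ?addr_ge0 ?sqr_ge0// lerDl sqr_ge0.
Qed.

Lemma Im_le_normc z : `|Im z| <= normc z.
Proof.
by case: z => a b /=; rewrite -sqrtr_sqr ler_sqrt ?addr_ge0 ?sqr_ge0// lerDr sqr_ge0.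
Qed.

Lemma normc_le_ReIm z : normc z <= `|Re z| + `|Im z|.
Proof.
rewrite -(ler_pXn2r (n := 2)) ?nnegrE ?addr_ge0 ?normc_ge0// normc_sqr sqrrD.
by rewrite !real_normK ?num_real// addrAC lerDl mulrn_wge0// mulr_ge0.
Qed.

Lemma normcM z w : normc (z * w) = normc z * normc w.
Proof. exact: ComplexField.Normc.normcM. Qed.
Lemma normc_conj z : normc z^* = normc z.
Proof. by case: z => a b /=; rewrite sqrrN. Qed.
Lemma normc_real (x : R) : normc x%:C = `|x|.
Proof. by rewrite /= expr0n/= addr0 sqrtr_sqr. Qed.
Lemma normc0 : normc (0 : R[i]) = 0. Proof. exact: ComplexField.Normc.normc0. Qed.
Lemma normc1 : normc (1 : R[i]) = 1. Proof. exact: ComplexField.Normc.normc1. Qed.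

Lemma normc_sum I (r : seq I) (P : pred I) (F : I -> R[i]) :
  normc (\sum_(i <- r | P i) F i) <= \sum_(i <- r | P i) normc (F i).
Proof.
elim/big_rec2: _ => [|i x y _ h]; first by rewrite normc0.
by rewrite (le_trans (le_normcD _ _))// lerD2l.
Qed.

Lemma normc_prod I (r : seq I) (P : pred I) (F : I -> R[i]) :
  normc (\prod_(i <- r | P i) F i) = \prod_(i <- r | P i) normc (F i).
Proof.
elim/big_rec2: _ => [|i x y _ <-]; first exact: normc1.
exact: normcM.
Qed.

Lemma mul_conj z : z * z^* = (normc z ^+ 2)%:C.
Proof.
rewrite normc_sqr.
by apply: complex_eq; rewrite ?ReM ?ImM ?Re_conj ?Im_conj /=; ring.
Qed.

End ComplexParts.

Section ComplexConvergence.
Variable R : realType.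
Implicit Types u v : nat -> R[i].

(** Convergence of both parts, so that the real limit and integral theorems apply directly. *)
Definition Ccvg u (l : R[i]) : Prop :=
  (Re (u n) @[n --> \oo] --> Re l) /\ (Im (u n) @[n --> \oo] --> Im l).

Lemma Ccvg_unique u l l' : Ccvg u l -> Ccvg u l' -> l = l'.
Proof.
move=> [a b] [c d]; apply: complex_eq.
- exact: (cvg_unique _ a c).
- exact: (cvg_unique _ b d).
Qed.

Lemma Ccvg_cst l : Ccvg (fun=> l) l.
Proof. by split; exact: cvg_cst. Qed.

Lemma CcvgD u v l l' : Ccvg u l -> Ccvg v l' -> Ccvg (fun n => u n + v n) (l + l').
Proof.
move=> [a b] [c d]; split.
- by rewrite ReD; under eq_fun do rewrite ReD; exact: cvgD.
- by rewrite ImD; under eq_fun do rewrite ImD; exact: cvgD.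
Qed.

Lemma CcvgM u v l l' : Ccvg u l -> Ccvg v l' -> Ccvg (fun n => u n * v n) (l * l').
Proof.
move=> [a b] [c d]; split.
- by rewrite ReM; under eq_fun do rewrite ReM; apply: cvgB; exact: cvgM.
- by rewrite ImM; under eq_fun do rewrite ImM; apply: cvgD; exact: cvgM.
Qed.

Lemma Ccvg_sum I (r : seq I) (P : pred I) (u : I -> nat -> R[i]) (l : I -> R[i]) :
  (forall i, P i -> Ccvg (u i) (l i)) ->
  Ccvg (fun n => \sum_(i <- r | P i) u i n) (\sum_(i <- r | P i) l i).
Proof.
move=> h; elim: r => [|i r ih].
  by rewrite big_nil; under eq_fun do rewrite big_nil; exact: Ccvg_cst.
rewrite big_cons; under eq_fun do rewrite big_cons.
by case: ifPn => // Pi; apply: CcvgD => //; exact: h.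
Qed.

Lemma Ccvg_prod I (r : seq I) (P : pred I) (u : I -> nat -> R[i]) (l : I -> R[i]) :
  (forall i, P i -> Ccvg (u i) (l i)) ->
  Ccvg (fun n => \prod_(i <- r | P i) u i n) (\prod_(i <- r | P i) l i).
Proof.
move=> h; elim: r => [|i r ih].
  by rewrite big_nil; under eq_fun do rewrite big_nil; exact: Ccvg_cst.
rewrite big_cons; under eq_fun do rewrite big_cons.
by case: ifPn => // Pi; apply: CcvgM => //; exact: h.
Qed.

Lemma Ccvg_normc u l :
  (normc (l - u n) @[n --> \oo] --> (0 : R)) -> Ccvg u l.
Proof.
have squeeze (v : nat -> R) c : (forall n, `|c - v n| <= normc (l - u n)) ->
    (normc (l - u n) @[n --> \oo] --> (0 : R)) -> v n @[n --> \oo] --> c.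
  move=> h k; apply/cvgrPdist_lt => e e0.
  move/cvgrPdist_lt : k => /(_ e e0); apply: filterS => n.
  by rewrite sub0r normrN ger0_norm ?normc_ge0//; apply: le_lt_trans.
move=> h; split; apply: squeeze h => n.
- by rewrite -ReN -ReD Re_le_normc.
- by rewrite -ImN -ImD Im_le_normc.
Qed.

End ComplexConvergence.

Section ComplexMeasurability.
Context {R : realType} d {T : measurableType d}.
Implicit Types f g : T -> R[i].

Lemma Cmeasurable_cst (c : R[i]) : Cmeasurable (fun _ : T => c).
Proof. by split; exact: measurable_cst. Qed.

Lemma Cmeasurable_real (h : T -> R) :
  measurable_fun setT h -> Cmeasurable (fun x => (h x)%:C).
Proof. by move=> mh; split => //=; exact: measurable_cst. Qed.

Lemma CmeasurableD f g :
  Cmeasurable f -> Cmeasurable g -> Cmeasurable (fun x => f x + g x).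
Proof.
move=> [a b] [a' b']; split.
- by under eq_fun do rewrite ReD; exact: measurable_funD.
- by under eq_fun do rewrite ImD; exact: measurable_funD.
Qed.

Lemma CmeasurableM f g :
  Cmeasurable f -> Cmeasurable g -> Cmeasurable (fun x => f x * g x).
Proof.
move=> [a b] [a' b']; split.
- by under eq_fun do rewrite ReM; apply: measurable_funB; exact: measurable_funM.
- by under eq_fun do rewrite ImM; apply: measurable_funD; exact: measurable_funM.
Qed.

Lemma Cmeasurable_conj f : Cmeasurable f -> Cmeasurable (fun x => (f x)^*).
Proof.
move=> [a b]; split.
- by under eq_fun do rewrite Re_conj.
- by under eq_fun do rewrite Im_conj; exact: measurable_funN.
Qed.

Lemma CmeasurableB f g :
  Cmeasurable f -> Cmeasurable g -> Cmeasurable (fun x => f x - g x).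
Proof.
move=> mf [a b]; apply: CmeasurableD => //; split.
- by under eq_fun do rewrite ReN; exact: measurable_funN.
- by under eq_fun do rewrite ImN; exact: measurable_funN.
Qed.

Lemma Cmeasurable_sum I (r : seq I) (F : I -> T -> R[i]) :
  (forall i, Cmeasurable (F i)) -> Cmeasurable (fun x => \sum_(i <- r) F i x).
Proof.
move=> h; elim: r => [|i r ih].
  by under eq_fun do rewrite big_nil; exact: Cmeasurable_cst.
by under eq_fun do rewrite big_cons; exact: CmeasurableD.
Qed.

Lemma Cmeasurable_prod I (r : seq I) (F : I -> T -> R[i]) :
  (forall i, Cmeasurable (F i)) -> Cmeasurable (fun x => \prod_(i <- r) F i x).
Proof.
move=> h; elim: r => [|i r ih].
  by under eq_fun do rewrite big_nil; exact: Cmeasurable_cst.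
by under eq_fun do rewrite big_cons; exact: CmeasurableM.
Qed.

Lemma Cmeasurable_comp d' (T' : measurableType d') f (phi : T' -> T) :
  Cmeasurable f -> measurable_fun setT phi -> Cmeasurable (fun x => f (phi x)).
Proof.
by move=> [a b] mphi; split; [exact: (measurableT_comp a mphi)|exact: (measurableT_comp b mphi)].
Qed.

Lemma measurable_sqrtr : measurable_fun setT (@Num.sqrt R).
Proof. exact: (continuous_measurable_fun (@sqrt_continuous R)). Qed.

Lemma measurable_normc f : Cmeasurable f -> measurable_fun setT (fun x => normc (f x)).
Proof.
move=> [a b]; rewrite (_ : (fun _ => _) =
    Num.sqrt \o (fun x => Re (f x) ^+ 2 + Im (f x) ^+ 2)).
  apply: measurableT_comp; first exact: measurable_sqrtr.
  by apply: measurable_funD; exact: measurable_funX.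
by apply/funext => x /=; case: (f x).
Qed.

Lemma Cmeasurable_indic (A : set T) :
  measurable A -> Cmeasurable (fun x => (\1_A x : R)%:C).
Proof. by move=> mA; apply: Cmeasurable_real; exact: measurable_indic. Qed.

End ComplexMeasurability.

Section ComplexIntegral.
Context {R : realType} d {T : measurableType d}.
Variable mu : {measure set T -> \bar R}.
Implicit Types (f g : T -> R[i]) (h : T -> R).

Lemma Cintegrable_measurable f : Cintegrable mu setT f -> Cmeasurable f.
Proof.
by move=> [/measurable_int/measurable_EFinP ? /measurable_int/measurable_EFinP ?]; split.
Qed.

Lemma le_Cintegrable f h : Cmeasurable f -> mu.-integrable setT (EFin \o h) ->
  (forall x, normc (f x) <= h x) -> Cintegrable mu setT f.
Proof.
move=> [a b] ih fh; split; apply: (le_integrable _ _ _ ih) => //=;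
  try exact/measurable_EFinP; move=> x _; rewrite lee_fin.
- by rewrite (le_trans (Re_le_normc _))// (le_trans (fh x))// ler_norm.
- by rewrite (le_trans (Im_le_normc _))// (le_trans (fh x))// ler_norm.
Qed.

Lemma Cintegrable_normc f : Cintegrable mu setT f ->
  mu.-integrable setT (fun x => (normc (f x))%:E).
Proof.
move=> fi; have mf := Cintegrable_measurable fi; case: fi => a b.
have : mu.-integrable setT (fun x => (`|Re (f x)| + `|Im (f x)|)%:E).
  under eq_fun do rewrite EFinD.
  apply: integrableD => //.
  - exact: (@integrable_norm _ _ _ mu setT (fun x => Re (f x)) a).
  - exact: (@integrable_norm _ _ _ mu setT (fun x => Im (f x)) b).
apply: le_integrable => //; first exact/measurable_EFinP/measurable_normc.
move=> x _ /=; rewrite lee_fin ger0_norm ?normc_ge0// ger0_norm ?addr_ge0//.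
exact: normc_le_ReIm.
Qed.

Lemma CintegrableP f : Cintegrable mu setT f <->
  Cmeasurable f /\ (\int[mu]_x (normc (f x))%:E < +oo)%E.
Proof.
split=> [fi|[mf fi]].
  split; first exact: Cintegrable_measurable.
  move/Cintegrable_normc/integrableP : fi => [_]; apply: le_lt_trans.
  rewrite le_eqVlt; apply/orP; left; apply/eqP; apply: eq_integral => x _ /=.
  by rewrite ger0_norm ?normc_ge0.
apply: (@le_Cintegrable _ (fun x => normc (f x))) => //.
apply/integrableP; split; first exact/measurable_EFinP/measurable_normc.
by under eq_integral do rewrite /= ger0_norm ?normc_ge0//.
Qed.

Lemma CintegrableD f g : Cintegrable mu setT f -> Cintegrable mu setT g ->
  Cintegrable mu setT (fun x => f x + g x).
Proof.
move=> [a b] [a' b']; split.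
- by under eq_fun do rewrite ReD EFinD; exact: integrableD.
- by under eq_fun do rewrite ImD EFinD; exact: integrableD.
Qed.

Lemma CintegrableZ (c : R[i]) f : Cintegrable mu setT f ->
  Cintegrable mu setT (fun x => c * f x).
Proof.
move=> [a b]; split.
- under eq_fun do rewrite ReM EFinB !EFinM.
  by apply: integrableB => //; exact: integrableZl.
- under eq_fun do rewrite ImM EFinD !EFinM.
  by apply: integrableD => //; exact: integrableZl.
Qed.

Lemma Cintegrable0 : Cintegrable mu setT (fun=> 0 : R[i]).
Proof. by split; exact: integrable0. Qed.

Lemma Cintegrable_sum I (r : seq I) (P : pred I) (F : I -> T -> R[i]) :
  (forall i, P i -> Cintegrable mu setT (F i)) ->
  Cintegrable mu setT (fun x => \sum_(i <- r | P i) F i x).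
Proof.
move=> h; elim: r => [|i r ih].
  by under eq_fun do rewrite big_nil; exact: Cintegrable0.
under eq_fun do rewrite big_cons.
by case: (boolP (P i)) => // Pi; apply: CintegrableD => //; exact: h.
Qed.

Lemma CintegralD f g : Cintegrable mu setT f -> Cintegrable mu setT g ->
  Cintegral mu setT (fun x => f x + g x) = Cintegral mu setT f + Cintegral mu setT g.
Proof.
move=> [a b] [a' b']; rewrite /Cintegral; apply: complex_eq => /=.
- under eq_integral do rewrite ReD EFinD; rewrite integralD//.
  by rewrite fineD//; exact: integrable_fin_num.
- under eq_integral do rewrite ImD EFinD; rewrite integralD//.
  by rewrite fineD//; exact: integrable_fin_num.
Qed.

Lemma fine_integralZl (r : R) h : mu.-integrable setT (EFin \o h) ->
  fine (\int[mu]_x ((r * h x)%:E))%E = r * fine (\int[mu]_x (h x)%:E)%E.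
Proof.
move=> ih; under eq_integral do rewrite EFinM.
by rewrite integralZl// fineM//; exact: integrable_fin_num.
Qed.

Lemma CintegralZ (c : R[i]) f : Cintegrable mu setT f ->
  Cintegral mu setT (fun x => c * f x) = c * Cintegral mu setT f.
Proof.
move=> [a b]; have iZ (r : R) h : mu.-integrable setT (fun x => (h x)%:E) ->
    mu.-integrable setT (fun x => (r * h x)%:E).
  by move=> ih; under eq_fun do rewrite EFinM; exact: integrableZl.
apply: complex_eq; rewrite ?ReM ?ImM /Cintegral /=.
- under eq_integral do rewrite ReM EFinB.
  rewrite integralB//; [|exact: iZ..].
  by rewrite fineB ?fine_integralZl//; apply: integrable_fin_num => //; exact: iZ.
- under eq_integral do rewrite ImM EFinD.
  rewrite integralD//; [|exact: iZ..].
  by rewrite fineD ?fine_integralZl//; apply: integrable_fin_num => //; exact: iZ.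
Qed.

Lemma Cintegral0 : Cintegral mu setT (fun=> 0 : R[i]) = 0.
Proof. by rewrite /Cintegral /= integral0. Qed.

Lemma Cintegral_sum I (r : seq I) (P : pred I) (F : I -> T -> R[i]) :
  (forall i, P i -> Cintegrable mu setT (F i)) ->
  Cintegral mu setT (fun x => \sum_(i <- r | P i) F i x) =
  \sum_(i <- r | P i) Cintegral mu setT (F i).
Proof.
move=> h; elim: r => [|i r ih].
  by under eq_fun do rewrite big_nil; rewrite big_nil Cintegral0.
under eq_fun do rewrite big_cons; rewrite big_cons.
case: (boolP (P i)) => // Pi; rewrite CintegralD ?ih//; first exact: h.
exact: Cintegrable_sum.
Qed.

Lemma Cintegral_conj f : Cintegrable mu setT f ->
  Cintegral mu setT (fun x => (f x)^*) = (Cintegral mu setT f)^*.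
Proof.
move=> [a b]; apply: complex_eq; rewrite ?Re_conj ?Im_conj /Cintegral /=.
- by under eq_integral do rewrite Re_conj.
- under eq_integral do rewrite Im_conj -mulN1r; rewrite fine_integralZl//.
  by rewrite mulN1r.
Qed.

Lemma eq_Cintegral (D : set T) f g : {in D, f =1 g} ->
  Cintegral mu D f = Cintegral mu D g.
Proof.
by move=> fg; congr Complex; congr fine; apply: eq_integral => x xD; rewrite fg.
Qed.

Lemma Cintegral_mkcond (D : set T) f :
  Cintegral mu D f = Cintegral mu setT (fun x => (\1_D x : R)%:C * f x).
Proof.
rewrite /Cintegral; congr Complex; congr fine; rewrite integral_mkcond;
  apply: eq_integral => x _; rewrite !patchE indicE; case: ifPn => _;
  by rewrite ?mul1r ?mul0r.
Qed.

Lemma Cintegrable_mkcond (D : set T) f : measurable D ->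
  Cintegrable mu D f <-> Cintegrable mu setT (fun x => (\1_D x : R)%:C * f x).
Proof.
move=> mD; rewrite /Cintegrable.
have e (p : R[i] -> R) : p 0 = 0 ->
    (mu.-integrable D (fun x => (p (f x))%:E) <->
     mu.-integrable setT (fun x => (p ((\1_D x : R)%:C * f x))%:E)).
  move=> p0; rewrite (integrable_mkcond _ mD).
  rewrite (_ : (fun x => (p ((\1_D x : R)%:C * f x))%:E) =
               (fun x => (p (f x))%:E) \_ D)//.
  apply/funext => x; rewrite patchE indicE.
  by case: ifPn => _; rewrite ?mul1r ?mul0r ?p0.
by rewrite (e (@complex.Re R))// (e (@complex.Im R)).
Qed.

Lemma ae_eq_Cintegral f g : Cmeasurable f -> Cmeasurable g ->
  {ae mu, forall x, f x = g x} -> Cintegral mu setT f = Cintegral mu setT g.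
Proof.
move=> [a b] [a' b'] fg; congr Complex; congr fine; apply: ae_eq_integral => //;
  try exact/measurable_EFinP;
  by apply: filterS fg => x -> _.
Qed.

Lemma C_dominated_convergence (fs : nat -> T -> R[i]) f h :
  (forall n, Cmeasurable (fs n)) -> Cmeasurable f ->
  {ae mu, forall x, Ccvg (fs ^~ x) (f x)} ->
  mu.-integrable setT (EFin \o h) ->
  {ae mu, forall x, forall n, normc (fs n x) <= h x} ->
  Cintegrable mu setT f /\
  Ccvg (fun n => Cintegral mu setT (fs n)) (Cintegral mu setT f).
Proof.
move=> mfs [ma mb] ff ih fh.
have part (p : R[i] -> R) : (forall z, `|p z| <= normc z) ->
    (forall n, measurable_fun setT (fun x => p (fs n x))) ->
    measurable_fun setT (fun x => p (f x)) ->
    {ae mu, forall x, p (fs n x) @[n --> \oo] --> p (f x)} ->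
    mu.-integrable setT (fun x => (p (f x))%:E) /\
    fine (\int[mu]_x (p (fs n x))%:E)%E @[n --> \oo] -->
    fine (\int[mu]_x (p (f x))%:E)%E.
  move=> pn mp mpf pf.
  have [] := @dominated_convergence _ _ _ mu setT measurableT
    (fun n x => (p (fs n x))%:E) (fun x => (p (f x))%:E) (EFin \o h).
  - by move=> n; exact/measurable_EFinP.
  - exact/measurable_EFinP.
  - by apply: filterS pf => x h' _; apply/cvg_EFin; [exact: nearW|exact: h'].
  - by [].
  - by apply: filterS fh => x h' n _ /=; rewrite lee_fin (le_trans (pn _)).
  move=> i _ c; split=> //; apply: fine_cvg; rewrite fineK//.
  exact: integrable_fin_num.
have [| | |i1 c1] := part (@complex.Re R) (@Re_le_normc R).
- by move=> n; case: (mfs n).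
- by [].
- by apply: filterS ff => x [].
have [| | |i2 c2] := part (@complex.Im R) (@Im_le_normc R).
- by move=> n; case: (mfs n).
- by [].
- by apply: filterS ff => x [].
by split; split.
Qed.

End ComplexIntegral.

(** * Products of sigma-finite measures *)

(** Sigma-finiteness of [lam] and of counting measure is only proved along the way; this turns such
    a proof into the bundled structure on which product measures and Fubini are stated. *)
Lemma sigma_finite_measureP d (T : measurableType d) (R : realType)
    (mu : {measure set T -> \bar R}) : sigma_finite setT mu ->
  exists nu : {sigma_finite_measure set T -> \bar R}, (nu : set T -> \bar R) = mu.
Proof.
move=> h; pose m1 := isSFinite.Build _ _ _ _ (sfinite_measure_sigma_finite h).
pose m2 := isSigmaFinite.Build _ _ _ _ h.
by exists (HB.pack_for (SigmaFiniteMeasure.type T R) (Measure.sort mu) m1 m2).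
Qed.

Section ProductIntegral.
Context {R : realType} d1 d2 {T1 : measurableType d1} {T2 : measurableType d2}.
Variables (m1 : {sigma_finite_measure set T1 -> \bar R})
          (m2 : {sigma_finite_measure set T2 -> \bar R}).

Lemma product_sigma_finite : sigma_finite setT (m1 \x m2)%E.
Proof.
have /sigma_finiteP[F [FT Fnd Foo]] := sigma_finiteT m1.
have /sigma_finiteP[G [GT Gnd Goo]] := sigma_finiteT m2.
exists (fun n => F n `*` G n) => [|n].
  apply/seteqP; split => // -[x y] _.
  have : setT x by []. have : setT y by [].
  rewrite FT GT => -[j _ Gy] [i _ Fx]; exists (maxn i j) => //; split => /=.
  - by move: Fx; apply/subsetPset/Fnd/leq_maxl.
  - by move: Gy; apply/subsetPset/Gnd/leq_maxr.
have [mF Fy] := Foo n; have [mG Gy] := Goo n; split; first exact: measurableX.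
by rewrite product_measure1E// lte_mul_pinfty// ge0_fin_numE.
Qed.

(** Where the inner integral is not finite, [fine] returns a junk value; those points form a null
    set, so neither integrability nor the integral changes. *)
Lemma fine_Fubini (f : T1 * T2 -> R) :
  (m1 \x m2)%E.-integrable setT (EFin \o f) ->
  m1.-integrable setT (fun x => (fine (\int[m2]_y (f (x, y))%:E)%E)%:E) /\
  fine (\int[m1 \x m2]_z (f z)%:E)%E =
  fine (\int[m1]_x (fine (\int[m2]_y (f (x, y))%:E)%E)%:E)%E.
Proof.
move=> fi; have iF := integrable_fubini_F fi.
have eF : {ae m1, forall x, setT x -> fubini_F m2 (EFin \o f) x =
    (fine (\int[m2]_y (f (x, y))%:E)%E)%:E}.
  apply: filterS (ae_integrable1 fi) => x ix _.
  by rewrite fineK//; exact: integrable_fin_num.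
have mF : measurable_fun setT (fun x => (fine (\int[m2]_y (f (x, y))%:E)%E)%:E).
  apply/measurable_EFinP; apply: measurableT_comp => //.
  exact: (measurable_int _ iF).
have ie : (\int[m1]_x fubini_F m2 (EFin \o f) x =
    \int[m1]_x (fine (\int[m2]_y (f (x, y))%:E)%E)%:E)%E.
  by apply: ae_eq_integral => //; exact: (measurable_int _ iF).
split; last by rewrite -ie integral12_prod_meas1.
apply/integrableP; split=> //; move/integrableP : iF => [m0]; apply: le_lt_trans.
rewrite le_eqVlt; apply/orP; left; apply/eqP; apply: ae_eq_integral => //.
- exact: measurableT_comp.
- exact: measurableT_comp.
- by apply: filterS eF => x /(_ I) h _; rewrite h.
Qed.

Lemma C_Fubini (f : T1 * T2 -> R[i]) : Cintegrable (m1 \x m2)%E setT f ->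
  [/\ {ae m1, forall x, Cintegrable m2 setT (fun y => f (x, y))},
      Cintegrable m1 setT (fun x => Cintegral m2 setT (fun y => f (x, y))) &
      Cintegral (m1 \x m2)%E setT f =
      Cintegral m1 setT (fun x => Cintegral m2 setT (fun y => f (x, y)))].
Proof.
move=> [a b]; have [a1 a2] := fine_Fubini a; have [b1 b2] := fine_Fubini b.
split; first by apply: filterS2 (ae_integrable1 a) (ae_integrable1 b) => x.
- by split.
- by apply: complex_eq.
Qed.

Lemma integral_normc_prod (f : T1 -> R[i]) (g : T2 -> R[i]) :
  Cmeasurable f -> Cmeasurable g ->
  (\int[m1 \x m2]_p (normc (f p.1 * g p.2))%:E =
   \int[m1]_x (normc (f x))%:E * \int[m2]_y (normc (g y))%:E)%E.
Proof.
move=> mf mg; rewrite fubini_tonelli1; last 2 first.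
- apply/measurable_EFinP; apply: measurable_normc; apply: CmeasurableM.
  + exact: (Cmeasurable_comp mf).
  + exact: (Cmeasurable_comp mg).
- by move=> p; rewrite lee_fin normc_ge0.
have gE : (0 <= \int[m2]_y (normc (g y))%:E)%E.
  by apply: integral_ge0 => y _; rewrite lee_fin normc_ge0.
rewrite muleC -ge0_integralZl//.
- apply: eq_integral => x _; rewrite /fubini_F muleC.
  transitivity (\int[m2]_y ((normc (f x))%:E * (normc (g y))%:E))%E.
    by apply: eq_integral => y _; rewrite /= normcM.
  rewrite ge0_integralZl_EFin ?normc_ge0 1?muleC//.
  + by move=> y _; rewrite lee_fin normc_ge0.
  + by apply/measurable_EFinP; exact: measurable_normc.
- by apply/measurable_EFinP; exact: measurable_normc.
- by move=> y _; rewrite lee_fin normc_ge0.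
Qed.

Lemma Cintegral_prod (f : T1 -> R[i]) (g : T2 -> R[i]) :
  Cintegrable m1 setT f -> Cintegrable m2 setT g ->
  Cintegrable (m1 \x m2)%E setT (fun p => f p.1 * g p.2) /\
  Cintegral (m1 \x m2)%E setT (fun p => f p.1 * g p.2) =
  Cintegral m1 setT f * Cintegral m2 setT g.
Proof.
move=> fi gi; have mf := Cintegrable_measurable fi.
have mg := Cintegrable_measurable gi.
have fgi : Cintegrable (m1 \x m2)%E setT (fun p => f p.1 * g p.2).
  apply/CintegrableP; split.
    apply: CmeasurableM.
    + exact: (Cmeasurable_comp mf).
    + exact: (Cmeasurable_comp mg).
  rewrite integral_normc_prod// lte_mul_pinfty//.
  - by apply: integral_ge0 => y _; rewrite lee_fin normc_ge0.
  - by rewrite integrable_fin_num//; exact: Cintegrable_normc.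
  - by case/CintegrableP : gi.
split=> //; have [_ _ ->] := C_Fubini fgi.
rewrite mulrC -CintegralZ//; apply: eq_Cintegral => x _ /=.
by rewrite CintegralZ// mulrC.
Qed.

Lemma ae_prod_fst (P : T1 -> Prop) : {ae m1, forall x, P x} ->
  {ae (m1 \x m2)%E, forall p, P p.1}.
Proof.
move=> [N [mN N0 NP]]; exists (N `*` setT); split; first exact: measurableX.
  by transitivity (m1 N * m2 setT)%E; [exact: product_measure1E|rewrite N0 mul0e].
by move=> p /= nP; split=> //; apply: NP.
Qed.

Lemma ae_prod_snd (P : T2 -> Prop) : {ae m2, forall x, P x} ->
  {ae (m1 \x m2)%E, forall p, P p.2}.
Proof.
move=> [N [mN N0 NP]]; exists (setT `*` N); split; first exact: measurableX.
  by transitivity (m1 setT * m2 N)%E; [exact: product_measure1E|rewrite N0 mule0].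
by move=> p /= nP; split=> //; apply: NP.
Qed.

Lemma ae_section (P : T1 * T2 -> Prop) : {ae (m1 \x m2)%E, forall p, P p} ->
  {ae m1, forall x, {ae m2, forall y, P (x, y)}}.
Proof.
move=> [N [mN N0 NP]].
have : {ae m1, forall x, setT x -> (m2 \o xsection N) x = 0%E}.
  apply/(ae_eq_integral_abs _ measurableT _).1 => //.
    exact: measurable_fun_xsection.
  rewrite -[RHS]N0; apply: eq_integral => x _ /=.
  by rewrite gee0_abs.
apply: filterS => x /(_ I) /= h; exists (xsection N x); split => //.
  exact: measurable_xsection.
by move=> y /= nP; rewrite /xsection /= inE; apply: NP.
Qed.

(** Null sections say nothing about a set that is not measurable in the product, hence the
    measurable cover [N]. *)
Lemma ae_of_section (P : T1 * T2 -> Prop) (N : set (T1 * T2)) :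
  measurable N -> ~` [set p | P p] `<=` N ->
  {ae m1, forall x, m2 (xsection N x) = 0%E} ->
  {ae (m1 \x m2)%E, forall p, P p}.
Proof.
move=> mN PN h; exists N; split => //.
rewrite /product_measure1 (ae_eq_integral (cst 0%E)) ?integral0//.
- exact: measurable_fun_xsection.
- by apply: filterS h.
Qed.

End ProductIntegral.

(** Swapping the coordinates turns one product into the product that slices along the other
    variable, and the two coincide by uniqueness. *)
Lemma ae_swap (R : realType) d1 d2 (T1 : measurableType d1) (T2 : measurableType d2)
    (m1 : {sigma_finite_measure set T1 -> \bar R})
    (m2 : {sigma_finite_measure set T2 -> \bar R}) (P : T1 * T2 -> Prop) :
  {ae (m1 \x m2)%E, forall p, P p} -> {ae (m2 \x m1)%E, forall p, P (p.2, p.1)}.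
Proof.
move=> [N [mN N0 NP]].
pose swap (p : T2 * T1) := (p.2, p.1).
have mswap : measurable_fun setT swap by exact: measurable_fun_pair.
have mN' : measurable (swap @^-1` N).
  by rewrite -[X in measurable X]setTI; exact: mswap.
exists (swap @^-1` N); split => //; last by move=> p /= nP; apply: NP.
have -> : (m2 \x m1)%E (swap @^-1` N) = (m1 \x^ m2)%E N.
  rewrite /product_measure1 /product_measure2; apply: eq_integral => y _ /=.
  by congr (m1 _); apply/seteqP; split => x; rewrite /xsection/ysection /= !inE.
rewrite -[RHS]N0; apply/esym/product_measure_unique => // A B mA mB.
by rewrite /= product_measure2E.
Qed.

Lemma Cintegral_pushforward (R : realType) d1 d2 (T1 : measurableType d1)
    (T2 : measurableType d2) (mu : {measure set T1 -> \bar R}) (phi : T1 -> T2)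
    (f : T2 -> R[i]) : measurable_fun setT phi -> Cmeasurable f ->
  Cintegrable mu setT (f \o phi) ->
  Cintegrable (pushforward mu phi) setT f /\
  Cintegral (pushforward mu phi) setT f = Cintegral mu setT (f \o phi).
Proof.
move=> mphi [/measurable_EFinP ma /measurable_EFinP mb] [a b]; split.
- split; first exact: (integrable_pushforward mphi ma a measurableT).
  exact: (integrable_pushforward mphi mb b measurableT).
- rewrite /Cintegral; congr Complex; congr fine.
  + exact: (integral_pushforward mphi ma a measurableT).
  + exact: (integral_pushforward mphi mb b measurableT).
Qed.

(** * Power measures *)

Section PowerMeasure.
Context {R : realType} d {T : measurableType d}.
Variable mu : {sigma_finite_measure set T -> \bar R}.

Definition tcons m (p : T * m.-tuple T) : m.+1.-tuple T := [tuple of p.1 :: p.2].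

Lemma measurable_tcons m : measurable_fun setT (@tcons m).
Proof. exact: measurable_cons. Qed.

Let tuncons m (x : m.+1.-tuple T) : T * m.-tuple T :=
  (thead x, [tuple of behead x]).

Let tconsK m : cancel (@tcons m) (@tuncons m).
Proof. by case=> x t; congr pair; apply: val_inj. Qed.

Let tunconsK m : cancel (@tuncons m) (@tcons m).
Proof. by move=> x; rewrite [RHS]tuple_eta. Qed.

Let measurable_tuncons m : measurable_fun setT (@tuncons m).
Proof.
apply: measurable_fun_pair; first exact: measurable_tnth.
exact: measurable_behead.
Qed.

Lemma measurable_tcons_image m (N : set (T * m.-tuple T)) :
  measurable N -> measurable (@tcons m @` N).
Proof.
move=> mN; rewrite (_ : _ @` _ = @tuncons m @^-1` N).
  by rewrite -[X in measurable X]setTI; exact: measurable_tuncons.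
apply/seteqP; split => [x [p Np <-]|x Nx]; first by rewrite /= tconsK.
by exists (tuncons x) => //; exact: tunconsK.
Qed.

(** [power_measure] is a bare set function. That it is a measure and that it is sigma-finite go
    through one induction, because each product needs its tail to be a sigma-finite measure
    already. *)
Lemma power_measure_sigma_finite m :
  exists nu : {sigma_finite_measure set (m.-tuple T) -> \bar R},
    (nu : set (m.-tuple T) -> \bar R) = power_measure mu m.
Proof.
elim: m => [|m [nu nuE]]; first by exists (\d_ ([tuple] : 0.-tuple T)).
rewrite /= -nuE.
have /= [F TF mF] : sigma_finite setT (mu \x nu)%E by exact: product_sigma_finite.
have := @sigma_finite_measureP _ _ _ (pushforward (mu \x nu)%E (@tcons m)).
apply; first exact: measurable_tcons.
exists (fun n => @tcons m @` F n).
  apply/seteqP; split => // x _; have : setT (tuncons x) by [].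
  by rewrite TF => -[n _ Fn]; exists n => //; exists (tuncons x) => //; exact: tunconsK.
move=> n; have [mFn Fny] := mF n; split; first exact: measurable_tcons_image.
change ((mu \x nu)%E (@tcons m @^-1` (@tcons m @` F n)) < +oo)%E.
rewrite (_ : _ @^-1` _ = F n)//.
apply/seteqP; split => [p [q Fq /(can_inj (@tconsK m)) <-]//|p Fp].
by exists p.
Qed.

Definition power_sfm m : {sigma_finite_measure set (m.-tuple T) -> \bar R} :=
  sval (cid (power_measure_sigma_finite m)).

Lemma power_sfmE m : (power_sfm m : set _ -> \bar R) = power_measure mu m.
Proof. exact: (svalP (cid (power_measure_sigma_finite m))). Qed.

Lemma power_sfmS m :
  (power_sfm m.+1 : set _ -> \bar R) = pushforward (mu \x power_sfm m)%E (@tcons m).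
Proof. by rewrite !power_sfmE. Qed.

Lemma power_sfm0 : (power_sfm 0 : set _ -> \bar R) = \d_ ([tuple] : 0.-tuple T).
Proof. by rewrite power_sfmE. Qed.

Lemma Cintegral_tcons m (f : m.+1.-tuple T -> R[i]) : Cmeasurable f ->
  Cintegrable (mu \x power_sfm m)%E setT (f \o @tcons m) ->
  Cintegrable (power_sfm m.+1) setT f /\
  Cintegral (power_sfm m.+1) setT f =
  Cintegral (mu \x power_sfm m)%E setT (f \o @tcons m).
Proof.
move=> mf fi; rewrite power_sfmS.
have := @Cintegral_pushforward R _ _ (T * m.-tuple T)%type (m.+1.-tuple T)
  (mu \x power_sfm m)%E (@tcons m) f.
by apply; [exact: measurable_tcons|exact: mf|exact: fi].
Qed.

Lemma Cintegral_tuple_prod m (g : 'I_m -> T -> R[i]) :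
  (forall i, Cintegrable mu setT (g i)) ->
  Cintegrable (power_sfm m) setT (fun x => \prod_i g i (tnth x i)) /\
  Cintegral (power_sfm m) setT (fun x => \prod_i g i (tnth x i)) =
  \prod_i Cintegral mu setT (g i).
Proof.
elim: m g => [|m ih] g gi.
  under eq_fun do rewrite big_ord0.
  rewrite big_ord0 power_sfm0; split; last first.
    rewrite /Cintegral !integral_dirac// !diracE !in_setT !mul1e.
    by apply: complex_eq.
  apply/CintegrableP; split; first exact: Cmeasurable_cst.
  by rewrite integral_dirac//= diracE in_setT mul1e ltry.
have [i1 e1] := ih (fun i => g (lift ord0 i)) (fun i => gi _).
have [i2 e2] := Cintegral_prod (gi ord0) i1.
have E : (fun x : m.+1.-tuple T => \prod_i g i (tnth x i)) \o @tcons m =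
    (fun p => g ord0 p.1 * \prod_(i < m) g (lift ord0 i) (tnth p.2 i)).
  apply/funext => p; rewrite /= big_ord_recl; congr (g ord0 _ * _).
  by apply: eq_bigr => i _; rewrite tnthS.
have [|//|] := @Cintegral_tcons m (fun x => \prod_i g i (tnth x i)).
- apply: Cmeasurable_prod => i; apply: (Cmeasurable_comp (Cintegrable_measurable (gi i))).
  exact: measurable_tnth.
- by rewrite E.
by rewrite E e2 big_ord_recl e1.
Qed.

Lemma ae_tcons m (P : m.+1.-tuple T -> Prop) :
  {ae (mu \x power_sfm m)%E, forall p, P (tcons p)} ->
  {ae power_sfm m.+1, forall x, P x}.
Proof.
move=> [N [mN N0 NP]]; exists (@tcons m @` N); split.
- exact: measurable_tcons_image.
- rewrite power_sfmS /pushforward -N0; congr (_ _).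
  apply/seteqP; split => [p [q Nq /(can_inj (@tconsK m)) <-]//|p Np].
  by exists p.
- move=> x /= nP; exists (tuncons x); last exact: tunconsK.
  by apply: NP => /=; rewrite tunconsK.
Qed.

Lemma ae_tnth m (P : T -> Prop) (i : 'I_m) :
  {ae mu, forall x, P x} -> {ae power_sfm m, forall x, P (tnth x i)}.
Proof.
elim: m i => [[]//|m ih] i h; apply: ae_tcons.
case: (unliftP ord0 i) => [j|] ->.
  have := ae_prod_snd mu (ih j h); apply: filterS => p.
  by rewrite tnthS.
by have := ae_prod_fst (power_sfm m) h; apply: filterS.
Qed.

(** As [mu] may be infinite, two coordinates need not have [mu \x mu] as image measure, but null
    sets still pull back to null sets. If one coordinate is the head, slice along it, after
    [ae_swap] when the head comes second; otherwise use induction. *)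
Lemma ae_tnth2 m (P : T * T -> Prop) (i j : 'I_m) : i != j ->
  {ae (mu \x mu)%E, forall p, P p} ->
  {ae power_sfm m, forall x, P (tnth x i, tnth x j)}.
Proof.
have head m' (Q : T * T -> Prop) (k : 'I_m') : {ae (mu \x mu)%E, forall p, Q p} ->
    {ae (mu \x power_sfm m')%E, forall p, Q (p.1, tnth p.2 k)}.
  move=> [N [mN N0 NQ]].
  pose phi (p : T * m'.-tuple T) := (p.1, tnth p.2 k).
  have mphi : measurable_fun setT phi.
    apply: measurable_fun_pair => //.
    by apply: (measurableT_comp (measurable_tnth k)).
  apply: (@ae_of_section _ _ _ _ _ mu (power_sfm m') _ (phi @^-1` N)).
  - by rewrite -[X in measurable X]setTI; exact: mphi.
  - by move=> p /= nQ; apply: NQ.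
  have : {ae (mu \x mu)%E, forall p, ~ N p}.
    by exists N; split => // p /= /contrapT.
  move/ae_section; apply: filterS => x /(ae_tnth k) [M [mM M0 MN]].
  apply/negligibleP.
    apply: measurable_xsection.
    by rewrite -[X in measurable X]setTI; exact: mphi.
  exists M; split => // t; rewrite /xsection /= inE => Nt.
  by apply: MN => /= /(_ Nt).
move=> ij h; elim: m i j ij => [[]//|m ih] i j ij; apply: ae_tcons.
case: (unliftP ord0 i) (unliftP ord0 j) ij => [i'|] -> [j'|] -> ij.
- have ij' : i' != j' by apply: contra_neq ij => ->.
  have := ae_prod_snd mu (ih i' j' ij'); apply: filterS => p.
  by rewrite !tnthS.
- have := head m (fun q => P (q.2, q.1)) i' (ae_swap h).
  by apply: filterS => p /=; rewrite tnthS.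
- have := head m P j' h.
  by apply: filterS => p /=; rewrite tnthS.
- by rewrite eqxx in ij.
Qed.

End PowerMeasure.

(** * Integrals of cyclic products *)

Section SquareIntegrable.
Context {R : realType} d {T : measurableType d}.
Variable mu : {measure set T -> \bar R}.
Implicit Types f g : T -> R[i].

(** Equivalent to [L2] by [L2P], but free of the exponent 1/2 in the norm. *)
Definition sqint f : Prop :=
  Cmeasurable f /\ (\int[mu]_x (normc (f x) ^+ 2)%:E < +oo)%E.

Lemma sqint_integrable f : sqint f ->
  mu.-integrable setT (fun x => (normc (f x) ^+ 2)%:E).
Proof.
move=> [mf fi]; apply/integrableP; split.
  by apply/measurable_EFinP/measurable_funX/measurable_normc.
by under eq_integral do rewrite /= ger0_norm ?sqr_ge0//.
Qed.

Lemma sqintP f h : Cmeasurable f -> mu.-integrable setT (EFin \o h) ->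
  (forall x, normc (f x) ^+ 2 <= h x) -> sqint f.
Proof.
move=> mf /integrableP[mh hi] fh; split => //; apply: le_lt_trans hi.
apply: ge0_le_integral => //.
- by move=> x _; rewrite lee_fin sqr_ge0.
- by apply/measurable_EFinP/measurable_funX/measurable_normc.
- by apply: measurableT_comp.
- by move=> x _; rewrite lee_fin (le_trans (fh x))// ler_norm.
Qed.

Lemma Cintegrable_mul_conj f g : sqint f -> sqint g ->
  Cintegrable mu setT (fun x => f x * (g x)^*).
Proof.
move=> fi gi; apply: (le_Cintegrable (h := fun x => normc (f x) ^+ 2 + normc (g x) ^+ 2)).
- by apply: CmeasurableM; [case: fi|apply: Cmeasurable_conj; case: gi].
- rewrite (_ : _ \o _ = (fun x => (normc (f x) ^+ 2)%:E) \+
      (fun x => (normc (g x) ^+ 2)%:E))%E//.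
  by apply: integrableD => //; exact: sqint_integrable.
- move=> x; rewrite normcM normc_conj.
  have := sqr_ge0 (normc (f x) - normc (g x)).
  by have := mulr_ge0 (normc_ge0 (f x)) (normc_ge0 (g x)); nra.
Qed.

Lemma sqint_indic (A : set T) f : measurable A -> sqint f ->
  sqint (fun x => (\1_A x : R)%:C * f x).
Proof.
move=> mA fi; apply: (sqintP (h := fun x => normc (f x) ^+ 2)).
- by apply: CmeasurableM; [exact: Cmeasurable_indic|case: fi].
- exact: sqint_integrable.
- move=> x; rewrite normcM normc_real indicE.
  by case: (_ \in _); rewrite ?normr1 ?mul1r// normr0 mul0r expr0n/= sqr_ge0.
Qed.

End SquareIntegrable.

Lemma Cauchy_Schwarz_sum (R : realType) (s a b : nat -> R) n :
  (forall i, 0 <= s i) ->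
  (\sum_(i < n) s i * (a i * b i)) ^+ 2 <=
  (\sum_(i < n) s i * a i ^+ 2) * (\sum_(i < n) s i * b i ^+ 2).
Proof.
move=> s0; elim: n => [|n ih]; first by rewrite !big_ord0 mul0r expr0n.
rewrite !big_ord_recr /=.
set S := (\sum_(i < n) _) in ih *; set P := (\sum_(i < n) _) in ih *.
set Q := (\sum_(i < n) _) in ih *.
have P0 : 0 <= P by apply: sumr_ge0 => i _; rewrite mulr_ge0 ?sqr_ge0.
have Q0 : 0 <= Q by apply: sumr_ge0 => i _; rewrite mulr_ge0 ?sqr_ge0.
(* The cross term of the induction step: by [S ^+ 2 <= P * Q], its square is at most four times the
   product of the two summands on the right, hence at most the square of their sum. *)
have h : 2 * S * (a n * b n) <= P * b n ^+ 2 + Q * a n ^+ 2.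
  have h0 : 0 <= P * b n ^+ 2 + Q * a n ^+ 2 by rewrite addr_ge0// mulr_ge0 ?sqr_ge0.
  apply: (le_trans (ler_norm _)); rewrite -(ler_pXn2r (n := 2)) ?nnegrE//.
  rewrite real_normK ?num_real//.
  have h1 : (2 * S * (a n * b n)) ^+ 2 <= 4 * (P * b n ^+ 2) * (Q * a n ^+ 2).
    have -> : (2 * S * (a n * b n)) ^+ 2 = S ^+ 2 * (4 * (a n * b n) ^+ 2) by ring.
    have -> : 4 * (P * b n ^+ 2) * (Q * a n ^+ 2) =
              P * Q * (4 * (a n * b n) ^+ 2) by ring.
    by rewrite ler_wpM2r// mulr_ge0 ?sqr_ge0.
  apply: (le_trans h1); rewrite -subr_ge0.
  have -> : (P * b n ^+ 2 + Q * a n ^+ 2) ^+ 2 - 4 * (P * b n ^+ 2) * (Q * a n ^+ 2) =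
    (P * b n ^+ 2 - Q * a n ^+ 2) ^+ 2 by ring.
  exact: sqr_ge0.
have := ler_wpM2l (s0 n) h; nra.
Qed.

(** * Integrable domination of the kernel expansion *)

Section KernelExpansion.
Context {R : realType} d {T : measurableType d}.
Variable mu : {measure set T -> \bar R}.
Variables (s : nat -> R) (psi phi : nat -> T -> R[i]).
Hypothesis s0 : forall n, 0 <= s n.
Hypothesis s_cvg : cvgn (series s).
Hypothesis mpsi : forall n, Cmeasurable (psi n).
Hypothesis mphi : forall n, Cmeasurable (phi n).
Hypothesis psi1 : forall n, (\int[mu]_x (normc (psi n x) ^+ 2)%:E <= 1)%E.
Hypothesis phi1 : forall n, (\int[mu]_x (normc (phi n x) ^+ 2)%:E <= 1)%E.

Lemma sqint_psi n : sqint mu (psi n).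
Proof. by split => //; apply: le_lt_trans (psi1 n) (ltry _). Qed.

Lemma sqint_phi n : sqint mu (phi n).
Proof. by split => //; apply: le_lt_trans (phi1 n) (ltry _). Qed.

Definition partial_kernel M (x y : T) : R[i] :=
  \sum_(n < M) (s n)%:C * psi n x * (phi n y)^*.

(** Adding both parts gives a single function that dominates the expansion in either argument. *)
Let a n x : R := s n * (normc (psi n x) ^+ 2 + normc (phi n x) ^+ 2).

Let a0 n x : 0 <= a n x.
Proof. by rewrite mulr_ge0// addr_ge0 ?sqr_ge0. Qed.

Let ma n : measurable_fun setT (a n).
Proof.
apply: measurable_funM; first exact: measurable_cst.
by apply: measurable_funD; apply: measurable_funX; exact: measurable_normc.
Qed.

Let qe x : \bar R := (\sum_(n <oo) (a n x)%:E)%E.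

Let int_qe : (\int[mu]_x qe x < +oo)%E.
Proof.
rewrite integral_nneseries//; last 2 first.
- by move=> n; exact/measurable_EFinP.
- by move=> n x _; rewrite lee_fin.
(* The factor 2 comes from the two squares, each of integral at most 1. *)
apply: (@le_lt_trans _ _ (\sum_(n <oo) (s n * 2)%:E)%E).
  apply: lee_nneseries => [n _ _|n _].
    by apply: integral_ge0 => x _; rewrite lee_fin.
  under eq_integral do rewrite EFinM.
  have mn f : Cmeasurable f -> measurable_fun setT (fun x : T => (normc (f x : R[i]) ^+ 2)%:E).
    by move=> mf; apply/measurable_EFinP/measurable_funX/measurable_normc.
  rewrite ge0_integralZl_EFin//; last 2 first.
  - by move=> x _; rewrite lee_fin addr_ge0 ?sqr_ge0.
  - by apply/measurable_EFinP/measurable_funD; exact/measurable_EFinP/mn.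
  rewrite EFinM lee_wpmul2l ?lee_fin//.
  under eq_integral do rewrite EFinD.
  rewrite ge0_integralD//; try by [move=> x _; rewrite lee_fin sqr_ge0|exact: mn].
  by rewrite (_ : 2%:E = 1 + 1)%E ?leeD// -EFinD.
have h : cvgn (series (fun n => s n * 2)).
  rewrite (_ : series _ = (fun n => series s n * 2)); last first.
    by apply/funext => n; rewrite /series /= mulr_suml.
  by apply: is_cvgMl; exact: s_cvg.
move/cvg_ex : h => [l hl].
have -> : (\sum_(n <oo) (s n * 2)%:E)%E = l%:E.
  apply/cvg_lim => //.
  rewrite (_ : (fun _ => _) = EFin \o series (fun n => s n * 2)).
    by apply/cvg_EFin => //; exact: nearW.
  by apply/funext => n; rewrite /series /= sumEFin.
exact: ltry.
Qed.

Let mqe : measurable_fun setT qe.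
Proof.
apply: ge0_emeasurable_sum => [k x _ _|k _]; first by rewrite lee_fin.
exact/measurable_EFinP.
Qed.

Let qe0 x : (0 <= qe x)%E.
Proof. by apply: nneseries_ge0 => n _ _; rewrite lee_fin. Qed.

Let qe_integrable : mu.-integrable setT qe.
Proof.
apply/integrableP; split => //; under eq_integral do rewrite gee0_abs//.
exact: int_qe.
Qed.

(* The junk value 0 where the series diverges makes [kernel_dom] a bound only at the
   points of [dom_good]. *)
Definition kernel_dom x : R := fine (qe x).

Lemma kernel_dom_ge0 x : 0 <= kernel_dom x.
Proof. exact: fine_ge0. Qed.

Lemma measurable_kernel_dom : measurable_fun setT kernel_dom.
Proof. by apply: measurableT_comp. Qed.

Lemma kernel_dom_integrable : mu.-integrable setT (EFin \o kernel_dom).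
Proof.
apply/integrableP; split; first exact/measurable_EFinP/measurable_kernel_dom.
move: int_qe; apply: le_lt_trans; rewrite le_eqVlt; apply/orP; left; apply/eqP.
apply: ae_eq_integral => //.
- by do 2 apply: measurableT_comp => //; exact: measurable_kernel_dom.
- apply: filterS (integrable_ae measurableT qe_integrable) => x h _ /=.
  by rewrite ger0_norm ?kernel_dom_ge0// fineK// h.
Qed.

Definition dom_good x : Prop := forall M, \sum_(n < M) a n x <= kernel_dom x.

Lemma ae_dom_good : {ae mu, forall x, dom_good x}.
Proof.
apply: filterS (integrable_ae measurableT qe_integrable) => x h M.
rewrite -lee_fin /kernel_dom fineK ?h// -sumEFin.
have := @nneseries_lim_ge R (fun n => (a n x)%:E) xpredT 0 M.
by rewrite big_mkord; apply => n _ _; rewrite lee_fin.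
Qed.

Lemma measurable_dom_good : measurable [set x | dom_good x].
Proof.
rewrite (_ : [set x | _] =
    \bigcap_M [set x | \sum_(n < M) a n x <= kernel_dom x]); last first.
  by apply/seteqP; split => x /= h => [M _|M]; [exact: h|exact: (h M)].
apply: bigcapT_measurable => M; rewrite -[X in measurable X]setTI.
apply: (measurable_fun_ler _ measurable_kernel_dom measurableT) => //.
exact: measurable_sum.
Qed.

(** Cauchy-Schwarz with weights [s n]. The bound is on the absolute series because it also has to
    give convergence of the expansion at good points. *)
Lemma partial_kernel_abs_le M x y : dom_good x -> dom_good y ->
  \sum_(n < M) normc ((s n)%:C * psi n x * (phi n y)^*) <=
  Num.sqrt (kernel_dom x) * Num.sqrt (kernel_dom y).
Proof.
move=> gx gy; under eq_bigr => n _ do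
  rewrite !normcM normc_conj normc_real ger0_norm// -mulrA.
rewrite -sqrtrM ?kernel_dom_ge0//.
apply: (le_trans (ler_norm _)); rewrite -sqrtr_sqr; apply: ler_wsqrtr.
apply: (le_trans (Cauchy_Schwarz_sum (fun n => normc (psi n x))
  (fun n => normc (phi n y)) M s0)).
apply: ler_pM.
- by apply: sumr_ge0 => i _; rewrite mulr_ge0 ?sqr_ge0.
- by apply: sumr_ge0 => i _; rewrite mulr_ge0 ?sqr_ge0.
- apply: le_trans (gx M); apply: ler_sum => n _.
  by rewrite ler_wpM2l// lerDl sqr_ge0.
- apply: le_trans (gy M); apply: ler_sum => n _.
  by rewrite ler_wpM2l// lerDr sqr_ge0.
Qed.

Lemma partial_kernel_le M x y : dom_good x -> dom_good y ->
  normc (partial_kernel M x y) <=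
  Num.sqrt (kernel_dom x) * Num.sqrt (kernel_dom y).
Proof.
by move=> gx gy; apply: le_trans (partial_kernel_abs_le M gx gy); exact: normc_sum.
Qed.

Lemma sqr_sqrt_dom x : Num.sqrt (kernel_dom x) * Num.sqrt (kernel_dom x) = kernel_dom x.
Proof. by rewrite -expr2 sqr_sqrtr ?kernel_dom_ge0. Qed.

Lemma Cmeasurable_partial_kernel M :
  Cmeasurable (fun p : T * T => partial_kernel M p.1 p.2).
Proof.
apply: Cmeasurable_sum => n; apply: CmeasurableM; last first.
  by apply: Cmeasurable_conj; exact: (Cmeasurable_comp (mphi n)).
apply: CmeasurableM; first exact: Cmeasurable_cst.
exact: (Cmeasurable_comp (mpsi n)).
Qed.

End KernelExpansion.

Section CyclicProducts.
Context {R : realType} d {T : measurableType d}.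
Variable mu : {sigma_finite_measure set T -> \bar R}.
Variables (s : nat -> R) (psi phi : nat -> T -> R[i]).
Hypothesis s0 : forall n, 0 <= s n.
Hypothesis s_cvg : cvgn (series s).
Hypothesis mpsi : forall n, Cmeasurable (psi n).
Hypothesis mphi : forall n, Cmeasurable (phi n).
Hypothesis psi1 : forall n, (\int[mu]_x (normc (psi n x) ^+ 2)%:E <= 1)%E.
Hypothesis phi1 : forall n, (\int[mu]_x (normc (phi n x) ^+ 2)%:E <= 1)%E.
Variables (m : nat) (A : 'I_m -> set T) (k : T -> T -> R[i]).
Hypothesis mA : forall i, measurable (A i).
Hypothesis mk : Cmeasurable (fun p : T * T => k p.1 p.2).
Hypothesis k_diag : forall i, Cintegrable mu (A i) (fun x => k x x).
(** Asked on the products of the [A i] only: the expansion will come from a cut kernel, which agrees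
    with [k] there. *)
Hypothesis k_expansion : {ae (mu \x mu)%E, forall p, forall i j,
  A i p.1 -> A j p.2 -> Ccvg (fun M => partial_kernel s psi phi M p.1 p.2) (k p.1 p.2)}.

Let q := kernel_dom s psi phi.

Definition box : set (m.-tuple T) := [set x | forall i, A i (tnth x i)].

(* A fixed point i of [sg] contributes the whole diagonal integral [e i], with its
   summation index pinned to [ord0]: the expansion of the kernel holds only almost
   everywhere on the product and may fail on the diagonal. *)
Definition cyc_approx (sg : 'S_m) (e : 'I_m -> R[i]) (G : 'I_m -> nat -> nat -> R[i])
    (M : nat) : R[i] :=
  \sum_(f : {ffun 'I_m -> 'I_M.+1}) \prod_i
    if sg i == i then (f i == ord0)%:R * e i
    else (s (f i))%:C * G i (f i) (f (perm_inv sg i)).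

Let ind (x : m.-tuple T) : R[i] := \prod_i (\1_(A i) (tnth x i) : R)%:C.

Let indE x : ind x = (\1_box x : R)%:C.
Proof.
rewrite /ind indicE; case: (boolP (x \in box)) => [|/negP].
  rewrite inE => h; rewrite big1// => i _; rewrite indicE mem_set//.
move=> h; have [i nAi] : exists i, ~ A i (tnth x i).
  by apply: contrapT => /forallNP h'; apply: h; rewrite inE => i; exact: contrapT.
by rewrite (bigD1 i)//= indicE memNset//= mul0r.
Qed.

Lemma measurable_box : measurable box.
Proof.
rewrite (_ : box = \big[setI/setT]_i [set x | A i (tnth x i)]); last first.
  apply/seteqP; split => [x h|x]; first by rewrite -bigcap_seq => i _; exact: h.
  by rewrite -bigcap_seq => h i; apply: h; rewrite /= mem_index_enum.
apply: bigsetI_measurable => i _; rewrite -[X in measurable X]setTI.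
exact: measurable_tnth.
Qed.

Section FixedPermutation.
Variable sg : 'S_m.

Let cyc x : R[i] := \prod_i k (tnth x i) (tnth x (sg i)).

Let fac M x i : R[i] :=
  if sg i == i then k (tnth x i) (tnth x i)
  else partial_kernel s psi phi M (tnth x i) (tnth x (sg i)).

(** [U] and [V] separate the two arguments of a factor, term by term in the expansion. At a fixed
    point the sum degenerates to the term of index 0, which carries the whole diagonal value; the
    length [M.+1] ensures that this index exists. *)
Let U i n y : R[i] := if sg i == i then (n == 0%N)%:R * k y y else (s n)%:C * psi n y.
Let V i n y : R[i] := if sg i == i then 1 else (phi n y)^*.

Let facE M x i : fac M.+1 x i =
  \sum_(n < M.+1) U i n (tnth x i) * V i n (tnth x (sg i)).
Proof.
rewrite /fac /U /V; case: ifPn => _ //.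
rewrite big_ord_recl /= mul1r mulr1 big1 ?addr0// => n _.
by rewrite mul0r mul0r.
Qed.

(** All that depends on the i-th coordinate once the product of sums is expanded: [U] from its own
    factor, and [V] from the factor of its predecessor under [sg]. *)
Let g M (f : {ffun 'I_m -> 'I_M.+1}) i y : R[i] :=
  (\1_(A i) y : R)%:C * (U i (f i) y * V (perm_inv sg i) (f (perm_inv sg i)) y).

Let sg_fix i : (sg (perm_inv sg i) == perm_inv sg i) = (sg i == i).
Proof.
rewrite permKV; apply/eqP/eqP => [h|h]; first by rewrite {1}h permKV.
by apply: (@perm_inj _ sg); rewrite permKV h.
Qed.

Let cyc_expand M x : ind x * \prod_i fac M.+1 x i =
  \sum_(f : {ffun 'I_m -> 'I_M.+1}) \prod_i g f i (tnth x i).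
Proof.
under [X in _ * X]eq_bigr do rewrite facE.
rewrite bigA_distr_bigA mulr_sumr; apply: eq_bigr => f _.
rewrite [X in _ * X]big_split /=.
rewrite [X in _ * (_ * X)](reindex_inj (@perm_inj _ (perm_inv sg)))/=.
rewrite -!big_split; apply: eq_bigr => i _ /=.
by rewrite /g permKV.
Qed.

Let g_integral M (f : {ffun 'I_m -> 'I_M.+1}) i :
  Cintegrable mu setT (g f i) /\
  Cintegral mu setT (g f i) =
    if sg i == i then (f i == ord0)%:R * Cintegral mu (A i) (fun x => k x x)
    else (s (f i))%:C *
      Cintegral mu (A i) (fun x => psi (f i) x * (phi (f (perm_inv sg i)) x)^*).
Proof.
rewrite /g /U /V sg_fix; case: ifPn => _.
  have -> : (fun y => (\1_(A i) y : R)%:C * ((nat_of_ord (f i) == 0%N)%:R * k y y * 1)) =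
      (fun y => (f i == ord0)%:R * ((\1_(A i) y : R)%:C * k y y)).
    by apply/funext => y; rewrite mulr1 mulrCA.
  have ki := (Cintegrable_mkcond _ (fun x => k x x) (mA i)).1 (k_diag i).
  split; first exact: CintegrableZ.
  by rewrite CintegralZ// -Cintegral_mkcond.
set n := f i; set n' := f _.
have -> : (fun y => (\1_(A i) y : R)%:C * ((s n)%:C * psi n y * (phi n' y)^*)) =
    (fun y => (s n)%:C * ((\1_(A i) y : R)%:C * psi n y * (phi n' y)^*)).
  by apply/funext => y; ring.
have fi : Cintegrable mu setT (fun y => (\1_(A i) y : R)%:C * psi n y * (phi n' y)^*).
  apply: Cintegrable_mul_conj; last exact: sqint_phi.
  by apply: sqint_indic => //; exact: sqint_psi.
split; first exact: CintegrableZ.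
rewrite CintegralZ// [in RHS]Cintegral_mkcond; congr (_ * _).
by apply: eq_Cintegral => y _; rewrite mulrA.
Qed.

(** A fixed point keeps its diagonal value as bound, since [q] dominates the partial sums but not
    [k] on the diagonal. *)
Let cyc_dom (x : m.-tuple T) : R :=
  \prod_i if sg i == i then normc ((\1_(A i) (tnth x i) : R)%:C * k (tnth x i) (tnth x i))
          else q (tnth x i).

Let cyc_dom_integrable : (power_sfm mu m).-integrable setT (EFin \o cyc_dom).
Proof.
pose h i y : R := if sg i == i then normc ((\1_(A i) y : R)%:C * k y y) else q y.
have hi i : Cintegrable mu setT (fun y => (h i y)%:C).
  split => /=; last exact: integrable0.
  rewrite /h; case: (boolP (sg i == i)) => _.
  - by apply: Cintegrable_normc; exact: (Cintegrable_mkcond _ (fun x => k x x) (mA i)).1.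
  - exact: kernel_dom_integrable.
have [[+ _] _] := Cintegral_tuple_prod hi.
by under eq_fun do rewrite -rmorph_prod.
Qed.

Let partial_cyc_le M x : (forall i, dom_good s psi phi (tnth x i)) ->
  normc (ind x * \prod_i fac M x i) <= cyc_dom x.
Proof.
move=> gx; rewrite /ind -big_split /= normc_prod.
pose u i : R := if sg i == i then normc ((\1_(A i) (tnth x i) : R)%:C * k (tnth x i) (tnth x i))
   else Num.sqrt (q (tnth x i)).
pose v i j : R := if sg i == i then 1 else Num.sqrt (q (tnth x j)).
apply: (@le_trans _ _ (\prod_i (u i * v i (sg i)))).
  apply: ler_prod => i _; rewrite normc_ge0 /= /u /v /fac.
  case: ifPn => _; first by rewrite mulr1.
  rewrite normcM normc_real; apply: le_trans (partial_kernel_le _ M (gx _) (gx _)) => //.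
  rewrite ler_piMl ?normc_ge0// indicE.
  by case: (_ \in _); rewrite ?normr1 ?normr0.
(* Move each second square root to the coordinate on which it depends, where it meets the first
   one. *)
rewrite big_split /= [X in _ * X](reindex_inj (@perm_inj _ (perm_inv sg)))/=.
rewrite -big_split /= le_eqVlt; apply/orP; left; apply/eqP.
apply: eq_bigr => i _; rewrite /u /v sg_fix permKV.
by case: ifPn => _; rewrite ?mulr1// sqr_sqrt_dom.
Qed.

Let ae_good : {ae power_sfm mu m, forall x, forall i, dom_good s psi phi (tnth x i)}.
Proof.
apply: filter_forall => i; apply: ae_tnth.
exact: ae_dom_good.
Qed.

Let ae_expansion : {ae power_sfm mu m, forall x, forall i, sg i != i ->
  forall i' j', A i' (tnth x i) -> A j' (tnth x (sg i)) ->
  Ccvg (fun M => partial_kernel s psi phi M (tnth x i) (tnth x (sg i)))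
    (k (tnth x i) (tnth x (sg i)))}.
Proof.
apply: filter_forall => i; have [_|sgi] := eqVneq (sg i) i; first exact: nearW.
have isg : i != sg i by rewrite eq_sym.
by have := ae_tnth2 isg k_expansion; apply: filterS => x h _; exact: h.
Qed.

Let Cmeasurable_cyc : Cmeasurable (fun x => ind x * cyc x).
Proof.
apply: CmeasurableM; apply: Cmeasurable_prod => i.
  apply: (Cmeasurable_comp (Cmeasurable_indic (mA i))); exact: measurable_tnth.
apply: (@Cmeasurable_comp _ _ _ _ _ (fun p : T * T => k p.1 p.2)
  (fun x : m.-tuple T => (tnth x i, tnth x (sg i)))) => //.
by apply: measurable_fun_pair; exact: measurable_tnth.
Qed.

(** Dominated convergence on the power space reduces the integral to finite sums of products of
    one-variable functions, which Fubini factors into the diagonal and Gram integrals of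
    [cyc_approx]. *)
Lemma cyc_integral :
  Cintegrable (power_sfm mu m) setT (fun x => (\1_box x : R)%:C * cyc x) /\
  Ccvg (cyc_approx sg (fun i => Cintegral mu (A i) (fun x => k x x))
         (fun i n n' => Cintegral mu (A i) (fun x => psi n x * (phi n' x)^*)))
    (Cintegral (power_sfm mu m) setT (fun x => (\1_box x : R)%:C * cyc x)).
Proof.
under eq_fun do rewrite -indE.
rewrite (_ : cyc_approx _ _ _ =
    fun M => Cintegral (power_sfm mu m) setT (fun x => ind x * \prod_i fac M.+1 x i)).
  apply: (C_dominated_convergence (h := cyc_dom)) => //.
  - move=> M; under eq_fun do rewrite cyc_expand.
    apply: Cmeasurable_sum => f; apply: Cmeasurable_prod => i.
    have [/Cintegrable_measurable gf _] := g_integral f i.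
    by apply: (Cmeasurable_comp gf); exact: measurable_tnth.
  - apply: filterS ae_expansion => x hx.
    have [xA|nxA] := pselect (forall i, A i (tnth x i)); last first.
      have -> : ind x = 0 by rewrite indE indicE memNset.
      rewrite mul0r (_ : (fun _ => _) = fun=> 0); first exact: Ccvg_cst.
      by apply/funext => M; rewrite mul0r.
    apply: CcvgM; first exact: Ccvg_cst.
    apply: Ccvg_prod => i _; rewrite /fac.
    have [sgi|sgi] := eqVneq (sg i) i; first by rewrite sgi; exact: Ccvg_cst.
    have [a b] := hx i sgi i (sg i) (xA _) (xA _).
    (* The factors are taken at [M.+1], so the limits are shifted by one. *)
    by split; [rewrite -(cvg_shiftS) in a|rewrite -(cvg_shiftS) in b].
  - by apply: filterS ae_good => x gx M; exact: partial_cyc_le.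
apply/funext => M.
rewrite (_ : (fun x => ind x * _) = (fun x =>
    \sum_(f : {ffun 'I_m -> 'I_M.+1}) \prod_i g f i (tnth x i))); last first.
  by apply/funext => x; exact: cyc_expand.
rewrite Cintegral_sum => [|f _].
  apply: eq_bigr => f _.
  have [_ ->] := Cintegral_tuple_prod (fun i => (g_integral f i).1).
  by apply: eq_bigr => i _; rewrite (g_integral f i).2.
by have [] := Cintegral_tuple_prod (fun i => (g_integral f i).1).
Qed.

End FixedPermutation.

Variable alpha : R.

Lemma det_alpha_integral :
  let F := fun x : m.-tuple T =>
    det_alpha alpha (\matrix_(i < m, j < m) k (tnth x i) (tnth x j)) in
  Cintegrable (power_sfm mu m) box F /\
  Ccvg (fun M => \sum_(sg : 'S_m) (alpha ^+ (m - #|porbits sg|))%:C *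
      cyc_approx sg (fun i => Cintegral mu (A i) (fun x => k x x))
        (fun i n n' => Cintegral mu (A i) (fun x => psi n x * (phi n' x)^*)) M)
    (Cintegral (power_sfm mu m) box F).
Proof.
have E : (fun x => (\1_box x : R)%:C * det_alpha alpha
      (\matrix_(i < m, j < m) k (tnth x i) (tnth x j))) =
    (fun x => \sum_(sg : 'S_m) (alpha ^+ (m - #|porbits sg|))%:C *
      ((\1_box x : R)%:C * \prod_i k (tnth x i) (tnth x (sg i)))).
  apply/funext => x; rewrite /det_alpha mulr_sumr; apply: eq_bigr => sg _.
  by rewrite mulrCA; congr (_ * (_ * _)); apply: eq_bigr => i _; rewrite mxE.
split.
  apply/Cintegrable_mkcond; first exact: measurable_box.
  rewrite E; apply: Cintegrable_sum => sg _; apply: CintegrableZ.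
  by have [] := cyc_integral sg.
rewrite Cintegral_mkcond E Cintegral_sum; last first.
  by move=> sg _; apply: CintegrableZ; have [] := cyc_integral sg.
apply: Ccvg_sum => sg _; rewrite CintegralZ; last by have [] := cyc_integral sg.
by apply: CcvgM; [exact: Ccvg_cst|have [] := cyc_integral sg].
Qed.

End CyclicProducts.

(** * Orthonormal bases *)

Section L2Theory.
Context {R : realType} d {T : measurableType d}.
Variable mu : {measure set T -> \bar R}.
Implicit Types f g h : T -> R[i].

Definition normsq f : R := fine (\int[mu]_x (normc (f x) ^+ 2)%:E)%E.

Lemma normsq_ge0 f : 0 <= normsq f.
Proof. by apply/fine_ge0/integral_ge0 => x _; rewrite lee_fin sqr_ge0. Qed.

Let L2norm_pow f :
  L2norm mu f = ((\int[mu]_x (normc (f x) ^+ 2)%:E) `^ 2^-1)%E.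
Proof.
rewrite /L2norm unlock; congr poweR; apply: eq_integral => x _ /=.
by rewrite ger0_norm ?normc_ge0// powR_mulrn// normc_ge0.
Qed.

Lemma L2P f : L2 mu f <-> sqint mu f.
Proof.
rewrite /L2 /sqint L2norm_pow; split=> -[mf h]; split => //.
- by apply: lty_poweRy h; rewrite invr_neq0.
- exact: poweR_lty.
Qed.

Lemma sqint_fineK f : sqint mu f ->
  (\int[mu]_x (normc (f x) ^+ 2)%:E)%E = (normsq f)%:E.
Proof.
move=> [_ h]; rewrite /normsq fineK// ge0_fin_numE//.
by apply: integral_ge0 => x _; rewrite lee_fin sqr_ge0.
Qed.

Lemma L2normE f : sqint mu f -> L2norm mu f = (Num.sqrt (normsq f))%:E.
Proof.
move=> fi; rewrite L2norm_pow sqint_fineK//= powR12_sqrt//.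
exact: normsq_ge0.
Qed.

Lemma sqintD f g : sqint mu f -> sqint mu g -> sqint mu (fun x => f x + g x).
Proof.
move=> fi gi; apply: (sqintP (h := fun x => 2 * normc (f x) ^+ 2 + 2 * normc (g x) ^+ 2)).
- by apply: CmeasurableD; [case: fi|case: gi].
- rewrite (_ : _ \o _ = (fun x => 2%:E * (normc (f x) ^+ 2)%:E) \+
      (fun x => 2%:E * (normc (g x) ^+ 2)%:E))%E//.
  by apply: integrableD => //; apply: integrableZl => //; exact: sqint_integrable.
- move=> x; have := le_normcD (f x) (g x); have := sqr_ge0 (normc (f x) - normc (g x)).
  by have := normc_ge0 (f x + g x); nra.
Qed.

Lemma sqintZ (c : R[i]) f : sqint mu f -> sqint mu (fun x => c * f x).
Proof.
move=> fi; apply: (sqintP (h := fun x => normc c ^+ 2 * normc (f x) ^+ 2)).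
- by apply: CmeasurableM; [exact: Cmeasurable_cst|case: fi].
- rewrite (_ : _ \o _ = (fun x => (normc c ^+ 2)%:E * (normc (f x) ^+ 2)%:E))%E//.
  by apply: integrableZl => //; exact: sqint_integrable.
- by move=> x; rewrite normcM exprMn.
Qed.

Lemma sqint0 : sqint mu (fun=> 0).
Proof.
split; first exact: Cmeasurable_cst.
by under eq_integral do rewrite normc0 expr0n; rewrite integral0.
Qed.

Lemma sqintB f g : sqint mu f -> sqint mu g -> sqint mu (fun x => f x - g x).
Proof.
move=> fi gi; under eq_fun do rewrite -mulN1r.
by apply: sqintD => //; exact: sqintZ.
Qed.

Lemma sqint_sum I (r : seq I) (F : I -> T -> R[i]) :
  (forall i, sqint mu (F i)) -> sqint mu (fun x => \sum_(i <- r) F i x).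
Proof.
move=> h; elim: r => [|i r ih].
  by under eq_fun do rewrite big_nil; exact: sqint0.
by under eq_fun do rewrite big_cons; exact: sqintD.
Qed.

Lemma sqint_sum_seq (I : eqType) (r : seq I) (F : I -> T -> R[i]) :
  (forall i, i \in r -> sqint mu (F i)) -> sqint mu (fun x => \sum_(i <- r) F i x).
Proof.
move=> h; elim: r h => [|i r ih] h.
  by under eq_fun do rewrite big_nil; exact: sqint0.
under eq_fun do rewrite big_cons; apply: sqintD; first by apply: h; rewrite mem_head.
by apply: ih => j jr; apply: h; rewrite in_cons jr orbT.
Qed.

Lemma sqint_indicC (E : set T) : measurable E -> (mu E < +oo)%E ->
  sqint mu (fun x => (\1_E x : R)%:C).
Proof.
move=> mE Ey; split; first exact: Cmeasurable_indic.
rewrite (_ : (\int[mu]_x _)%E = mu E)//.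
rewrite -[E in RHS]setIT -integral_indic//; apply: eq_integral => x _.
by rewrite normc_real indicE; case: (_ \in _); rewrite ?normr1 ?normr0 ?expr1n ?expr0n.
Qed.

Lemma innerDl f g h : sqint mu f -> sqint mu g -> sqint mu h ->
  inner mu (fun x => f x + g x) h = inner mu f h + inner mu g h.
Proof.
move=> fi gi hi; rewrite /inner; under eq_fun do rewrite mulrDl.
by rewrite CintegralD//; exact: Cintegrable_mul_conj.
Qed.

Lemma innerZl c f h : sqint mu f -> sqint mu h ->
  inner mu (fun x => c * f x) h = c * inner mu f h.
Proof.
move=> fi hi; rewrite /inner; under eq_fun do rewrite -mulrA.
by rewrite CintegralZ//; exact: Cintegrable_mul_conj.
Qed.

Lemma inner_conj f g : sqint mu f -> sqint mu g -> inner mu f g = (inner mu g f)^*.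
Proof.
move=> fi gi; rewrite /inner -Cintegral_conj; last exact: Cintegrable_mul_conj.
by apply: eq_Cintegral => x _; rewrite rmorphM /= conjCK mulrC.
Qed.

Lemma innerDr f g h : sqint mu f -> sqint mu g -> sqint mu h ->
  inner mu h (fun x => f x + g x) = inner mu h f + inner mu h g.
Proof.
move=> fi gi hi; rewrite inner_conj//; last exact: sqintD.
by rewrite innerDl// rmorphD /= -!inner_conj.
Qed.

Lemma innerZr c f h : sqint mu f -> sqint mu h ->
  inner mu h (fun x => c * f x) = c^* * inner mu h f.
Proof.
move=> fi hi; rewrite inner_conj//; last exact: sqintZ.
by rewrite innerZl// rmorphM /= -inner_conj.
Qed.

Lemma innerBl f g h : sqint mu f -> sqint mu g -> sqint mu h ->
  inner mu (fun x => f x - g x) h = inner mu f h - inner mu g h.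
Proof.
move=> fi gi hi; under eq_fun do rewrite -mulN1r.
by rewrite innerDl ?innerZl ?mulN1r//; exact: sqintZ.
Qed.

Lemma inner0l h : inner mu (fun=> 0) h = 0.
Proof. by rewrite /inner; under eq_fun do rewrite mul0r; exact: Cintegral0. Qed.

Lemma inner_suml (I : eqType) (r : seq I) (F : I -> T -> R[i]) h :
  (forall i, i \in r -> sqint mu (F i)) -> sqint mu h ->
  inner mu (fun x => \sum_(i <- r) F i x) h = \sum_(i <- r) inner mu (F i) h.
Proof.
move=> Fi hi; elim: r Fi => [|i r ih] Fi.
  by under eq_fun do rewrite big_nil; rewrite big_nil inner0l.
have Fr j : j \in r -> sqint mu (F j) by move=> jr; apply: Fi; rewrite in_cons jr orbT.
under eq_fun do rewrite big_cons; rewrite big_cons innerDl ?ih//.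
- by apply: Fi; rewrite mem_head.
- exact: sqint_sum_seq.
Qed.

Lemma inner_sumr (I : eqType) (r : seq I) (F : I -> T -> R[i]) h :
  (forall i, i \in r -> sqint mu (F i)) -> sqint mu h ->
  inner mu h (fun x => \sum_(i <- r) F i x) = \sum_(i <- r) inner mu h (F i).
Proof.
move=> Fi hi; rewrite inner_conj//; last exact: sqint_sum_seq.
rewrite inner_suml// rmorph_sum /= !big_seq; apply: eq_bigr => i ir.
by rewrite -inner_conj//; exact: Fi.
Qed.

Lemma inner_self f : sqint mu f -> inner mu f f = (normsq f)%:C.
Proof.
move=> fi; rewrite /inner; under eq_fun do rewrite mul_conj.
by apply: complex_eq; rewrite /= ?integral0.
Qed.

Lemma normsqB f g : sqint mu f -> sqint mu g ->
  normsq (fun x => f x - g x) = normsq f - 2 * Re (inner mu f g) + normsq g.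
Proof.
move=> fi gi; have := inner_self (sqintB fi gi).
have gN : sqint mu (fun x => -1 * g x) by exact: sqintZ.
rewrite {1 2}(_ : (fun x => f x - g x) = (fun x => f x + -1 * g x)); last first.
  by apply/funext => x; rewrite mulN1r.
rewrite innerDl ?innerDr ?innerZl ?innerZr//; last exact: sqintD.
move=> E; transitivity (Re (normsq (fun x => f x - g x))%:C); first by [].
rewrite -E !inner_self// (inner_conj gi fi) !ReD !ReM !Re_conj !ImM !Im_conj /=.
ring.
Qed.

Lemma Cauchy_Schwarz f g : sqint mu f -> sqint mu g ->
  normc (inner mu f g) ^+ 2 <= normsq f * normsq g.
Proof.
move=> fi gi; set c := inner mu f g.
(* The square norm of [f - t c g]; the factor [c] aligns the phases, so that a real parameter [t] is
   enough. *)
have key (t : R) : 0 <= normsq f - 2 * t * normc c ^+ 2 + t ^+ 2 * normc c ^+ 2 * normsq g.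
  have tg : sqint mu (fun x => (t%:C * c) * g x) by exact: sqintZ.
  have := normsq_ge0 (fun x => f x - (t%:C * c) * g x).
  have cE : (t%:C * c)^* = t%:C * c^* by rewrite rmorphM; congr (_ * _); exact: conj_realC.
  rewrite normsqB// innerZr// -/c cE.
  have -> : normsq (fun x => t%:C * c * g x) = t ^+ 2 * normc c ^+ 2 * normsq g.
    have := inner_self tg; rewrite innerZl ?innerZr ?inner_self// => E.
    transitivity (Re (normsq (fun x => t%:C * c * g x))%:C); first by [].
    by rewrite -E cE normc_sqr !ReM !ImM !Re_conj !Im_conj /=; ring.
  have -> : Re (t%:C * c^* * c) = t * normc c ^+ 2.
    by rewrite -mulrA (mulrC c^*) mul_conj ReM mul0r subr0.
  by rewrite mulrA.
have [G0|G0] := eqVneq (normsq g) 0.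
  rewrite G0 mulr0 leNgt; apply/negP => c0.
  (* With [normsq g = 0] the lower bound is affine in [t], and this value would make it -1. *)
  have := key ((normsq f + 1) / (2 * normc c ^+ 2)).
  rewrite G0 mulr0 addr0 -mulrA -[X in _ - _ * X]mulrA.
  have -> : (2 * normc c ^+ 2)^-1 * normc c ^+ 2 = 2^-1.
    by rewrite invfM -mulrA mulVf ?mulr1// gt_eqF.
  by rewrite mulrCA mulfV ?mulr1//; have := normsq_ge0 f; lra.
have G1 : 0 < normsq g by rewrite lt_def G0 normsq_ge0.
(* The minimizer of the quadratic in [t]. *)
have := key (normsq g)^-1.
have -> : normsq f - 2 * (normsq g)^-1 * normc c ^+ 2 +
    (normsq g)^-1 ^+ 2 * normc c ^+ 2 * normsq g =
    normsq f - normc c ^+ 2 / normsq g by field.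
by rewrite subr_ge0 ler_pdivrMr.
Qed.

Section Orthonormal.
Variables (J : choiceType) (D : set J) (e : J -> T -> R[i]).
Hypothesis oe : orthonormal_family mu D e.

Let ei j : D j -> sqint mu (e j).
Proof. by move=> Dj; apply/L2P; exact: oe.1. Qed.

Definition proj (r : seq J) g : T -> R[i] :=
  fun x => \sum_(j <- r) inner mu g (e j) * e j x.

Let proj_sqint r g : (forall j, j \in r -> D j) -> sqint mu (proj r g).
Proof. by move=> rD; apply: sqint_sum_seq => j jr; exact/sqintZ/ei/rD. Qed.

Let inner_proj r g h : (forall j, j \in r -> D j) -> sqint mu h ->
  inner mu (proj r g) h = \sum_(j <- r) inner mu g (e j) * inner mu (e j) h.
Proof.
move=> rD hi; rewrite inner_suml//; last by move=> j jr; exact/sqintZ/ei/rD.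
by rewrite !big_seq; apply: eq_bigr => j jr; rewrite innerZl//; exact/ei/rD.
Qed.

Let inner_projP r g j : uniq r -> (forall j, j \in r -> D j) -> sqint mu g ->
  j \in r -> inner mu (fun x => g x - proj r g x) (e j) = 0.
Proof.
move=> ur rD gi jr; have ej := ei (rD _ jr).
rewrite innerBl ?inner_proj//; last exact: proj_sqint.
rewrite (bigD1_seq j)//= oe.2 ?eqxx ?mulr1; [|exact: rD..].
rewrite big_seq_cond big1 ?addr0 ?subrr// => i /andP[ir ij].
by rewrite oe.2 ?(negbTE ij) ?mulr0//; exact: rD.
Qed.

Lemma bessel r g : uniq r -> (forall j, j \in r -> D j) -> sqint mu g ->
  \sum_(j <- r) normc (inner mu g (e j)) ^+ 2 <= normsq g.
Proof.
move=> ur rD gi; have Pi := @proj_sqint r g rD.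
have PE : inner mu (proj r g) g = (\sum_(j <- r) normc (inner mu g (e j)) ^+ 2)%:C.
  rewrite inner_proj// rmorph_sum /= !big_seq; apply: eq_bigr => j jr.
  by rewrite [inner mu (e j) g]inner_conj ?mul_conj//; exact/ei/rD.
have E : inner mu (fun x => g x - proj r g x) (proj r g) = 0.
  rewrite inner_sumr; last 2 first.
  - by move=> j jr; exact/sqintZ/ei/rD.
  - exact: sqintB.
  rewrite big_seq big1// => j jr; rewrite innerZr ?inner_projP ?mulr0//.
  - exact/ei/rD.
  - exact: sqintB.
have : inner mu (proj r g) (proj r g) = inner mu g (proj r g).
  by apply/esym/eqP; rewrite -subr_eq0 -innerBl ?E.
rewrite inner_self// (inner_conj gi Pi) PE conj_realC => -[h].
have := normsq_ge0 (fun x => g x - proj r g x).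
by rewrite normsqB// h (inner_conj gi Pi) PE conj_realC /=; lra.
Qed.

(** Pythagoras: [g - proj r g] is orthogonal to the span of [r], which contains both the competitor
    and the projection. The competitor may use fewer indices, because the basis property yields some
    finite set whereas [parseval] sums along a given sequence of sets. *)
Lemma best_approx r r' (c : J -> R[i]) g : uniq r -> (forall j, j \in r -> D j) ->
  {subset r' <= r} -> sqint mu g ->
  normsq (fun x => g x - proj r g x) <=
  normsq (fun x => g x - \sum_(j <- r') c j * e j x).
Proof.
move=> ur rD r'r gi; have Pi := @proj_sqint r g rD.
set Q := fun x => \sum_(j <- r') c j * e j x.
have Qi : sqint mu Q.
  by apply: sqint_sum_seq => j jr; exact/sqintZ/ei/rD/r'r.
have gP : sqint mu (fun x => g x - proj r g x) by exact: sqintB.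
have PQ : sqint mu (fun x => Q x - proj r g x) by exact: sqintB.
have -> : (fun x => g x - Q x) = (fun x => (g x - proj r g x) - (Q x - proj r g x)).
  by apply/funext => x; rewrite opprB addrA subrK.
have lin (v : T -> R[i]) (w : J -> R[i]) r'' : {subset r'' <= r} ->
    v = (fun x => \sum_(j <- r'') w j * e j x) ->
    inner mu (fun x => g x - proj r g x) v = 0.
  move=> sr ->; rewrite inner_sumr//; last by move=> j jr; exact/sqintZ/ei/rD/sr.
  rewrite big_seq big1// => j jr; rewrite innerZr ?inner_projP ?mulr0//; first exact: sr.
  exact/ei/rD/sr.
rewrite [leRHS]normsqB//.
have -> : inner mu (fun x => g x - proj r g x) (fun x => Q x - proj r g x) = 0.
  rewrite inner_conj// innerBl// rmorphB /= -!inner_conj//.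
  by rewrite (lin _ c r')// (lin _ (fun j => inner mu g (e j)) r)// subrr.
by rewrite /= mulr0 subr0 lerDl normsq_ge0.
Qed.

Hypothesis be : forall g, L2 mu g -> forall eps : R, 0 < eps ->
  exists (r : seq J) (c : J -> R[i]), (forall j, j \in r -> D j) /\
    (L2norm mu (fun x => (g x - \sum_(j <- r) c j * e j x)%R) < eps%:E)%E.

(** The basis property approximates [g] on some finite set of indices. Once [r n] contains it, the
    projection is at least as close, and Cauchy-Schwarz carries the error over to the inner product
    with [h]. *)
Lemma parseval (r : nat -> seq J) g h :
  (forall n, uniq (r n)) -> (forall n j, j \in r n -> D j) ->
  (forall j, D j -> exists N, forall n, (N <= n)%N -> j \in r n) ->
  sqint mu g -> sqint mu h ->
  Ccvg (fun n => \sum_(j <- r n) inner mu g (e j) * (inner mu h (e j))^*)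
    (inner mu g h).
Proof.
move=> ur rD rJ gi hi; apply: Ccvg_normc; apply/cvgrPdist_lt => eps eps0.
have H0 : 0 < normsq h + 1 by rewrite ltr_wpDl ?normsq_ge0.
(* The summand 1 keeps the denominator positive when [h] has norm 0. *)
have del0 : 0 < eps / Num.sqrt (normsq h + 1) by rewrite divr_gt0 ?sqrtr_gt0.
have [r' [c [r'D lt]]] := be ((L2P g).2 gi) del0.
have [N hN] : exists N, forall n, (N <= n)%N -> {subset r' <= r n}.
  elim: {lt} r' r'D => [|j r' ih] r'D; first by exists 0%N.
  have [i ir|N1 h1] := ih; first by apply: r'D; rewrite in_cons ir orbT.
  have [|N2 h2] := rJ j; first by apply: r'D; rewrite mem_head.
  exists (maxn N1 N2) => n; rewrite geq_max => /andP[n1 n2] i.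
  by rewrite in_cons => /orP[/eqP ->|ir]; [exact: h2|exact: (h1 n n1)].
exists N => // n /= Nn; rewrite sub0r normrN ger0_norm ?normc_ge0//.
have Qi : sqint mu (fun x => \sum_(j <- r') c j * e j x).
  by apply: sqint_sum_seq => j jr; exact/sqintZ/ei/r'D.
rewrite L2normE in lt; last exact: sqintB.
rewrite lte_fin ltr_pdivlMr ?sqrtr_gt0// in lt.
have Pi := @proj_sqint (r n) g (rD n).
have -> : inner mu g h - \sum_(j <- r n) inner mu g (e j) * (inner mu h (e j))^* =
    inner mu (fun x => g x - proj (r n) g x) h.
  rewrite innerBl ?inner_proj//; last exact: rD.
  congr (_ - _); rewrite !big_seq; apply: eq_bigr => j jr; congr (_ * _).
  by rewrite [RHS]inner_conj//; exact/ei/rD/jr.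
apply: le_lt_trans lt.
have gP : sqint mu (fun x => g x - proj (r n) g x) by exact: sqintB.
have := Cauchy_Schwarz gP hi; rewrite -sqrtrM ?normsq_ge0//.
set z := inner mu _ _ => le; rewrite -[normc z]ger0_norm ?normc_ge0// -sqrtr_sqr.
apply: ler_wsqrtr; apply: (le_trans le); apply: ler_pM; rewrite ?normsq_ge0//.
- by apply: best_approx => //; [exact: rD|exact: hN].
- by rewrite lerDl.
Qed.

End Orthonormal.

End L2Theory.

(** * The kernel of a trace class operator *)

Section Generator.
Context {R : realType} d {T : measurableType d}.
Variable mu : {measure set T -> \bar R}.
Variable C : nat -> set T.
Hypothesis C_meas : forall n, measurable (C n).
Hypothesis C_setI : setI_closed (range C).
Hypothesis C_gen : @measurable _ T = <<s range C >>.
Hypothesis C_cover : \bigcup_n C n = setT.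

(** Dynkin's argument is run inside one [C n] at a time, since [h] is known to be integrable only
    there; the countable cover glues the null sets. *)
Lemma ae_eq0_of_generator (h : T -> R) : measurable_fun setT h ->
  (forall n, mu.-integrable (C n) (EFin \o h)) ->
  (forall n, \int[mu]_(x in C n) (h x)%:E = 0)%E -> {ae mu, forall x, h x = 0}.
Proof.
move=> mh ih h0.
suff H n : ae_eq mu (C n) (EFin \o h) (cst 0%E).
  have : {ae mu, forall x, forall n, C n x -> (h x)%:E = 0%E}.
    have [F hF] := choice H.
    apply: negligibleS (negligible_bigcup H) => x /= /existsNP[n hn].
    by exists n.
  apply: filterS => x hx; have : setT x by [].
  by rewrite -C_cover => -[n _ /hx] [].
apply: (integral_ae_eq (C_meas n) (ih n)) => //.
move=> E EC mE; rewrite integral0.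
have step : forall B, <<s range C >> B -> (\int[mu]_(x in B `&` C n) (h x)%:E = 0)%E.
  apply: (dynkin_induction C_gen C_setI).
  - by rewrite setTI.
  - move=> _ [k _ <-]; have [l _ <-] : range C (C k `&` C n).
      by apply: C_setI; [exists k|exists n].
    exact: h0.
  - move=> B mB B0; have := h0 n.
    rewrite -[X in integral _ X](setUIDK _ B) integral_setU//.
    + by rewrite setIC B0 add0e setDE setIC.
    + exact: measurableI.
    + exact: measurableD.
    + by apply/measurable_EFinP; exact: measurable_funTS.
    + by rewrite disj_set2E setDE setIACA setICr setI0.
  - move=> F mF tF F0; rewrite setI_bigcupl integral_bigcup.
    + by rewrite eseries0// => k _ _; exact: F0.
    + exact: trivIset_setIr.
    + by move=> k; exact: measurableI.
    + apply: (integrableS (E := C n)) => //.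
      * by apply: bigcup_measurable => k _; exact: measurableI.
      * by move=> x [k _ []].
by have := step E; rewrite -C_gen => /(_ mE); rewrite (setIidl EC).
Qed.

End Generator.

Section LimitIdentification.
Context {R : realType} d {T : measurableType d}.
Variable mu : {measure set T -> \bar R}.

(** Fatou takes the place of an almost everywhere convergent subsequence: the lower limit of the
    squared errors has integral 0, and at almost every point it is the squared distance of [f] and
    [l]. *)
Lemma ae_eq_of_L2_limit (f l : T -> R[i]) (u : nat -> T -> R[i]) :
  (forall n, Cmeasurable (fun x => f x - u n x)) ->
  (\int[mu]_x (normc (f x - u n x) ^+ 2)%:E @[n --> \oo] --> 0)%E ->
  {ae mu, forall x, Ccvg (u ^~ x) (l x)} -> {ae mu, forall x, f x = l x}.
Proof.
move=> mu_ u0 ul.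
pose v n x : \bar R := (normc (f x - u n x) ^+ 2)%:E.
have mv n : measurable_fun setT (v n).
  by apply/measurable_EFinP/measurable_funX/measurable_normc.
have v0 n x : setT x -> (0 <= v n x)%E by rewrite lee_fin sqr_ge0.
have := fatou mu measurableT mv v0.
have [-> _] := cvg_limn_einf_sup u0 => int0.
have mF : measurable_fun setT (fun x => limn_einf (v ^~ x)).
  rewrite /limn_einf; apply: measurableT_comp => //.
  by apply: measurable_fun_limn_esup => n; exact: measurableT_comp.
have F0 x : (0 <= limn_einf (v ^~ x))%E.
  rewrite limn_einf_lim; apply: lime_ge; first exact: is_cvg_einfs.
  apply: nearW => n; apply: le_ereal_inf_tmp => _ [k _ <-]; exact: v0.
have : ae_eq mu setT (fun x => limn_einf (v ^~ x)) (cst 0%E).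
  apply/ae_eq_integral_abs => //; apply/eqP; rewrite eq_le integral_ge0// andbT.
  by under eq_integral do rewrite gee0_abs//.
apply: filterS2 ul => x xl /(_ I) /= x0.
have vl : v n x @[n --> \oo] --> (normc (f x - l x) ^+ 2)%:E.
  apply/cvg_EFin; first exact: nearW.
  have [a b] := xl; rewrite normc_sqr (_ : fine \o _ =
      fun n => Re (f x - u n x) ^+ 2 + Im (f x - u n x) ^+ 2); last first.
    by apply/funext => n; exact: normc_sqr.
  have a' : Re (f x - u n x) @[n --> \oo] --> Re (f x - l x).
    rewrite ReD ReN; under eq_fun do rewrite ReD ReN.
    by apply: cvgB => //; exact: cvg_cst.
  have b' : Im (f x - u n x) @[n --> \oo] --> Im (f x - l x).
    rewrite ImD ImN; under eq_fun do rewrite ImD ImN.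
    by apply: cvgB => //; exact: cvg_cst.
  exact: cvgD (cvgM a' a') (cvgM b' b').
have [e _] := cvg_limn_einf_sup vl.
move: x0; rewrite e => -[/eqP]; rewrite sqrf_eq0 => /eqP h.
by apply/eqP; rewrite -subr_eq0; apply/eqP; exact: ComplexField.Normc.eq0_normc h.
Qed.

End LimitIdentification.

Section AbsoluteConvergence.
Variable R : realType.

Lemma abs_bounded_cvg (u : nat -> R) (B : R) :
  (forall M, \sum_(n < M) `|u n| <= B) -> cvgn (fun M => \sum_(n < M) u n).
Proof.
move=> uB.
have -> : (fun M => \sum_(n < M) u n) = series u.
  by apply/funext => M; rewrite /series /= big_mkord.
apply: normed_cvg; apply: nondecreasing_is_cvgn.
  by apply: nondecreasing_series => n _ _; rewrite normr_ge0.
by exists B => _ [M _ <-]; rewrite /= /series /= big_mkord; exact: uB.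
Qed.

Lemma Cabs_bounded_cvg (u : nat -> R[i]) (B : R) :
  (forall M, \sum_(n < M) normc (u n) <= B) ->
  exists l, Ccvg (fun M => \sum_(n < M) u n) l.
Proof.
move=> uB.
have /cvg_ex[a ha] : cvgn (fun M => \sum_(n < M) Re (u n)).
  apply: (@abs_bounded_cvg (fun n => Re (u n)) B) => M; apply: le_trans (uB M).
  by apply: ler_sum => n _; exact: Re_le_normc.
have /cvg_ex[b hb] : cvgn (fun M => \sum_(n < M) Im (u n)).
  apply: (@abs_bounded_cvg (fun n => Im (u n)) B) => M; apply: le_trans (uB M).
  by apply: ler_sum => n _; exact: Im_le_normc.
exists (Complex a b); split => /=.
- by under eq_fun do rewrite Re_sum.
- by under eq_fun do rewrite Im_sum.
Qed.

End AbsoluteConvergence.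

Section TraceClassKernel.
Context {R : realType} d {T : measurableType d}.
Variable mu : {sigma_finite_measure set T -> \bar R}.
Variable C : nat -> set T.
Hypothesis C_meas : forall n, measurable (C n).
Hypothesis C_fin : forall n, (mu (C n) < +oo)%E.
Hypothesis C_setI : setI_closed (range C).
Hypothesis C_gen : @measurable _ T = <<s range C >>.
Hypothesis C_cover : \bigcup_n C n = setT.
Variable K : T -> T -> R[i].
Hypothesis mK : Cmeasurable (fun p : T * T => K p.1 p.2).

Section Expansion.
Variables (s : nat -> R) (psi phi : nat -> T -> R[i]).
Hypothesis s0 : forall n, 0 <= s n.
Hypothesis s_cvg : cvgn (series s).
Hypothesis mpsi : forall n, Cmeasurable (psi n).
Hypothesis mphi : forall n, Cmeasurable (phi n).
Hypothesis psi1 : forall n, (\int[mu]_x (normc (psi n x) ^+ 2)%:E <= 1)%E.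
Hypothesis phi1 : forall n, (\int[mu]_x (normc (phi n x) ^+ 2)%:E <= 1)%E.
Hypothesis K_dom : forall f, L2 mu f -> op_dom (kernel_operator mu K) f.
Hypothesis K_svd : forall f, L2 mu f ->
  (fun N => L2norm mu (fun x => kernel_operator mu K f x -
     \sum_(n < N) (s n)%:C * inner mu f (phi n) * psi n x)) @ \oo --> 0%E.

Let q := kernel_dom s psi phi.
Let G : set T := [set x | dom_good s psi phi x].

Let u M (p : T * T) : R[i] :=
  (\1_G p.1 : R)%:C * (\1_G p.2 : R)%:C * partial_kernel s psi phi M p.1 p.2.

Let mG : measurable G. Proof. exact: measurable_dom_good. Qed.

Let mu_ M : Cmeasurable (u M).
Proof.
apply: CmeasurableM; last exact: Cmeasurable_partial_kernel.
apply: CmeasurableM.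
- by apply: (Cmeasurable_comp (Cmeasurable_indic mG)).
- by apply: (Cmeasurable_comp (Cmeasurable_indic mG)).
Qed.

Let u_cvg p : exists l, Ccvg (u ^~ p) l.
Proof.
have [[g1 g2]|ng] := pselect (G p.1 /\ G p.2); last first.
  exists 0; rewrite (_ : u ^~ p = fun=> 0); first exact: Ccvg_cst.
  apply/funext => M; rewrite /u !indicE.
  have [g1|g1] := pselect (G p.1); last by rewrite (memNset g1) !mul0r.
  by rewrite (memNset (fun g2 => ng (conj g1 g2))) mulr0 mul0r.
have [l hl] := @Cabs_bounded_cvg R (fun n => (s n)%:C * psi n p.1 * (phi n p.2)^*)
  _ (fun M => partial_kernel_abs_le s0 M g1 g2).
exists l; rewrite (_ : u ^~ p = fun M => partial_kernel s psi phi M p.1 p.2)//.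
by apply/funext => M; rewrite /u !indicE !mem_set// !mul1r.
Qed.

(* An everywhere defined measurable version of the limit of the expansion; testing
   both operators on the sets [C n] shows that almost every section of K is a
   section of [k']. *)
Let k' (p : T * T) : R[i] := sval (cid (u_cvg p)).
Let k'P p : Ccvg (u ^~ p) (k' p). Proof. exact: (svalP (cid (u_cvg p))). Qed.

Let mk' : Cmeasurable k'.
Proof.
split.
- apply: (measurable_fun_cvg (h := fun M p => Re (u M p))).
  + by move=> M; case: (mu_ M).
  + by move=> p _; case: (k'P p).
- apply: (measurable_fun_cvg (h := fun M p => Im (u M p))).
  + by move=> M; case: (mu_ M).
  + by move=> p _; case: (k'P p).
Qed.

Let section_meas (f : T * T -> R[i]) x : Cmeasurable f -> Cmeasurable (fun y => f (x, y)).
Proof. by move=> mf; apply: (Cmeasurable_comp mf); exact: pair1_measurable. Qed.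

(** At a good point, integrating [k'] against an indicator gives the same series as applying the
    expanded operator to that indicator. *)
Let k'_section x E : G x -> measurable E -> (mu E < +oo)%E ->
  Cintegrable mu setT (fun y => k' (x, y) * (\1_E y : R)%:C) /\
  Ccvg (fun N => \sum_(n < N) (s n)%:C * inner mu (fun y => (\1_E y : R)%:C) (phi n) * psi n x)
    (Cintegral mu setT (fun y => k' (x, y) * (\1_E y : R)%:C)).
Proof.
move=> Gx mE Ey; have iE := sqint_indicC mE Ey.
have E_int : mu.-integrable setT (fun y => (\1_E y : R)%:E).
  apply/integrableP; split; first exact/measurable_EFinP/measurable_indic.
  under eq_integral do rewrite gee0_abs ?lee_fin//.
  by rewrite integral_indic// setIT.
have [i1 c1] : Cintegrable mu setT (fun y => k' (x, y) * (\1_E y : R)%:C) /\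
    Ccvg (fun N => Cintegral mu setT (fun y => u N (x, y) * (\1_E y : R)%:C))
      (Cintegral mu setT (fun y => k' (x, y) * (\1_E y : R)%:C)).
  apply: (C_dominated_convergence
    (* On [E] the bound [sqrt (q y)] is at most [1 + q y], which is integrable as [E] has finite
       measure. *)
    (h := fun y => Num.sqrt (q x) * ((\1_E y : R) + q y))).
  - move=> N; apply: CmeasurableM; last exact: Cmeasurable_indic.
    exact: section_meas.
  - by apply: CmeasurableM; [exact: section_meas|exact: Cmeasurable_indic].
  - by apply: nearW => y; apply: CcvgM; [exact: k'P|exact: Ccvg_cst].
  - rewrite (_ : _ \o _ = (fun y => (Num.sqrt (q x))%:E *
      ((fun y => (\1_E y : R)%:E) \+ (EFin \o q)) y)%E)//.
    apply: integrableZl => //; apply: integrableD => //.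
    exact: kernel_dom_integrable.
  - apply: nearW => y N; rewrite /u /= !normcM !normc_real !indicE (mem_set Gx) normr1 mul1r.
    have q0 : 0 <= q y by exact: kernel_dom_ge0.
    case: (boolP (y \in G)) => yG; last first.
      by rewrite normr0 !mul0r mulr_ge0 ?sqrtr_ge0// addr_ge0// ler0n.
    rewrite inE in yG; rewrite normr1 mul1r.
    case: (y \in E); last by rewrite normr0 mulr0 mulr_ge0 ?sqrtr_ge0// addr_ge0.
    rewrite normr1 mulr1; apply: (le_trans (partial_kernel_le s0 N Gx yG)).
    rewrite ler_wpM2l ?sqrtr_ge0//.
    change (Num.sqrt (q y) <= 1 + q y).
    have := sqr_ge0 (Num.sqrt (q y) - 1); have := sqrtr_ge0 (q y).
    by have := sqr_sqrtr q0; move: (Num.sqrt (q y)) => r <-; nra.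
split=> //; move: c1; congr Ccvg; apply/funext => N.
transitivity (Cintegral mu setT (fun y => \sum_(n < N)
    ((s n)%:C * psi n x) * ((\1_E y : R)%:C * (phi n y)^*))).
  apply: ae_eq_Cintegral.
  - by apply: CmeasurableM; [exact: section_meas|exact: Cmeasurable_indic].
  - apply: Cmeasurable_sum => n; apply: CmeasurableM; first exact: Cmeasurable_cst.
    by apply: CmeasurableM; [exact: Cmeasurable_indic|exact: Cmeasurable_conj].
  - have := ae_dom_good s0 s_cvg mpsi mphi psi1 phi1; apply: filterS => y Gy.
    have Gy' : G y by [].
    rewrite /u /= !indicE (mem_set Gx) (mem_set Gy') !mul1r /partial_kernel mulr_suml.
    by apply: eq_bigr => n _; rewrite -!mulrA; congr (_ * (_ * _)); rewrite mulrC.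
rewrite Cintegral_sum; last first.
  by move=> n _; apply/CintegrableZ/Cintegrable_mul_conj => //; exact: sqint_phi.
apply: eq_bigr => n _; rewrite CintegralZ.
  by rewrite mulrAC.
by apply: Cintegrable_mul_conj => //; exact: sqint_phi.
Qed.

(** The partial sums converge in norm to the image of the indicator, and almost everywhere to its
    pairing with [k'], so both limits agree. The exceptional null set depends on [E]; only countably
    many sets can be tested at once. *)
Let section_eq E : measurable E -> (mu E < +oo)%E ->
  {ae mu, forall x, Cintegrable mu setT (fun y => K x y * (\1_E y : R)%:C) /\
    Cintegral mu setT (fun y => K x y * (\1_E y : R)%:C) =
    Cintegral mu setT (fun y => k' (x, y) * (\1_E y : R)%:C)}.
Proof.
move=> mE Ey; have iE := sqint_indicC mE Ey.
have lE := (L2P mu _).2 iE.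
have [_ K1 K2] := K_dom lE; have Kcv := K_svd lE.
set Kf := kernel_operator mu K _ in Kcv.
have sKf : sqint mu Kf by exact/L2P.
pose S N x := \sum_(n < N) (s n)%:C *
    inner mu (fun y => (\1_E y : R)%:C) (phi n) * psi n x.
have sS N : sqint mu (S N).
  by apply: sqint_sum => n; apply: sqintZ; exact: sqint_psi.
have sD N := sqintB sKf (sS N).
have h1 : (\int[mu]_x (normc (Kf x - S N x) ^+ 2)%:E @[N --> \oo] --> 0)%E.
  under eq_fun do rewrite (sqint_fineK (sD _)).
  apply/cvg_EFin; first exact: nearW.
  have /fine_cvgP[_ h] : (fun N => L2norm mu (fun x => Kf x - S N x)) @ \oo --> (0 : R)%:E.
    exact: Kcv.
  rewrite (_ : fine \o _ = fun N => fine (L2norm mu (fun x => Kf x - S N x)) *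
      fine (L2norm mu (fun x => Kf x - S N x))).
    have h' : fine (L2norm mu (fun x => Kf x - S N x)) @[N --> \oo] --> (0 : R) by exact: h.
    rewrite -(mulr0 (0 : R)); exact: (cvgM h' h').
  apply/funext => N; rewrite /= L2normE//= -expr2 sqr_sqrtr//.
  exact: normsq_ge0.
have h2 : {ae mu, forall x, Ccvg (S ^~ x)
    (Cintegral mu setT (fun y => k' (x, y) * (\1_E y : R)%:C))}.
  have := ae_dom_good s0 s_cvg mpsi mphi psi1 phi1; apply: filterS => x Gx.
  by have [] := k'_section Gx mE Ey.
have h3 := ae_eq_of_L2_limit (fun N => (sD N).1) h1 h2.
by apply: filterS2 K1 h3 => x a b; split.
Qed.

Let ae_K_eq : {ae mu, forall x, {ae mu, forall y, K x y = k' (x, y)}}.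
Proof.
have : {ae mu, forall x, G x /\ forall n,
    Cintegrable mu setT (fun y => K x y * (\1_(C n) y : R)%:C) /\
    Cintegral mu setT (fun y => K x y * (\1_(C n) y : R)%:C) =
    Cintegral mu setT (fun y => k' (x, y) * (\1_(C n) y : R)%:C)}.
  have h1 : {ae mu, forall x, forall n,
    Cintegrable mu setT (fun y => K x y * (\1_(C n) y : R)%:C) /\
    Cintegral mu setT (fun y => K x y * (\1_(C n) y : R)%:C) =
    Cintegral mu setT (fun y => k' (x, y) * (\1_(C n) y : R)%:C)}.
    apply: negligibleS (negligible_bigcup (fun n => section_eq (C_meas n) (C_fin n))).
    by move=> x /= /existsNP[n hn]; exists n.
  by have := ae_dom_good s0 s_cvg mpsi mphi psi1 phi1; apply: filterS2 h1.
apply: filterS => x [Gx hx].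
have mKx := section_meas x mK; have mkx := section_meas x mk'.
have [mD1 mD2] := CmeasurableB mKx mkx.
have D_int n : Cintegrable mu (C n) (fun y => K x y - k' (x, y)) /\
    Cintegral mu (C n) (fun y => K x y - k' (x, y)) = 0.
  have [a b] := hx n; have [a' _] := k'_section Gx (C_meas n) (C_fin n).
  have E : (fun y => (\1_(C n) y : R)%:C * (K x y - k' (x, y))) =
      (fun y => K x y * (\1_(C n) y : R)%:C + -1 * (k' (x, y) * (\1_(C n) y : R)%:C)).
    by apply/funext => y; ring.
  have a'' := CintegrableZ (-1) a'.
  split; first by apply/(Cintegrable_mkcond _ _ (C_meas n)); rewrite E; exact: CintegrableD.
  by rewrite Cintegral_mkcond E CintegralD// CintegralZ// b mulN1r subrr.
have e1 : {ae mu, forall y, Re (K x y - k' (x, y)) = 0}.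
  apply: (ae_eq0_of_generator C_meas C_setI C_gen C_cover) => //.
  - by move=> n; have [[]] := D_int n.
  - move=> n; have [[iR _]] := D_int n; move/(congr1 (@complex.Re R)) => /= h.
    by rewrite -[LHS]fineK ?h//; exact: integrable_fin_num.
have e2 : {ae mu, forall y, Im (K x y - k' (x, y)) = 0}.
  apply: (ae_eq0_of_generator C_meas C_setI C_gen C_cover) => //.
  - by move=> n; have [[]] := D_int n.
  - move=> n; have [[_ iI]] := D_int n; move/(congr1 (@complex.Im R)) => /= h.
    by rewrite -[LHS]fineK ?h//; exact: integrable_fin_num.
apply: filterS2 e1 e2 => y r1 r2; apply/eqP; rewrite -subr_eq0; apply/eqP.
exact: complex_eq.
Qed.

(** Both kernels are jointly measurable, so the set where they differ is measurable, and having null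
    sections makes it null. *)
Lemma svd_kernel_expansion : {ae (mu \x mu)%E, forall p,
  Ccvg (fun M => partial_kernel s psi phi M p.1 p.2) (K p.1 p.2)}.
Proof.
have h1 : {ae (mu \x mu)%E, forall p, K p.1 p.2 = k' p}.
  have [m1 m2] := CmeasurableB mK mk'.
  pose N : set (T * T) := [set p | Re (K p.1 p.2 - k' p) != 0] `|`
     [set p | Im (K p.1 p.2 - k' p) != 0].
  have mN : measurable N.
    have mne (h : T * T -> R) : measurable_fun setT h -> measurable [set p | h p != 0].
      move=> mh; rewrite (_ : [set p | _] = h @^-1` (~` [set 0])).
        by rewrite -[X in measurable X]setTI; apply: mh => //; exact: measurableC.
      by apply/seteqP; split => p /= /eqP.
    by apply: measurableU; exact: mne.
  apply: (ae_of_section mN).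
    move=> p /= Kk; have [re|] := eqVneq (Re (K p.1 p.2 - k' p)) 0; last by left.
    right; apply/eqP => im; apply: Kk; apply/eqP; rewrite -subr_eq0; apply/eqP.
    exact: complex_eq.
  apply: filterS ae_K_eq => x [Z [mZ Z0 hZ]]; apply/negligibleP.
    exact: measurable_xsection.
  exists Z; split => // y; rewrite /xsection /= inE => Ny; apply: hZ => /= e.
  by move: Ny; rewrite /N /= e subrr /= !eqxx => -[].
have g1 := ae_prod_fst mu (ae_dom_good s0 s_cvg mpsi mphi psi1 phi1).
have g2 := ae_prod_snd mu (ae_dom_good s0 s_cvg mpsi mphi psi1 phi1).
apply: filterS3 h1 g1 g2 => p -> p1 p2.
have := k'P p; congr Ccvg; apply/funext => M.
by rewrite /u !indicE !mem_set// !mul1r.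
Qed.

End Expansion.

Lemma trace_class_expansion : trace_class mu (kernel_operator mu K) ->
  exists (s : nat -> R) (psi phi : nat -> T -> R[i]),
   [/\ [/\ forall n, 0 <= s n, cvgn (series s),
           forall n, Cmeasurable (psi n) & forall n, Cmeasurable (phi n)],
       forall n, (\int[mu]_x (normc (psi n x) ^+ 2)%:E <= 1)%E,
       forall n, (\int[mu]_x (normc (phi n x) ^+ 2)%:E <= 1)%E &
       {ae (mu \x mu)%E, forall p,
         Ccvg (fun M => partial_kernel s psi phi M p.1 p.2) (K p.1 p.2)}].
Proof.
move=> [Kdom [s [phi0 [psi0 [s0 scvg [phiL phiO] [psiL psiO] Ksvd]]]]].
(* The singular vectors are controlled only where [s n != 0]; the others are replaced by 0, which
   leaves the expansion unchanged and makes the bounds hold for all [n]. *)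
pose cut (e : nat -> T -> R[i]) n : T -> R[i] := if s n != 0 then e n else fun=> 0.
have cut_ok e : (forall n, s n != 0 -> L2 mu (e n)) ->
    (forall i j, s i != 0 -> s j != 0 -> inner mu (e i) (e j) = (i == j)%:R) ->
    forall n, Cmeasurable (cut e n) /\
      (\int[mu]_x (normc (cut e n x) ^+ 2)%:E <= 1)%E.
  move=> eL eO n; rewrite /cut; case: ifPn => sn; last first.
    split; first exact: Cmeasurable_cst.
    by under eq_integral do rewrite normc0 expr0n; rewrite integral0.
  have ei := (L2P mu _).1 (eL n sn); split; first by case: ei.
  rewrite (sqint_fineK ei); have := inner_self ei.
  by rewrite (eO n n sn sn) eqxx => -[<-].
have psiok := cut_ok _ psiL psiO; have phiok := cut_ok _ phiL phiO.
exists s, (cut psi0), (cut phi0); split; first split => //.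
- by move=> n; case: (psiok n).
- by move=> n; case: (phiok n).
- by move=> n; case: (psiok n).
- by move=> n; case: (phiok n).
apply: svd_kernel_expansion => //.
- by move=> n; case: (psiok n).
- by move=> n; case: (phiok n).
- by move=> n; case: (psiok n).
- by move=> n; case: (phiok n).
move=> f fL; have := Ksvd f fL; apply: cvg_trans; apply: near_eq_cvg.
apply: nearW => N; congr (L2norm mu _); apply/funext => x; congr (_ - _).
apply: eq_bigr => n _; rewrite /cut; case: (eqVneq (s n) 0) => //= ->.
by rewrite !mul0r.
Qed.

End TraceClassKernel.

(** * The basis of level [l] *)

Section LevelBasisTheory.
Context {R : realType} {S : ptopologicalType} {I : pointedType}.
Variable lam : {measure set (borel S) -> \bar R}.
Variable cell : node I -> set S.
Variable f : node I -> S -> R.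
Hypothesis lam_compact : forall K : set S, compact K -> (lam K < +oo)%E.
Hypothesis cellP : nested_partitions lam cell.
Hypothesis fP : adapted_basis lam cell f.

Let partP (n : node I) : lambda_partition lam cell [set n' : node I | level n' = level n].
Proof. by have [h _ _] := cellP; exact: h. Qed.

Lemma cell_measurable n : measurable (cell n : set (borel S)).
Proof. by have [_ _ _ /(_ n erefl)[]] := partP n. Qed.

Lemma cell_compact n : compact (closure (cell n)).
Proof. by have [_ _ _ /(_ n erefl)[]] := partP n. Qed.

Lemma cell_gt0 n : (0 < lam (cell n))%E.
Proof. by have [_ _ _ /(_ n erefl)[]] := partP n. Qed.

Lemma closed_borel (C : set S) : closed C -> measurable (C : set (borel S)).
Proof.
move=> cC; rewrite -[C]setCK; apply: measurableC; apply: sub_sigma_algebra.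
by rewrite openC.
Qed.

Lemma cell_lty n : (lam (cell n) < +oo)%E.
Proof.
apply: (@le_lt_trans _ _ (lam (closure (cell n) : set S))); last first.
  by apply: lam_compact; exact: cell_compact.
apply: le_measure; rewrite ?inE; first exact: cell_measurable.
  by apply: (@closed_borel (closure (cell n))); exact: closed_closure.
exact: subset_closure.
Qed.

Lemma cell_neq0 n : cell n !=set0.
Proof.
apply/set0P/eqP => c0; have := cell_gt0 n.
by rewrite c0 measure0 ltxx.
Qed.

Lemma cell_inj n n' x : level n = level n' -> cell n x -> cell n' x -> n = n'.
Proof.
move=> nn' nx n'x; have [_ tI _ _] := partP n.
by apply: tI => //; exists x.
Qed.

Lemma cell_cover l x : (0 < l)%N -> exists2 n, level n = l & cell n x.
Proof.
move=> l0; have [h _ _] := cellP; have [_ _ + _] := h l l0.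
have : setT x by []. by move=> xT UE; move: xT; rewrite -UE => -[n nl nx]; exists n.
Qed.

Lemma cell_prefix i w v : cell (i, w ++ v) `<=` cell (i, w).
Proof.
have [->|v0] := eqVneq v [::]; first by rewrite cats0.
have [_ h _] := cellP; apply/h; last by split => //; exact: prefix_prefix.
by rewrite /level /= size_cat ltnS -[ltnLHS]addn0 ltn_add2l; case: v v0.
Qed.

(** The labelling gives inclusions only. The children exhaust the cell because both levels are
    partitions: the cell of the next level through a point has a parent, which can only be this
    cell. *)
Lemma cell_children i w :
  cell (i, w) = cell (i, rcons w false) `|` cell (i, rcons w true).
Proof.
apply/seteqP; split => [x wx|x]; last first.
  by rewrite -!cats1 => -[]; exact: cell_prefix.
have [[j v] vl vx] := @cell_cover (size w).+2 x isT.
move: vl vx; case/lastP: v => [|v b] // [].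
rewrite size_rcons => -[sv] vx.
have vx' : cell (j, v) x by move: vx; rewrite -cats1; exact: cell_prefix.
have [<- <-] : (j, v) = (i, w) by apply: (cell_inj _ vx' wx); rewrite /level /= sv.
by case: b vx => vx; [right|left].
Qed.

Lemma cell_childrenI i w :
  cell (i, rcons w false) `&` cell (i, rcons w true) = set0.
Proof.
apply/seteqP; split => // x [x0 x1].
have : (i, rcons w false) = (i, rcons w true).
  by apply: (cell_inj _ x0 x1); rewrite /level /= !size_rcons.
by move=> [] /rcons_inj [].
Qed.

(** Saturation with respect to cells is stable under complements and countable unions, so it passes
    from the cells to the sigma-algebra that they generate. *)
Lemma calF_saturated l (C : set S) n x y : (0 < l)%N -> calF cell l C ->
  level n = l -> cell n x -> cell n y -> C x -> C y.
Proof.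
move=> l0 FC nl nx ny Cx.
pose P : set (set S) := [set C | forall n x y, level n = l ->
  cell n x -> cell n y -> C x -> C y].
suff : calF cell l `<=` P by move=> /(_ _ FC) /(_ n x y); exact.
apply: smallest_sub; last first.
  move=> _ [k kl <-] n' x' y' n'l n'x n'y kx.
  by rewrite (@cell_inj k n' x')// kl n'l.
split.
- by [].
- move=> B PB n' x' y' n'l n'x n'y [_ nB]; split=> // By.
  by apply: nB; exact: (PB n' y' x').
- move=> F PF n' x' y' n'l n'x n'y [k _ Fk]; exists k => //.
  exact: (PF k n' x' y').
Qed.

Let fL2 n : bigI n -> sqint lam (fun x : borel S => (f n x)%:C).
Proof. by move=> nI; apply/L2P; have [[[h _] _] _ _ _] := fP; exact: h. Qed.

Lemma f_const n n' x y : bigI n -> level n' = level n ->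
  cell n' x -> cell n' y -> f n x = f n y.
Proof.
move=> nI n'n xn' yn'; have [_ fF _ _] := fP.
have : calF cell (level n) (f n @^-1` [set f n x]).
  rewrite -fF//; apply: sub_sigma_algebra.
  by exists n, [set f n x]; split.
move/(calF_saturated (l := level n) isT) => /(_ n' x y n'n xn' yn' erefl).
by [].
Qed.

Lemma f_supp n x : bigI n -> (f n x != 0) <-> basis_supp cell n x.
Proof.
by move=> nI; have [_ _ /(_ n nI) <- _] := fP.
Qed.

Lemma bigI_rcons i w : bigI ((i, rcons w false) : node I).
Proof. by rewrite /bigI /= last_rcons. Qed.

Definition ind n : borel S -> R[i] := fun x => (\1_(cell n) x : R)%:C.

Lemma sqint_ind n : sqint lam (ind n).
Proof. exact: (sqint_indicC (cell_measurable n) (cell_lty n)). Qed.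

Lemma inner_ind n n' : cell n `<=` cell n' ->
  inner lam (ind n) (ind n') = (fine (lam (cell n)))%:C.
Proof.
move=> nn'; rewrite /inner /Cintegral.
have E x : ind n x * (ind n' x)^* = (\1_(cell n) x : R)%:C.
  rewrite /ind conj_realC !indicE; case: (boolP (x \in cell n)) => xn.
    by rewrite inE in xn; rewrite (mem_set (nn' _ xn)) mulr1.
  by rewrite mul0r.
under eq_integral do rewrite E.
under [X in Complex _ (fine X)]eq_integral do rewrite E.
rewrite /= integral0 integral_indic ?setIT//; exact: cell_measurable.
Qed.

Lemma f_rank1 i : (fun x => (f (i, [::]) x)%:C) =
  (fun x => ((Num.sqrt (fine (lam (cell (i, [::])))))^-1)%:C * ind (i, [::]) x).
Proof.
have [_ _ _ ->] := fP; apply/funext => x.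
by rewrite /normalized_indicator mulrC rmorphM.
Qed.

Lemma sqrt_cell_gt0 n : 0 < Num.sqrt (fine (lam (cell n))).
Proof. by rewrite sqrtr_gt0 fine_gt0// cell_gt0 cell_lty. Qed.

Lemma ind_rank1 i : ind (i, [::]) =
  (fun x => (Num.sqrt (fine (lam (cell (i, [::])))))%:C * (f (i, [::]) x)%:C).
Proof.
apply/funext => x; have := congr1 (@^~ x) (f_rank1 i) => /= ->.
by rewrite mulrA -rmorphM /= mulfV ?mul1r// gt_eqF// sqrt_cell_gt0.
Qed.

Lemma ind_children i w :
  ind (i, w) = (fun x => ind (i, rcons w false) x + ind (i, rcons w true) x).
Proof.
apply/funext => x; rewrite /ind !indicE cell_children in_setU.
have := cell_childrenI i w => h.
case: (boolP (x \in cell (i, rcons w false))) => x0;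
  case: (boolP (x \in cell (i, rcons w true))) => x1 //=;
  rewrite ?addr0 ?add0r//.
by rewrite !inE in x0 x1; have : set0 x by rewrite -h.
Qed.

(** Measurability at its own level makes the function constant on both children, and its support is
    exactly the parent cell, so both constants are nonzero. *)
Lemma f_children i w : exists a b : R, [/\ a != 0, b != 0 &
  (fun x => (f (i, rcons w false) x)%:C) =
  (fun x => a%:C * ind (i, rcons w false) x + b%:C * ind (i, rcons w true) x)].
Proof.
have bI := bigI_rcons i w; set n := (i, rcons w false).
have [x0 x0n] := cell_neq0 n; have [x1 x1n] := cell_neq0 (i, rcons w true).
have suppE : basis_supp cell n = cell (i, w).
  rewrite /basis_supp /n /= size_rcons /= -cats1 take_size_cat//.
  by case: w {n bI x0n x1n}.
have in0 : cell (i, w) x0 by rewrite cell_children; left.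
have in1 : cell (i, w) x1 by rewrite cell_children; right.
exists (f n x0), (f n x1); split.
- by apply/f_supp => //; rewrite suppE.
- by apply/f_supp => //; rewrite suppE.
apply/funext => x; rewrite /ind !indicE.
have [xw|nxw] := pselect (cell (i, w) x); last first.
  have -> : f n x = 0.
    by apply/eqP; apply: contrapT => /negP/(f_supp x bI); rewrite suppE.
  move: nxw; rewrite cell_children => /not_orP[nx0 nx1].
  by rewrite !memNset// !mulr0 addr0.
have h := cell_childrenI i w.
move: (xw); rewrite cell_children => -[xc|xc].
- rewrite (mem_set xc) memNset ?mulr1 ?mulr0 ?addr0; last first.
    by move=> xc'; have : set0 x by rewrite -h.
  by congr (_%:C); apply: (f_const bI erefl xc x0n).
- rewrite (mem_set xc) memNset ?mulr1 ?mulr0 ?add0r; last first.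
    by move=> xc'; have : set0 x by rewrite -h.
  congr (_%:C); apply: (f_const bI _ xc x1n).
  by rewrite /level /= !size_rcons.
Qed.

Let fO n n' : bigI n -> bigI n' ->
  inner lam (fun x : borel S => (f n x)%:C) (fun x => (f n' x)%:C) = (n == n')%:R.
Proof. by have [[[_ h] _] _ _ _] := fP; exact: h. Qed.

(** Induction down the tree. The indicator of a rank 1 cell is a multiple of a basis function.
    Below, the inner products [c0] and [c1] with two siblings satisfy [c0 + c1 = 0], by induction
    for the parent, and [a c0 + b' c1 = 0], by orthogonality to the basis function carried by the
    parent. As [a != b'], both vanish. *)
Lemma f_orth_ind n n' : bigI n -> (level n' < level n)%N ->
  inner lam (fun x : borel S => (f n x)%:C) (ind n') = 0.
Proof.
move=> nI; case: n' => i w; elim/last_ind: w n nI => [|w b ih] n nI ln.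
  rewrite ind_rank1 innerZr ?fO//; [|exact: fL2..].
  case: eqP => [e|_]; last by rewrite mulr0.
  by move: ln; rewrite e ltnn.
have lp : (level (i, w) < level n)%N.
  by apply: ltn_trans ln; rewrite /level /= size_rcons.
have := ih n nI lp.
rewrite ind_children innerDr; [|exact: sqint_ind|exact: sqint_ind|exact: fL2].
set c0 := inner lam _ (ind (i, rcons w false)).
set c1 := inner lam _ (ind (i, rcons w true)) => c01.
have [a [b' [a0 b0 fE]]] := f_children i w.
have mI := bigI_rcons i w.
have := fO nI mI; rewrite fE innerDr; [|exact/sqintZ/sqint_ind..|exact: fL2].
rewrite !innerZr; [|exact: sqint_ind|exact: fL2|exact: sqint_ind|exact: fL2].
rewrite -/c0 -/c1 !conj_realC.
have -> : n == (i, rcons w false) = false.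
  apply/eqP => e; move: ln; rewrite e /level /= !size_rcons ltnn//.
rewrite mulr0n => ab.
(* If they were equal, this basis function would be a nonzero multiple of the parent's indicator, to
   which it is orthogonal by induction. *)
have ab_neq : a != b'.
  apply/eqP => ab'.
  have := ih _ mI; rewrite /level /= size_rcons => /(_ (ltnSn _)).
  rewrite fE innerDl; [|exact/sqintZ/sqint_ind..|exact: sqint_ind].
  rewrite !innerZl; [|exact: sqint_ind..].
  have sub1 : cell (i, rcons w true) `<=` cell (i, w).
    by rewrite (cell_children i w); exact: subsetUr.
  have sub0 : cell (i, rcons w false) `<=` cell (i, w).
    by rewrite (cell_children i w); exact: subsetUl.
  rewrite (inner_ind sub0) (inner_ind sub1).
  rewrite -ab' -mulrDr -rmorphD => /eqP; rewrite mulf_eq0 => /orP[/eqP[]|/eqP[]].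
    by apply/eqP.
  have p0 : 0 < fine (lam (cell (i, rcons w false))).
    by rewrite fine_gt0// cell_gt0 cell_lty.
  have p1 : 0 < fine (lam (cell (i, rcons w true))).
    by rewrite fine_gt0// cell_gt0 cell_lty.
  by move/eqP; rewrite gt_eqF// addr_gt0.
have c1E : c1 = - c0 by apply/eqP; rewrite -addr_eq0 addrC c01.
have c00 : c0 = 0.
  move: ab; rewrite c1E mulrN -mulrBl -rmorphB => /eqP; rewrite mulf_eq0.
  by move=> /orP[/eqP[/eqP]|/eqP//]; rewrite subr_eq0 (negbTE ab_neq).
case: b {ln}; last exact: c00.
by change (c1 = 0); rewrite c1E c00 oppr0.
Qed.

Variable l : nat.
Hypothesis l_gt0 : (0 < l)%N.

Let J := level_index I l.
Local Notation lb := (level_basis lam cell f (l := l)).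

Lemma level_base_node (j : J) : level (base_node j) = l.
Proof.
case: j => -[[i w] v] /= h; have /andP[/eqP /= sw _] := h.
by rewrite /level /base_node /= sw prednK.
Qed.

Lemma level_flat_node (j : J) : (sval j).2 != [::] -> (l < level (flat_node j))%N.
Proof.
case: j => -[[i w] v] /= h v0; have /andP[/eqP /= sw _] := h.
rewrite /level /flat_node /base_node /= size_cat sw -addSn prednK//.
by rewrite -[ltnLHS]addn0 ltn_add2l; case: v v0 {h}.
Qed.

Lemma bigI_flat_node (j : J) : (sval j).2 != [::] -> bigI (flat_node j).
Proof.
case: j => -[[i w] v] /= h v0; have /andP[_ /= lv] := h.
rewrite /bigI /flat_node /base_node /= last_cat.
by case: v v0 lv {h}.
Qed.

Lemma level_indexP (j j' : J) : (sval j).2 = [::] -> (sval j').2 = [::] ->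
  base_node j = base_node j' -> j = j'.
Proof.
case: j j' => -[n v] h [[n' v'] h'] /= v0 v'0; rewrite /base_node /= => nn'.
by apply: val_inj => /=; rewrite v0 v'0 nn'.
Qed.

Lemma flat_node_inj (j j' : J) : flat_node j = flat_node j' -> j = j'.
Proof.
case: j j' => -[[i w] v] h [[[i' w'] v'] h'].
rewrite /flat_node /base_node /= => -[-> wv].
have /andP[/eqP /= sw _] := h; have /andP[/eqP /= sw' _] := h'.
have ww' : w = w' by rewrite -(take_size_cat v sw) -(take_size_cat v' sw') wv.
have vv' : v = v' by rewrite -(drop_size_cat v sw) -(drop_size_cat v' sw') wv.
by apply: val_inj => /=; rewrite ww' vv'.
Qed.

Lemma level_basis_rank1 (j : J) : (sval j).2 = [::] ->
  (fun x => (lb j x)%:C) = (fun x =>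
    ((Num.sqrt (fine (lam (cell (base_node j)))))^-1)%:C * ind (base_node j) x).
Proof.
move=> v0; apply/funext => x; rewrite /level_basis v0 /normalized_indicator.
by rewrite mulrC rmorphM.
Qed.

Lemma level_basis_rank2 (j : J) : (sval j).2 != [::] -> lb j = f (flat_node j).
Proof. by rewrite /level_basis; case: (sval j).2. Qed.

Lemma sqint_level_basis (j : J) : sqint lam (fun x : borel S => (lb j x)%:C).
Proof.
have [v0|v0] := eqVneq (sval j).2 [::].
  by rewrite level_basis_rank1//; apply: sqintZ; exact: sqint_ind.
by rewrite level_basis_rank2//; apply: fL2; exact: bigI_flat_node.
Qed.

(** The rank 1 functions are normalized indicators of disjoint cells, the others belong to the given
    basis. The mixed case is [f_orth_ind], as flattened nodes of higher rank have level greater than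
    [l]. *)
Lemma level_basis_orthonormal :
  orthonormal_family lam [set: J] (fun j (x : borel S) => (lb j x)%:C).
Proof.
split=> [j _|j j' _ _]; first by apply/L2P; exact: sqint_level_basis.
have cross (j1 j2 : J) : (sval j1).2 != [::] -> (sval j2).2 = [::] ->
    inner lam (fun x : borel S => (lb j1 x)%:C) (fun x => (lb j2 x)%:C) = 0.
  move=> v1 v2; rewrite (level_basis_rank1 v2) (level_basis_rank2 v1).
  rewrite innerZr ?f_orth_ind ?mulr0//.
  - exact: bigI_flat_node.
  - by rewrite level_base_node level_flat_node.
  - exact: sqint_ind.
  - by apply: fL2; exact: bigI_flat_node.
have [v0|v0] := eqVneq (sval j).2 [::]; have [v0'|v0'] := eqVneq (sval j').2 [::].
- rewrite (level_basis_rank1 v0) (level_basis_rank1 v0').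
  rewrite innerZl ?innerZr; [|exact: sqint_ind|exact: sqint_ind|exact: sqint_ind|
    exact/sqintZ/sqint_ind].
  case: (eqVneq j j') => [<-|jj'].
    rewrite inner_ind// conj_realC -!rmorphM /=.
    have tt : Num.sqrt (fine (lam (cell (base_node j)))) *
        Num.sqrt (fine (lam (cell (base_node j)))) = fine (lam (cell (base_node j))).
      by rewrite -expr2 sqr_sqrtr// fine_ge0.
    have s0 := sqrt_cell_gt0 (base_node j); congr (_%:C).
    by move: (Num.sqrt _) s0 tt => r /lt0r_neq0 s0 <-; field.
  rewrite (_ : inner _ _ _ = 0) ?mulr0//.
  rewrite /inner (_ : (fun _ => _) = fun=> 0) ?Cintegral0//.
  apply/funext => x; rewrite /ind conj_realC !indicE.
  case: (boolP (x \in cell (base_node j))) => xj; last by rewrite mul0r.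
  case: (boolP (x \in cell (base_node j'))) => xj'; last by rewrite mulr0.
  rewrite !inE in xj xj'; have bb := cell_inj _ xj xj'.
  rewrite !level_base_node in bb; case/eqP: jj'.
  exact: level_indexP (bb erefl).
- rewrite inner_conj; [|exact: sqint_level_basis..].
  rewrite cross// conjC0; case: eqP => // e.
  by rewrite -e v0 in v0'.
- rewrite cross//; case: eqP => // e.
  by rewrite e v0' in v0.
- rewrite (level_basis_rank2 v0) (level_basis_rank2 v0') fO; try exact: bigI_flat_node.
  congr (_%:R); congr nat_of_bool; apply/eqP/eqP => [|->//].
  exact: flat_node_inj.
Qed.

(* Each [f n] is a finite combination of level basis functions: those of rank at most
   [l] are constant on the cells of level [l]. *)
Let span (h : S -> R[i]) : Prop := exists w : seq (R[i] * J),
  h = (fun x => \sum_(p <- w) p.1 * (lb p.2 x)%:C).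

Let spanD h h' : span h -> span h' -> span (fun x => h x + h' x).
Proof.
move=> [w ->] [w' ->]; exists (w ++ w').
by apply/funext => x; rewrite big_cat.
Qed.

Let spanZ c h : span h -> span (fun x => c * h x).
Proof.
move=> [w ->]; exists [seq (c * p.1, p.2) | p <- w].
by apply/funext => x; rewrite big_map mulr_sumr; apply: eq_bigr => p _; rewrite mulrA.
Qed.

Let span0 : span (fun=> 0).
Proof. by exists [::]; apply/funext => x; rewrite big_nil. Qed.

Let span_sum (K : eqType) (r : seq K) (F : K -> S -> R[i]) :
  (forall k, k \in r -> span (F k)) -> span (fun x => \sum_(k <- r) F k x).
Proof.
elim: r => [|k r ih] h.
  by under eq_fun do rewrite big_nil; exact: span0.
under eq_fun do rewrite big_cons; apply: spanD; first by apply: h; rewrite mem_head.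
by apply: ih => k' k'r; apply: h; rewrite in_cons k'r orbT.
Qed.

Let span_lb (j : J) : span (fun x => (lb j x)%:C).
Proof. by exists [:: (1, j)]; apply/funext => x; rewrite big_seq1 mul1r. Qed.

(** Induction on [l - level n]: split a coarse cell into its children until level [l] is reached. *)
Let span_ind n : (level n <= l)%N -> span (ind n).
Proof.
move: {2}(l - level n)%N (erefl (l - level n)%N) => k.
elim: k n => [|k ih] [i w] lk nl.
  have ll : level (i, w) = l by apply/eqP; rewrite eqn_leq nl -subn_eq0 lk.
  have h : level_index_pred l ((i, w), [::]).
    by rewrite /level_index_pred /= andbT -[l]ll.
  pose j : J := exist (fun p => is_true (level_index_pred l p)) _ h.
  have := spanZ (Num.sqrt (fine (lam (cell (i, w)))))%:C (span_lb j).
  congr span; apply/funext => x.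
  have := congr1 (@^~ x) (@level_basis_rank1 j erefl) => /= ->.
  by rewrite mulrA -rmorphM /= mulfV ?mul1r// gt_eqF// sqrt_cell_gt0.
rewrite ind_children.
have lS b : level (i, rcons w b) = (level (i, w)).+1 by rewrite /level /= size_rcons.
have lt : (level (i, w) < l)%N by rewrite -subn_gt0 lk.
by apply: spanD; apply: ih; rewrite lS// subnS lk.
Qed.

Let span_f n : bigI n -> span (fun x => (f n x)%:C).
Proof.
case: n => i w nI; have [lw|wl] := ltnP l (level (i, w)).
  have h : level_index_pred l ((i, take l.-1 w), drop l.-1 w).
    rewrite /level_index_pred /=; apply/andP; split.
      rewrite size_take; move: lw; rewrite /level /= ltnS => lw.
      by rewrite prednK// lw.
    move: nI; rewrite /bigI /= -{1}(cat_take_drop l.-1 w) last_cat.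
    by case: (drop l.-1 w).
  pose j : J := exist (fun p => is_true (level_index_pred l p)) _ h.
  have jE : flat_node j = (i, w) by rewrite /flat_node /base_node /= cat_take_drop.
  rewrite -jE -level_basis_rank2; first exact: span_lb.
  rewrite /= -size_eq0 size_drop subn_eq0 -ltnNge.
  by move: lw; rewrite /level /= ltnS; case: (l) l_gt0.
case/lastP: w nI wl => [|w b] nI wl.
  by rewrite f_rank1; apply: spanZ; exact: span_ind.
have -> : b = false by move: nI; rewrite /bigI /= last_rcons; case: b {wl}.
have [a [b' [_ _ ->]]] := f_children i w.
by apply: spanD; apply: spanZ; apply: span_ind; move: wl; rewrite /level /= !size_rcons.
Qed.

Lemma level_basis_orthonormal_basis :
  orthonormal_basis lam [set: J] (fun j (x : borel S) => (lb j x)%:C).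
Proof.
split; first exact: level_basis_orthonormal.
move=> g gL eps eps0; have [[_ h] _ _ _] := fP.
have [r [c [rI lt]]] := h g gL eps eps0.
have [w wE] : span (fun x => \sum_(j <- r) c j * (f j x)%:C).
  by apply: span_sum => k /rI kI; apply: spanZ; exact: span_f.
(* [w] may list an index several times, while the basis property asks for a coefficient function;
   the coefficients of equal indices are added up. *)
exists (undup [seq p.2 | p <- w]), (fun j => \sum_(p <- w | p.2 == j) p.1); split => //.
move: lt; congr (_ < _)%E; congr L2norm; apply/funext => x; congr (_ - _).
have := congr1 (@^~ x) wE => /= ->.
under [RHS]eq_bigr do rewrite mulr_suml.
rewrite (exchange_big_dep xpredT)//=; rewrite !big_seq; apply: eq_bigr => p pw.
rewrite -big_filter (_ : [seq j <- _ | _] = [:: p.2]) ?big_seq1//.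
have pin : p.2 \in undup [seq p.2 | p <- w] by rewrite mem_undup map_f.
have : perm_eq [seq j <- undup [seq p.2 | p <- w] | p.2 == j] [:: p.2].
  apply: uniq_perm => //; first by rewrite filter_uniq ?undup_uniq.
  move=> j; rewrite mem_filter inE eq_sym; case: eqP => // ->.
  by rewrite pin.
by move/perm_small_eq; apply.
Qed.

Lemma level_basis_out (j : J) x : ~ cell (base_node j) x -> lb j x = 0.
Proof.
move=> nx; have [v0|v0] := eqVneq (sval j).2 [::].
  by rewrite /level_basis v0 /normalized_indicator indicE memNset// mul0r.
rewrite level_basis_rank2//; apply/eqP; apply: contrapT => /negP.
move/(f_supp x (bigI_flat_node v0)) => h; apply: nx; move: h.
rewrite /basis_supp /flat_node /=; case: j v0 => -[[i w] v] /= h v0.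
rewrite /base_node /=; case wv : (w ++ v) => [|b u].
  by clear h v0; case: w wv.
rewrite -wv take_cat size_cat; case/lastP: v v0 {h wv} => // v b' _.
rewrite size_rcons addnS /= ltnNge leq_addr /= addKn.
exact: cell_prefix.
Qed.

(** The support is nonempty and lies in the base cell, and cells of one level are disjoint. The
    index set of the theorem thus becomes a condition on base nodes. *)
Lemma level_supp_sub (j : J) n : level n = l ->
  (level_supp cell j `<=` cell n) <-> base_node j = n.
Proof.
have sub : level_supp cell j `<=` cell (base_node j).
  move=> x; have [v0|v0] := eqVneq (sval j).2 [::].
    by rewrite /level_supp v0.
  have -> : level_supp cell j = basis_supp cell (flat_node j).
    by rewrite /level_supp; case: (sval j).2 v0.
  move/(f_supp x (bigI_flat_node v0)); rewrite -level_basis_rank2// => h.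
  by apply: contrapT => /level_basis_out h'; rewrite h' eqxx in h.
have [x xj] : level_supp cell j !=set0.
  rewrite /level_supp; case: (sval j).2 => [|_ _]; first exact: cell_neq0.
  by rewrite /basis_supp; case: (flat_node j) => i [|b u]; exact: cell_neq0.
move=> nl; split=> [jn|<-//].
by apply: (cell_inj _ (sub _ xj) (jn _ xj)); rewrite level_base_node.
Qed.

(** The partition is countable as a family of sets. Since its cells are nonempty and disjoint,
    distinct labels have distinct cells, which makes [I] countable too. *)
Lemma level_index_countable : exists iota : J -> nat, injective iota.
Proof.
have [h _ _] := cellP; have [/countable_injP[g gi] _ _ _] := h 1 isT.
pose c (i : I) := g (cell (i, [::])).
have ci : injective c.
  move=> i i' /gi e.
  have : cell (i, [::]) = cell (i', [::]).
    by apply: e; rewrite inE; [exists (i, [::])|exists (i', [::])].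
  have [x xi] := cell_neq0 (i, [::]) => cc.
  by have [] : (i, [::] : seq bool) = (i', [::]) by apply: (cell_inj _ xi) => //; rewrite -cc.
exists (fun j : J => pickle (c (sval j).1.1, (sval j).1.2, (sval j).2)).
move=> [[[i w] v] p] [[[i' w'] v'] p'] /(pcan_inj pickleK) /= [/ci ii' ww' vv'].
by apply: val_inj => /=; rewrite ii' ww' vv'.
Qed.

End LevelBasisTheory.

(** * Sesquilinear form of an expanded kernel *)

Section KernelForm.
Context {R : realType} d {T : measurableType d}.
Variable mu : {sigma_finite_measure set T -> \bar R}.
Variables (s : nat -> R) (psi phi : nat -> T -> R[i]).
Hypothesis s0 : forall n, 0 <= s n.
Hypothesis s_cvg : cvgn (series s).
Hypothesis mpsi : forall n, Cmeasurable (psi n).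
Hypothesis mphi : forall n, Cmeasurable (phi n).
Hypothesis psi1 : forall n, (\int[mu]_x (normc (psi n x) ^+ 2)%:E <= 1)%E.
Hypothesis phi1 : forall n, (\int[mu]_x (normc (phi n x) ^+ 2)%:E <= 1)%E.
Variable k : T -> T -> R[i].
Hypothesis mk : Cmeasurable (fun p : T * T => k p.1 p.2).
Hypothesis k_expansion : {ae (mu \x mu)%E, forall p,
  Ccvg (fun M => partial_kernel s psi phi M p.1 p.2) (k p.1 p.2)}.

Lemma kernel_form (u v : T -> R[i]) : sqint mu u -> sqint mu v ->
  Cintegrable (mu \x mu)%E setT (fun p => k p.1 p.2 * (u p.1)^* * v p.2) /\
  Ccvg (fun M => \sum_(n < M) (s n)%:C * inner mu (psi n) u * inner mu v (phi n))
    (Cintegral (mu \x mu)%E setT (fun p => k p.1 p.2 * (u p.1)^* * v p.2)).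
Proof.
move=> ui vi; have mu_ : Cmeasurable u by case: ui.
have mv_ : Cmeasurable v by case: vi.
pose q := kernel_dom s psi phi.
have m1 : Cmeasurable (fun p : T * T => (u p.1)^*).
  by apply: Cmeasurable_conj; exact: (Cmeasurable_comp mu_).
have m2 : Cmeasurable (fun p : T * T => v p.2) by exact: (Cmeasurable_comp mv_).
have termE M p : partial_kernel s psi phi M p.1 p.2 * (u p.1)^* * v p.2 =
    \sum_(n < M) (s n)%:C * ((psi n p.1 * (u p.1)^*) * (v p.2 * (phi n p.2)^*)).
  rewrite /partial_kernel mulr_suml mulr_suml; apply: eq_bigr => n _.
  by ring.
have prodP n := Cintegral_prod (Cintegrable_mul_conj (sqint_psi mpsi psi1 n) ui)
  (Cintegrable_mul_conj vi (sqint_phi mphi phi1 n)).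
rewrite (_ : (fun M => _) = (fun M => Cintegral (mu \x mu)%E setT
    (fun p => partial_kernel s psi phi M p.1 p.2 * (u p.1)^* * v p.2))); last first.
  apply/funext => M; rewrite (_ : (fun p => _) = (fun p : T * T =>
    \sum_(n < M) (s n)%:C * ((psi n p.1 * (u p.1)^*) * (v p.2 * (phi n p.2)^*)))); last first.
    by apply/funext => p; exact: termE.
  rewrite Cintegral_sum => [|n _]; last by apply: CintegrableZ; case: (prodP n).
  apply: eq_bigr => n _; have [i e] := prodP n.
  by rewrite CintegralZ// e mulrA.
(* From [sqrt (q x) * c <= q x + c ^+ 2], which bounds each variable by an integrable function of
   its own. *)
pose h1 x := q x + normc (u x) ^+ 2; pose h2 x := q x + normc (v x) ^+ 2.
have hi w : sqint mu w -> Cintegrable mu setT (fun x => (q x + normc (w x) ^+ 2)%:C).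
  move=> wi; split => /=; last exact: integrable0.
  under eq_fun do rewrite EFinD.
  by apply: integrableD => //; [exact: kernel_dom_integrable|exact: sqint_integrable].
have [[hint _] _] := Cintegral_prod (hi u ui) (hi v vi).
apply: (C_dominated_convergence (h := fun p => h1 p.1 * h2 p.2)).
- move=> M; apply: CmeasurableM => //; apply: CmeasurableM => //.
  exact: Cmeasurable_partial_kernel.
- by apply: CmeasurableM => //; apply: CmeasurableM.
- apply: filterS k_expansion => p kp.
  by apply: CcvgM; [apply: CcvgM => //; exact: Ccvg_cst|exact: Ccvg_cst].
- move: hint; congr (integrable _ _ _); apply/funext => p /=.
  by rewrite mulr0 subr0.
- have g1 := ae_prod_fst mu (ae_dom_good s0 s_cvg mpsi mphi psi1 phi1).
  have g2 := ae_prod_snd mu (ae_dom_good s0 s_cvg mpsi mphi psi1 phi1).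
  apply: filterS2 g1 g2 => p p1 p2 M.
  rewrite !normcM normc_conj.
  have ab (x : T) (c : R) : 0 <= c -> Num.sqrt (q x) * c <= q x + c ^+ 2.
    move=> c0; have q0 : 0 <= q x by exact: kernel_dom_ge0.
    have := sqrtr_ge0 (q x); have := sqr_sqrtr q0; move: (Num.sqrt _) => r <- r0.
    by nra.
  apply: (@le_trans _ _ ((Num.sqrt (q p.1) * normc (u p.1)) *
                         (Num.sqrt (q p.2) * normc (v p.2)))).
    rewrite mulrACA -mulrA ler_wpM2r ?mulr_ge0 ?normc_ge0//.
    exact: partial_kernel_le.
  apply: ler_pM; rewrite ?mulr_ge0 ?sqrtr_ge0 ?normc_ge0//;
    by rewrite /h1 /h2 ab ?normc_ge0.
Qed.

End KernelForm.

(** * Counting measure on a countable discrete space *)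

Section Counting.
Context {R : realType} d {X : measurableType d}.
Variable iota : X -> nat.
Hypothesis iota_inj : injective iota.
Hypothesis X_set1 : forall x : X, measurable [set x].

Let mu : {measure set X -> \bar R} := @counting X R.

Lemma discrete_measurable (A : set X) : measurable A.
Proof.
apply: countable_measurable => //; apply/countable_injP; exists iota.
by move=> x y _ _; exact: iota_inj.
Qed.

Lemma discrete_measurable_fun d' (Y : measurableType d') (f : X -> Y) :
  measurable_fun setT f.
Proof. by move=> _ A _; exact: discrete_measurable. Qed.

Lemma discrete_Cmeasurable (f : X -> R[i]) : Cmeasurable f.
Proof. by split; exact: discrete_measurable_fun. Qed.

Lemma discrete_Cmeasurable2 (f : X * X -> R[i]) : Cmeasurable f.
Proof.
suff h (A : set (X * X)) : measurable A by split=> ? ? ?; exact: h.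
apply: countable_measurable.
- move=> [x y]; rewrite (_ : [set _] = [set x] `*` [set y]); first exact: measurableX.
  by apply/seteqP; split => [[a b] [-> ->]|[a b] [/= -> ->]].
- apply/countable_injP; exists (fun p => pickle (iota p.1, iota p.2)).
  by move=> [x y] [x' y'] _ _ /(pcan_inj pickleK)[/iota_inj -> /iota_inj ->].
Qed.

Lemma counting_set1 x : mu [set x] = 1%E.
Proof.
rewrite /mu /= /counting asboolT; last exact: finite_set1.
by rewrite fset_set1 finmap.cardfs1.
Qed.

Lemma counting_ae (P : X -> Prop) : {ae mu, forall x, P x} -> forall x, P x.
Proof.
move=> [N [mN N0 NP]] x; apply: contrapT => nPx.
have : (mu [set x] <= mu N)%E.
  apply: le_measure; rewrite ?inE//.
  by move=> _ ->; exact: NP.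
by rewrite counting_set1 N0 leNgt lte01.
Qed.

Lemma counting_sigma_finite : sigma_finite setT mu.
Proof.
exists (fun n => [set x | iota x = n]).
  by apply/seteqP; split => // x _; exists (iota x).
move=> n; split; first exact: discrete_measurable.
have [[x xn]|nx] := pselect (exists x, iota x = n).
  rewrite (_ : [set _ | _] = [set x]) ?counting_set1 ?ltry//.
  by apply/seteqP; split => y /= => [yn|->//]; apply: iota_inj; rewrite yn xn.
rewrite (_ : [set _ | _] = set0) ?measure0//.
by apply/seteqP; split => // y yn; apply: nx; exists y.
Qed.

Let inv k : option X :=
  if pselect (exists x, iota x = k) is left h then Some (sval (cid h)) else None.

Let invP k x : inv k = Some x <-> iota x = k.
Proof.
rewrite /inv; case: pselect => [h|nh]; last by split => // e; case: nh; exists x.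
split => [[<-]|e]; first exact: (svalP (cid h)).
by congr Some; apply: iota_inj; rewrite (svalP (cid h)).
Qed.

(** Exhausts the space by finite lists, in the order of the codes. *)
Definition below N : seq X := pmap inv (seq.iota 0 N).

Lemma mem_below N x : (x \in below N) = (iota x < N)%N.
Proof.
rewrite /below mem_pmap; apply/mapP/idP => [[k]|xN].
  by rewrite mem_iota add0n => /andP[_ kN] /esym/invP ->.
by exists (iota x); [rewrite mem_iota add0n|exact/esym/invP].
Qed.

Lemma uniq_below N : uniq (below N).
Proof.
rewrite /below; elim: N => // N ih.
rewrite -addn1 iotaD pmap_cat cat_uniq ih /= add0n.
case E: (inv N) => [x|] //=; rewrite orbF andbT -/(below N) mem_below.
by move/invP : E => ->; rewrite ltnn.
Qed.

(** Matches the partial sums of [has_trace], for a basis indexed by the range of the codes, with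
    sums over [below]. *)
Lemma sum_below_inv (V : nmodType) N (F : X -> V) (G : nat -> V) :
  (forall x, G (iota x) = F x) ->
  \sum_(n < N | (n : nat) \in range iota) G n = \sum_(x <- below N) F x.
Proof.
move=> GF; rewrite -(big_mkord (fun n => n \in range iota)) /below /index_iota subn0.
elim: (seq.iota 0 N) => [|k r ih]; first by rewrite !big_nil.
rewrite big_cons /= ih; case E : (inv k) => [x|] /=.
  move/invP : E => <-; rewrite big_cons GF ifT//.
  by rewrite inE; exists x.
rewrite ifF//; apply/negbTE; apply/negP; rewrite inE => -[x _ xk].
by move: E; rewrite (invP k x).2.
Qed.

Lemma integral_below (h : X -> \bar R) N : (forall x, 0 <= h x)%E ->
  (\int[mu]_(x in [set` below N]) h x = \sum_(x <- below N) h x)%E.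
Proof.
move=> h0; rewrite (_ : [set` below N] = \big[setU/set0]_(x <- below N) [set x]).
  rewrite ge0_integral_bigsetU//.
  - apply: eq_bigr => x _; transitivity (\int[mu]_(y in [set x]) cst (h x) y)%E.
      by apply: eq_integral => y; rewrite inE => ->.
    by rewrite integral_cst// counting_set1 mule1.
  - exact: uniq_below.
  - by move=> x y _ _ [z [-> ->]].
  - by move=> _ A _; exact: discrete_measurable.
apply/seteqP; split => x /=; rewrite -bigcup_seq => xN; first by exists x.
by case: xN => y yN ->.
Qed.

Lemma counting_integral_cvg (h : X -> \bar R) : (forall x, 0 <= h x)%E ->
  ((\sum_(x <- below N) h x)%E @[N --> \oo] --> \int[mu]_x h x)%E.
Proof.
move=> h0; have -> : setT = \bigcup_N [set` below N].
  by apply/seteqP; split => // x _; exists (iota x).+1 => //=; rewrite mem_below.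
under eq_fun do rewrite -integral_below//.
apply: ge0_nondecreasing_set_cvg_integral => //.
- move=> N M NM; apply/subsetPset => x /=; rewrite !mem_below => xN.
  exact: leq_trans NM.
- by move=> N; exact: discrete_measurable.
- by move=> N _ A _; exact: discrete_measurable.
Qed.

Lemma Cintegral_counting (h : X -> R[i]) : Cintegrable mu setT h ->
  Ccvg (fun N => \sum_(x <- below N) h x) (Cintegral mu setT h).
Proof.
move=> hi.
have one x : Cintegrable mu setT (fun y => (\1_[set x] y : R)%:C) /\
    Cintegral mu setT (fun y => (\1_[set x] y : R)%:C) = 1.
  split; last first.
    rewrite /Cintegral /= integral0 integral_indic// setIT counting_set1//.
  split => /=; last exact: integrable0.
  apply/integrableP; split; first exact: discrete_measurable_fun.
  under eq_integral do rewrite gee0_abs ?lee_fin//.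
  by rewrite integral_indic// setIT counting_set1 ltry.
have -> : (fun N => \sum_(x <- below N) h x) = (fun N => Cintegral mu setT
    (fun y => \sum_(x <- below N) h x * (\1_[set x] y : R)%:C)).
  apply/funext => N; rewrite Cintegral_sum => [|x _].
    by apply: eq_bigr => x _; have [i e] := one x; rewrite CintegralZ// e mulr1.
  by apply: CintegrableZ; case: (one x).
have E N y : \sum_(x <- below N) h x * (\1_[set x] y : R)%:C =
    if (iota y < N)%N then h y else 0.
  case: ifPn; rewrite -mem_below => yN.
    rewrite (bigD1_seq y)//=; last exact: uniq_below.
    rewrite indicE mem_set//= mulr1 big1 ?addr0// => x xy.
    by rewrite indicE memNset ?mulr0//= => yx; rewrite yx eqxx in xy.
  rewrite big_seq big1// => x xN; rewrite indicE memNset ?mulr0//= => yx.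
  by rewrite yx xN in yN.
have [] := @C_dominated_convergence _ _ _ mu
  (fun N y => \sum_(x <- below N) h x * (\1_[set x] y : R)%:C) h (fun y => normc (h y)) => //.
- by move=> N; exact: discrete_Cmeasurable.
- exact: discrete_Cmeasurable.
- apply: nearW => y; have near_eq : \forall N \near \oo,
      h y = \sum_(x <- below N) h x * (\1_[set x] y : R)%:C.
    by exists (iota y).+1 => // N /= yN; rewrite E yN.
  by split; apply: cvg_near_cst; apply: filterS near_eq => N <-.
- exact: Cintegrable_normc.
- apply: nearW => y N; rewrite E; case: ifP => // _.
  by rewrite normc0 normc_ge0.
Qed.

End Counting.

(** * Comparison of the determinant integrals *)

Section CellFamily.
Context {R : realType} {S : ptopologicalType} {I : pointedType}.
Variable lam : {measure set (borel S) -> \bar R}.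
Variable cell : node I -> set S.
Hypothesis lam_compact : forall K : set S, compact K -> (lam K < +oo)%E.
Hypothesis cellP : nested_partitions lam cell.

Lemma node_countable : exists code : node I -> nat, injective code.
Proof.
have [g gi] := level_index_countable cellP 1.
have rank1 i : level_index_pred 1 ((i, [::]) : node I, [::]) by [].
pose j i : level_index I 1 := exist (fun p => is_true (level_index_pred 1 p)) _ (rank1 i).
exists (fun n => pickle (g (j n.1), n.2)).
by move=> [i w] [i' w'] /(pcan_inj pickleK)[/gi [->] ->].
Qed.

Lemma cell_setI n n' : (level n <= level n')%N ->
  cell n `&` cell n' = set0 \/ cell n `&` cell n' = cell n'.
Proof.
move=> nn'; have [->|/set0P[x [xn xn']]] := eqVneq (cell n `&` cell n') set0.
  by left.
right; apply/setIidPr; case: n' nn' xn' => i w nn' xn'.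
have sub : cell (i, w) `<=` cell (i, take (size n.2) w).
  by rewrite -{1}(cat_take_drop (size n.2) w); exact: (cell_prefix cellP).
have -> : n = (i, take (size n.2) w).
  apply: (cell_inj cellP _ xn (sub _ xn')); rewrite /level /= size_takel//.
exact: sub.
Qed.

Lemma cell_family : exists C : nat -> set (borel S),
  [/\ forall n, measurable (C n), forall n, (lam (C n) < +oo)%E,
      setI_closed (range C), @measurable _ (borel S) = <<s range C >> &
      \bigcup_n C n = setT].
Proof.
have [code code_inj] := node_countable.
(* Code 0 is reserved for the empty set, which two disjoint cells need for closure under
   intersection. *)
pose C k : set (borel S) :=
  if pselect (exists n, (code n).+1 = k) is left h then cell (sval (cid h)) else set0.
have CP k : C k = set0 \/ exists n, C k = cell n.
  by rewrite /C; case: pselect => [h|_]; [right; eexists|left].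
have C0 : C 0%N = set0 by rewrite /C; case: pselect => // -[].
have CE n : C (code n).+1 = cell n.
  rewrite /C; case: pselect => [h|[]]; last by exists n.
  by congr cell; have := svalP (cid h) => -[/code_inj].
have mC k : measurable (C k).
  by have [->//|[n ->]] := CP k; exact: (cell_measurable cellP).
exists C; split=> //.
- move=> k; have [->|[n ->]] := CP k; first by rewrite measure0 ltry.
  exact: (cell_lty lam_compact cellP).
- have H n n' : (level n <= level n')%N -> range C (cell n `&` cell n').
    by case/cell_setI => ->; [exists 0%N|exists (code n').+1].
  move=> _ _ [k _ <-] [k' _ <-].
  have [->|[n ->]] := CP k; first by rewrite set0I; exists 0%N.
  have [->|[n' ->]] := CP k'; first by rewrite setI0; exists 0%N.
  have [|/ltnW] := leqP (level n) (level n'); first exact: H.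
  by rewrite setIC; exact: H.
- apply/seteqP; split.
    have [_ _ <-] := cellP; apply: smallest_sub; first exact: smallest_sigma_algebra.
    move=> B [l _]; apply: smallest_sub; first exact: smallest_sigma_algebra.
    by move=> _ [n _ <-]; apply: sub_sigma_algebra; exists (code n).+1.
  apply: smallest_sub; first exact: sigma_algebra_measurable.
  by move=> _ [k _ <-].
- apply/seteqP; split => // x _; have [n _ xn] := cell_cover cellP x (isT : (0 < 1)%N).
  by exists (code n).+1 => //; rewrite CE.
Qed.

Lemma lam_sigma_finite : sigma_finite setT lam.
Proof.
have [C [mC Cfin _ _ CU]] := cell_family.
by exists C => // n; split.
Qed.

End CellFamily.

(** [has_trace] quantifies over bases indexed by subsets of [nat]. *)
Lemma orthonormal_basis_reindex (R : realType) d (T : measurableType d)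
    (lam : {measure set T -> \bar R}) (J : choiceType) (iota : J -> nat)
    (e : J -> T -> R[i]) : injective iota -> orthonormal_basis lam [set: J] e ->
  exists e' : nat -> T -> R[i],
    (forall j, e' (iota j) = e j) /\ orthonormal_basis lam (range iota) e'.
Proof.
move=> iota_inj [[eL2 eO] ebasis].
pose e' n := if pselect (exists j, iota j = n) is left h then e (sval (cid h))
  else fun=> 0.
have e'E j : e' (iota j) = e j.
  rewrite /e'; case: pselect => [h|[]]; last by exists j.
  by congr e; exact: iota_inj (svalP (cid h)).
exists e'; split=> //; split.
  split=> [_ [j _ <-]|_ _ [j _ <-] [j' _ <-]]; rewrite !e'E; first exact: eL2.
  by rewrite eO// (inj_eq iota_inj).
move=> g gL2 eps eps0; have [r [c [_ rc]]] := ebasis g gL2 eps eps0.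
exists (map iota r), (fun n => if pselect (exists j, iota j = n) is left h
  then c (sval (cid h)) else 0); split.
  by move=> _ /mapP[j _ ->]; exists j.
suff -> : (fun x => g x - \sum_(k <- map iota r) (if pselect (exists j, iota j = k)
    is left h then c (sval (cid h)) else 0) * e' k x) =
  (fun x => g x - \sum_(j <- r) c j * e j x) by [].
apply/funext => x; congr (_ - _).
rewrite big_map; apply: eq_bigr => j _; rewrite e'E; congr (_ * _).
case: pselect => [h|[]]; last by exists j.
by congr c; exact: iota_inj (svalP (cid h)).
Qed.

Lemma Ccvg_normc_le (R : realType) (u : nat -> R[i]) l (B : R) :
  Ccvg u l -> (forall n, normc (u n) <= B) -> normc l <= B.
Proof.
move=> [ur ui] uB; have B0 : 0 <= B by exact: le_trans (normc_ge0 _) (uB 0%N).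
have u2 : (Re (u n) ^+ 2 + Im (u n) ^+ 2) @[n --> \oo] --> Re l ^+ 2 + Im l ^+ 2.
  by rewrite !expr2; apply: cvgD; apply: cvgM.
rewrite -(@ler_pXn2r _ 2)// ?nnegrE ?normc_ge0// normc_sqr.
rewrite -(cvg_lim (@Rhausdorff R) u2); apply: limr_le.
  by apply/cvg_ex; exists (Re l ^+ 2 + Im l ^+ 2).
by apply: nearW => n; rewrite -normc_sqr ler_pXn2r// nnegrE ?normc_ge0.
Qed.

Lemma indic_in (R : pzRingType) T (A : set T) x : A x -> \1_A x = 1 :> R.
Proof. by move=> Ax; rewrite indicE mem_set. Qed.

Lemma indic_out (R : pzRingType) T (A : set T) x : ~ A x -> \1_A x = 0 :> R.
Proof. by move=> Ax; rewrite indicE memNset. Qed.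

Section DeterminantIntegrals.
Context {R : realType} {S : ptopologicalType} {I : pointedType}.
Variable lam : {sigma_finite_measure set (borel S) -> \bar R}.
Variable cell : node I -> set S.
Variable f : node I -> S -> R.
Hypothesis lam_compact : forall K : set S, compact K -> (lam K < +oo)%E.
Hypothesis cellP : nested_partitions lam cell.
Hypothesis fP : adapted_basis lam cell f.
Variable l : nat.
Hypothesis l_gt0 : (0 < l)%N.
Variable K : S -> S -> R[i].
Hypothesis mK : kernel_measurable K.
Hypothesis K_tf : trace_formula lam K.
Variables (m : nat) (a : 'I_m -> node I).
Hypothesis a_level : forall i, level (a i) = l.
Variable alpha : R.

Let X := borel (level_space I l).
Let e (j : X) (x : borel S) : R[i] := (level_basis lam cell f j x)%:C.
Let KF : X -> X -> R[i] := level_kernel lam cell f K.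
Let cellA i : set (borel S) := cell (a i).
(** By [level_supp_sub], the indices whose support lies in the i-th cell. *)
Let idx i : set X := [set j | base_node j = a i].

Lemma level_space_set1 (x : X) : measurable [set x].
Proof. by apply: sub_sigma_algebra; exact: discrete_open. Qed.

Let mA i : measurable (cellA i). Proof. exact: (cell_measurable cellP). Qed.

Let oneb := level_basis_orthonormal_basis lam_compact cellP fP l_gt0.

Section Expansion.
Variable cnt : {sigma_finite_measure set X -> \bar R}.
Hypothesis cntE : (cnt : set X -> \bar R) = counting.
Variable iota : X -> nat.
Hypothesis iota_inj : injective iota.
Variable C : set S.
Hypothesis AC : forall i, cellA i `<=` C.
Variables (s : nat -> R) (psi phi : nat -> borel S -> R[i]).
Hypothesis s0 : forall n, 0 <= s n.
Hypothesis s_cvg : cvgn (series s).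
Hypothesis mpsi : forall n, Cmeasurable (psi n).
Hypothesis mphi : forall n, Cmeasurable (phi n).
Hypothesis psi1 : forall n, (\int[lam]_x (normc (psi n x) ^+ 2)%:E <= 1)%E.
Hypothesis phi1 : forall n, (\int[lam]_x (normc (phi n x) ^+ 2)%:E <= 1)%E.
Let k : borel S -> borel S -> R[i] := cut_kernel C K.
Hypothesis mk : Cmeasurable (fun p : borel S * borel S => k p.1 p.2).
Hypothesis k_expansion : {ae (lam \x lam)%E, forall p,
  Ccvg (fun M => partial_kernel s psi phi M p.1 p.2) (k p.1 p.2)}.

Let psih n (j : X) : R[i] := inner lam (psi n) (e j).
Let phih n (j : X) : R[i] := inner lam (phi n) (e j).

Let sqint_e j : sqint lam (e j).
Proof. exact: (sqint_level_basis lam_compact cellP fP). Qed.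

Let spsi n : sqint lam (psi n). Proof. exact: sqint_psi. Qed.
Let sphi n : sqint lam (phi n). Proof. exact: sqint_phi. Qed.

Let e_out i j x : idx i j -> ~ cellA i x -> e j x = 0.
Proof.
move=> ij nx; rewrite /e (level_basis_out cellP fP)//.
by rewrite ij.
Qed.

Let e_out' i j x : ~ idx i j -> cellA i x -> e j x = 0.
Proof.
move=> ij ax; rewrite /e (level_basis_out cellP fP)// => bx; apply: ij.
by apply: (cell_inj cellP _ bx ax); rewrite a_level level_base_node.
Qed.

Let hat_le1 (g : borel S -> R[i]) : Cmeasurable g ->
  (\int[lam]_x (normc (g x) ^+ 2)%:E <= 1)%E ->
  (\int[cnt]_j (normc (inner lam g (e j)) ^+ 2)%:E <= 1)%E.
Proof.
move=> mg g1; rewrite cntE.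
have sg : sqint lam g by split => //; exact: le_lt_trans g1 (ltry _).
have c := counting_integral_cvg iota_inj level_space_set1
  (h := fun j => (normc (inner lam g (e j)) ^+ 2)%:E) (fun j => sqr_ge0 _).
rewrite -(cvg_lim _ c)//; apply: lime_le; first by apply/cvg_ex; eexists; exact: c.
apply: nearW => N; rewrite sumEFin; apply: le_trans g1.
rewrite (sqint_fineK sg) lee_fin.
by apply: (bessel oneb.1) => //; exact: uniq_below.
Qed.

(** Holds for every pair of indices, diagonal ones included, because the coefficients are integrals.
    Cutting [K] to [C] does not change them, as both basis functions vanish outside cells contained
    in [C]. *)
Let KF_cvg i i' j j' : idx i j -> idx i' j' ->
  Ccvg (fun M => partial_kernel s psih phih M j j') (KF j j').
Proof.
move=> ij ij'; have [_] := kernel_form s0 s_cvg mpsi mphi psi1 phi1 mk k_expansion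
  (sqint_e j) (sqint_e j').
congr (Ccvg _ _).
  apply/funext => M; apply: eq_bigr => n _; rewrite /psih /phih.
  by congr (_ * _); rewrite inner_conj.
apply: eq_Cintegral => p _; rewrite /k /cut_kernel conj_realC.
rewrite -/(e j p.1) -/(e j' p.2).
have [p1|p1] := pselect (cellA i p.1); last by rewrite (e_out ij p1) /= !(mulr0,mul0r).
have [p2|p2] := pselect (cellA i' p.2); last by rewrite (e_out ij' p2) /= !(mulr0,mul0r).
by rewrite (indic_in _ (AC p1)) (indic_in _ (AC p2)) mul1r mulr1.
Qed.

(** For [K] the integrability of the diagonal is part of the trace formula; here it follows from the
    bound of the diagonal by [kernel_dom]. *)
Let hat_diag i : Cintegrable cnt (idx i) (fun j => KF j j) /\
  Ccvg (fun N => \sum_(j <- below iota N) (\1_(idx i) j : R)%:C * KF j j)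
    (Cintegral cnt (idx i) (fun j => KF j j)).
Proof.
have mi : measurable (idx i) := discrete_measurable iota_inj level_space_set1 _.
have p1 n := hat_le1 (mpsi n) (psi1 n); have p2 n := hat_le1 (mphi n) (phi1 n).
have mh (h : X -> R[i]) : Cmeasurable h.
  exact: (discrete_Cmeasurable iota_inj level_space_set1).
(* For counting measure almost everywhere means everywhere. *)
have good : forall j, dom_good s psih phih j.
  apply: (counting_ae (R := R) level_space_set1).
  have [N [mN N0 NP]] := ae_dom_good s0 s_cvg (fun n => mh (psih n)) (fun n => mh (phih n)) p1 p2.
  exists N; split; [exact: mN|exact: etrans (congr1 (@^~ N) (esym cntE)) N0|exact: NP].
have qint := kernel_dom_integrable s0 s_cvg (fun n => mh (psih n)) (fun n => mh (phih n)) p1 p2.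
have ki : Cintegrable cnt setT (fun j => (\1_(idx i) j : R)%:C * KF j j).
  apply: (le_Cintegrable (mh _) qint) => j.
  have [ij|ij] := pselect (idx i j); last first.
    by rewrite indicE memNset// mul0r normc0 kernel_dom_ge0.
  rewrite indicE mem_set// mul1r; apply: (Ccvg_normc_le (KF_cvg ij ij)) => M.
  rewrite -(sqr_sqrt_dom psih phih s0 j).
  exact: (partial_kernel_le s0 M (good j) (good j)).
split; first exact/(Cintegrable_mkcond _ _ mi).
move: ki; rewrite cntE Cintegral_mkcond.
exact: (Cintegral_counting iota_inj level_space_set1).
Qed.

(** A basis function based in another cell vanishes on the i-th one, so the cut operator kills it.
    For the remaining ones the iterated integral of the operator has to be turned into the double
    integral of [level_kernel]. *)
Let operator_form i j :
  inner lam (kernel_operator lam (cut_kernel (cellA i) K : borel S -> borel S -> R[i]) (e j)) (e j) =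
  (\1_(idx i) j : R)%:C * KF j j.
Proof.
pose A := cellA i.
have cutE x y : cut_kernel A K x y * e j y =
    if j \in idx i then k x y * ((\1_A x : R)%:C)^* * e j y else 0.
  rewrite conj_realC /cut_kernel; case: ifPn => ij.
    have {}ij : idx i j by move: ij; rewrite inE.
    have [ay|ay] := pselect (A y); last by rewrite (e_out ij ay) !mulr0.
    rewrite /k /cut_kernel (indic_in _ (AC ay)) (indic_in _ ay).
    have [ax|ax] := pselect (A x); last by rewrite (indic_out _ ax) !(mul0r, mulr0).
    by rewrite (indic_in _ (AC ax)) (indic_in _ ax) !(mul1r, mulr1).
  have {}ij : ~ idx i j by move: ij; rewrite notin_setE.
  have [ay|ay] := pselect (A y); first by rewrite (e_out' ij ay) mulr0.
  by rewrite (indic_out _ ay) mulr0 mul0r.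
rewrite /kernel_operator /=.
have [ij|ij] := boolP (j \in idx i); last first.
  rewrite indicE (negPf ij) mul0r (_ : (fun x => _) = fun=> 0) ?inner0l//.
  apply/funext => x; rewrite -[RHS](Cintegral0 lam); apply: eq_Cintegral => y _.
  by rewrite cutE (negPf ij).
have {}ij' : idx i j by move: ij; rewrite inE.
have sA := sqint_indicC (mA i) (cell_lty lam_compact cellP (a i)).
(* Testing with the indicator of the cell makes almost every section over the cell integrable before
   it is multiplied by [e j x], so that this factor can be moved into the inner integral. *)
have [i1 _] := kernel_form s0 s_cvg mpsi mphi psi1 phi1 mk k_expansion sA (sqint_e j).
have [i2 _] := kernel_form s0 s_cvg mpsi mphi psi1 phi1 mk k_expansion (sqint_e j) (sqint_e j).
have [ae1 m1 _] := C_Fubini i1; have [_ m2 e2] := C_Fubini i2.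
rewrite indicE ij mul1r.
transitivity (Cintegral (lam \x lam)%E setT (fun p => k p.1 p.2 * (e j p.1)^* * e j p.2)).
  rewrite e2 /inner (_ : (fun x => Cintegral lam setT (fun y => cut_kernel A K x y * e j y) * _) =
    (fun x => Cintegral lam setT (fun y => k x y * ((\1_A x : R)%:C)^* * e j y) * (e j x)^*)); last first.
    apply/funext => x; congr (_ * _); apply: eq_Cintegral => y _.
    by rewrite cutE ij.
  apply: ae_eq_Cintegral.
  - apply: CmeasurableM; first exact: Cintegrable_measurable m1.
    by apply: Cmeasurable_conj; case: (sqint_e j).
  - exact: Cintegrable_measurable m2.
  apply: filterS ae1 => x ix; rewrite mulrC -CintegralZ//.
  apply: eq_Cintegral => y _ /=; have [ax|ax] := pselect (A x).
    by rewrite (indic_in _ ax) !conj_realC mulr1; ring.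
  by rewrite (e_out ij' ax) !conj_realC !(mul0r, mulr0).
apply: eq_Cintegral => p _; rewrite /k /cut_kernel conj_realC.
rewrite -/(e j p.1) -/(e j p.2).
have [p1|p1] := pselect (cellA i p.1); last by rewrite (e_out ij' p1) /= !(mulr0,mul0r).
have [p2|p2] := pselect (cellA i p.2); last by rewrite (e_out ij' p2) /= !(mulr0,mul0r).
by rewrite (indic_in _ (AC p1)) (indic_in _ (AC p2)) mul1r mulr1.
Qed.

(** The trace formula equates the diagonal integral with the trace of the operator cut to the cell,
    and a trace may be computed in the level basis. *)
Let diag_eq i : Cintegral cnt (idx i) (fun j => KF j j) =
  Cintegral lam (cellA i) (fun x => K x x).
Proof.
have [_ c1] := hat_diag i; apply: Ccvg_unique c1 _.
have [_ tr] := K_tf (mA i) (cell_compact cellP (n := a i)).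
have [e' [e'E oe']] := orthonormal_basis_reindex iota_inj oneb.
have /Ccvg_normc := tr _ _ oe'.
congr (Ccvg _ _); apply/funext => N.
apply: (@sum_below_inv _ _ _ iota_inj R[i] N (fun j => (\1_(idx i) j : R)%:C * KF j j)
  (fun n => inner lam (kernel_operator lam (cut_kernel (cellA i) K) (e' n)) (e' n))) => j.
by rewrite e'E; exact: operator_form.
Qed.

(** Parseval for [psi n] cut to the cell and [phi n']. Since a basis function lives in one cell, the
    cut keeps the coefficients with index in [idx i] and annihilates the others. *)
Let gram_eq i n n' : Cintegral cnt (idx i) (fun j => psih n j * (phih n' j)^*) =
  Cintegral lam (cellA i) (fun x => psi n x * (phi n' x)^*).
Proof.
have mh (h : X -> R[i]) : Cmeasurable h.
  exact: (discrete_Cmeasurable iota_inj level_space_set1).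
have mi : measurable (idx i) := discrete_measurable iota_inj level_space_set1 _.
have sh g : Cmeasurable g -> (\int[lam]_x (normc (g x) ^+ 2)%:E <= 1)%E ->
    sqint cnt (fun j => inner lam g (e j)).
  move=> mg g1; split; first exact: mh.
  exact: le_lt_trans (hat_le1 mg g1) (ltry _).
have hi : Cintegrable cnt setT (fun j => (\1_(idx i) j : R)%:C * psih n j * (phih n' j)^*) :=
  Cintegrable_mul_conj (sqint_indic mi (sh _ (mpsi n) (psi1 n))) (sh _ (mphi n') (phi1 n')).
rewrite [RHS]Cintegral_mkcond.
transitivity (inner lam (fun x => (\1_(cellA i) x : R)%:C * psi n x) (phi n')); last first.
  by apply: eq_Cintegral => x _; rewrite mulrA.
have sA := sqint_indic (mA i) (spsi n).
have cv : Ccvg (fun N => \sum_(j <- below iota N)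
    inner lam (fun x => (\1_(cellA i) x : R)%:C * psi n x) (e j) * (inner lam (phi n') (e j))^*)
    (inner lam (fun x => (\1_(cellA i) x : R)%:C * psi n x) (phi n')).
  apply: (parseval oneb.1 oneb.2) => //; first exact: uniq_below.
  by move=> j _; exists (iota j).+1 => N jN; exact: (eq_ind_r is_true jN (mem_below iota_inj N j)).
apply: Ccvg_unique cv.
move: hi; rewrite cntE [in X in _ -> X]Cintegral_mkcond => hi.
have := Cintegral_counting iota_inj level_space_set1 hi.
congr (Ccvg _ _); last first.
  by apply: eq_Cintegral => j _; rewrite mulrA.
apply/funext => N; apply: eq_bigr => j _; congr (_ * _).
have [ij|ij] := pselect (idx i j).
  rewrite (indic_in _ ij) mul1r; apply: eq_Cintegral => x _.
  have [ax|ax] := pselect (cellA i x); first by rewrite (indic_in _ ax) mul1r.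
  by rewrite -/(e j x) (e_out ij ax) conj_realC !mulr0.
rewrite (indic_out _ ij) mul0r -[LHS](Cintegral0 lam); apply: eq_Cintegral => x _.
have [ax|ax] := pselect (cellA i x); last by rewrite (indic_out _ ax) !mul0r.
by rewrite -/(e j x) (e_out' ij ax) conj_realC mulr0.
Qed.

Lemma det_alpha_integral_expansion :
  let F := fun x : m.-tuple (borel S) =>
    det_alpha alpha (\matrix_(i < m, j < m) K (tnth x i) (tnth x j)) in
  let G := fun x : m.-tuple X =>
    det_alpha alpha (\matrix_(i < m, j < m) KF (tnth x i) (tnth x j)) in
  [/\ Cintegrable (power_sfm lam m) (box cellA) F,
      Cintegrable (power_sfm cnt m) (box idx) G &
      Cintegral (power_sfm lam m) (box cellA) F =
      Cintegral (power_sfm cnt m) (box idx) G].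
Proof.
move=> F G.
have mi i : measurable (idx i) := discrete_measurable iota_inj level_space_set1 _.
have mh (h : X -> R[i]) : Cmeasurable h.
  exact: (discrete_Cmeasurable iota_inj level_space_set1).
have expA : {ae (lam \x lam)%E, forall p, forall i j, cellA i p.1 -> cellA j p.2 ->
    Ccvg (fun M => partial_kernel s psi phi M p.1 p.2) (K p.1 p.2)}.
  apply: filterS k_expansion => p kp i j p1 p2; move: kp.
  by rewrite /k /cut_kernel (indic_in _ (AC p1)) (indic_in _ (AC p2)) mul1r mulr1.
have diagA i : Cintegrable lam (cellA i) (fun x => K x x).
  exact: (K_tf (mA i) (cell_compact cellP (n := a i))).1.
have expI : {ae (cnt \x cnt)%E, forall p, forall i j, idx i p.1 -> idx j p.2 ->
    Ccvg (fun M => partial_kernel s psih phih M p.1 p.2) (KF p.1 p.2)}.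
  by apply: nearW => p i j; exact: KF_cvg.
have [iF cF] := det_alpha_integral s0 s_cvg mpsi mphi psi1 phi1 mA mK diagA expA alpha.
have [iG cG] := det_alpha_integral s0 s_cvg (fun n => mh (psih n)) (fun n => mh (phih n))
  (fun n => hat_le1 (mpsi n) (psi1 n)) (fun n => hat_le1 (mphi n) (phi1 n)) mi
  (discrete_Cmeasurable2 iota_inj level_space_set1 _) (fun i => (hat_diag i).1) expI alpha.
split=> //; apply: Ccvg_unique cF _.
move: cG; congr (Ccvg _ _); apply/funext => M; apply: eq_bigr => sg _; congr (_ * _).
rewrite /cyc_approx; apply: eq_bigr => g _; apply: eq_bigr => i _.
by rewrite gram_eq diag_eq.
Qed.

End Expansion.

Lemma det_alpha_integral_sigma_finite : locally_trace_class lam K ->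
  let F := fun x : m.-tuple (borel S) =>
    det_alpha alpha (\matrix_(i < m, j < m) K (tnth x i) (tnth x j)) in
  let G := fun x : m.-tuple X =>
    det_alpha alpha (\matrix_(i < m, j < m) KF (tnth x i) (tnth x j)) in
  [/\ Cintegrable (power_measure lam m) (box cellA) F,
      Cintegrable (power_measure (counting : set X -> \bar R) m) (box idx) G &
      Cintegral (power_measure lam m) (box cellA) F =
      Cintegral (power_measure (counting : set X -> \bar R) m) (box idx) G].
Proof.
move=> K_tc F G.
have [iota iota_inj] : exists iota : X -> nat, injective iota.
  exact: (level_index_countable cellP l).
have [cnt cntE] := sigma_finite_measureP
  (counting_sigma_finite (R := R) iota_inj level_space_set1).
(* One compact set for all factors: a single expansion has to cover arguments from different
   cells. *)
pose C : set S := \big[setU/set0]_(i < m) closure (cell (a i)).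
have C_compact : compact C.
  by apply: bigsetU_compact => i _; exact: (cell_compact cellP).
have C_closed : closed C.
  by apply: closed_bigsetU => i _; exact: closed_closure.
have AC i : cellA i `<=` C.
  by move=> x ax; rewrite /C (bigD1 i)//=; left; exact: subset_closure.
have mC : measurable (C : set (borel S)) by exact: closed_borel.
have mk : Cmeasurable (fun p : borel S * borel S => cut_kernel C K p.1 p.2).
  have mI := Cmeasurable_indic mC (R := R).
  apply: CmeasurableM; last exact: (Cmeasurable_comp mI).
  by apply: CmeasurableM; [exact: (Cmeasurable_comp mI)|exact: mK].
have [C' [mC' C'fin C'I C'gen C'U]] := cell_family lam_compact cellP.
have [s [psi [phi [[s0 sc mpsi mphi] psi1 phi1 kx]]]] :=
  trace_class_expansion mC' C'fin C'I C'gen C'U mk (K_tc C C_compact).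
have := det_alpha_integral_expansion cntE iota_inj AC s0 sc mpsi mphi psi1 phi1 mk kx.
by rewrite !power_sfmE cntE.
Qed.

End DeterminantIntegrals.

Lemma det_alpha_integral_level (R : realType) (S : ptopologicalType) (I : pointedType)
    (lam : {measure set (borel S) -> \bar R}) (cell : node I -> set S)
    (f : node I -> S -> R) (l : nat) (K : S -> S -> R[i]) (m : nat)
    (a : 'I_m -> node I) (alpha : R) :
  (forall K : set S, compact K -> (lam K < +oo)%E) ->
  nested_partitions lam cell -> adapted_basis lam cell f -> (0 < l)%N ->
  kernel_measurable K -> trace_formula lam K -> locally_trace_class lam K ->
  (forall i, level (a i) = l) ->
  let F := fun x : m.-tuple (borel S) =>
    det_alpha alpha (\matrix_(i < m, j < m) K (tnth x i) (tnth x j)) in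
  let G := fun x : m.-tuple (borel (level_space I l)) =>
    det_alpha alpha (\matrix_(i < m, j < m)
      level_kernel lam cell f K (tnth x i) (tnth x j)) in
  let cellA := box (fun i => cell (a i) : set (borel S)) in
  let idx := box (fun i => [set j | base_node j = a i] : set (borel (level_space I l))) in
  [/\ Cintegrable (power_measure lam m) cellA F,
      Cintegrable (power_measure counting m) idx G &
      Cintegral (power_measure lam m) cellA F = Cintegral (power_measure counting m) idx G].
Proof.
move=> lc cP; have [lam' lamE] := sigma_finite_measureP (lam_sigma_finite lc cP).
have {}lamE : lam = lam' by apply: eq_measure; rewrite -lamE.
move: lc cP; rewrite lamE => *; exact: det_alpha_integral_sigma_finite.
Qed.

(** * Measurability of counts for the vague topology *)

Lemma borel_measurable_continuous (R : realType) (T : ptopologicalType) (g : T -> R) :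
  continuous g -> measurable_fun setT (g : borel T -> R).
Proof.
move=> /continuousP cg; apply: (measurability _ (RGenOpens.measurableE R)).
move=> _ [_ [a [b ->] <-]]; rewrite setTI; apply: sub_sigma_algebra.
exact/cg/interval_open.
Qed.

Lemma open_rel_compact_nbhd (S : ptopologicalType) (C : set S) :
  locally_compact [set: S] -> compact C ->
  exists W : set S, [/\ open W, C `<=` W & compact (closure W)].
Proof.
move=> lc cC.
have H (x : S) : exists Q : set S, [/\ nbhs x Q, compact Q & closed Q].
  have [Q xQ [cQ kQ]] : compact_near (within setT (nbhs x)) by exact: lc.
  exists Q; split=> //.
  by move: xQ; rewrite withinET.
have [Q HQ] := choice H.
have : cover_compact C by rewrite -compact_cover.
move=> /(_ S setT (fun x => interior (Q x)))[||D _ CD].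
- by move=> x _; exact: open_interior.
- by move=> x _; exists x => //; have [xQ _ _] := HQ x; exact: xQ.
have {D CD}[r Cr] : exists r : seq S, C `<=` \bigcup_(x in [set` r]) interior (Q x).
  by exists (finmap.enum_fset D).
exists (\bigcup_(x in [set` r]) interior (Q x)); split => //.
  by apply: bigcup_open => x _; exact: open_interior.
have cl : closed (\big[setU/set0]_(x <- r) Q x).
  by apply: closed_bigsetU => x _; have [] := HQ x.
apply: (subclosed_compact _ (B := \big[setU/set0]_(x <- r) Q x)).
- exact: closed_closure.
- by apply: bigsetU_compact => x _; have [] := HQ x.
- rewrite [X in _ `<=` X](closure_id _).1//; apply: closureS.
  rewrite -bigcup_seq; apply: subset_bigcup => x _; exact: interior_subset.
Qed.

Section VagueMeasurability.
Context {R : realType} {S : ptopologicalType}.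

Lemma measurable_vague_eval (g : test_fun S R) :
  measurable_fun setT (fun s : config_space S R => vague_eval s g : R).
Proof.
apply: (@borel_measurable_continuous R (vague_config S R)
  (fun s => vague_eval s g : R)).
move=> s; apply: (@cvg_comp _ _ _ (@vague_eval S R : vague_config S R -> _)
    (fun h : {ptws test_fun S R -> R} => h g) _ (nbhs (vague_eval s))).
  exact: initial_continuous.
have /cvg_sup/(_ g) c : nbhs (vague_eval s) --> vague_eval s by apply: cvg_id.
apply: cvg_trans (@initial_continuous _ _ (fun h : test_fun S R -> R => h g) (vague_eval s)).
by move=> B /c.
Qed.

Hypothesis S_hausdorff : hausdorff_space S.
Hypothesis S_locally_compact : locally_compact [set: S].
Hypothesis S_countable : @second_countable S.

Let bump (U : set S) (g : S -> R) : Prop :=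
  [/\ continuous g, forall x, 0 <= g x & forall x, ~ U x -> g x = 0].

Let bump_at U x : open U -> U x -> exists2 g, bump U g & 1 / 2 < g x.
Proof.
move=> oU Ux.
have /(_ x (~` U)) := locally_compact_completely_regular (R := R) S_locally_compact S_hausdorff.
move=> /(_ (open_closedC oU) (fun h => h Ux))/(@uniform_separatorP _ R)[g [cg g01 g0 g1]].
exists (fun y => 1 - g y).
  split => [y|y|y Uy].
  - by apply: cvgB; [exact: cvg_cst|exact: cg].
  - by have : range g (g y) by []; move/g01; rewrite /= in_itv/= subr_ge0 => /andP[].
  - by have -> : g y = 1; [apply: g1; exists y|rewrite subrr].
have -> : g x = 0 by apply: g0; exists x.
by rewrite subr0 ltr_pdivrMr// mul1r ltrDl.
Qed.

(** Second countability reduces one bump function per point to a sequence: choose one for each basic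
    set on which some bump function exceeds 1/2. *)
Let bump_sequence U : open U -> exists g : nat -> S -> R,
  (forall k, bump U (g k)) /\ forall x, U x -> exists k, 1 / 2 < g k x.
Proof.
move=> oU; have [B /countable_injP[code code_inj] [_ Bbasis]] := S_countable.
have H k : exists g, bump U g /\ forall b, B b -> code b = k ->
    (exists2 g', bump U g' & forall x, b x -> 1 / 2 < g' x) ->
    forall x, b x -> 1 / 2 < g x.
  have [[b [Bb bk [g Ug gb]]]|no] := pselect (exists b, [/\ B b, code b = k &
      exists2 g', bump U g' & forall x, b x -> 1 / 2 < g' x]).
    exists g; split=> // b' Bb' b'k _; suff -> : b' = b by [].
    by apply: code_inj; rewrite ?inE// b'k.
  exists (fun=> 0); split; first by split => // x; exact: cvg_cst.
  by move=> b Bb bk gb; case: no; exists b.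
have [g gP] := choice H; exists g; split=> [k|x Ux]; first by case: (gP k).
have [g' Ug' gx] := bump_at oU Ux.
have ox : nbhs x [set y | 1 / 2 < g' y].
  by have [cg _ _] := Ug'; apply: (cvgr_gt (g' x)) gx; exact: cg.
have [b [Bb bx] bsub] := Bbasis x _ ox.
exists (code b); have [_] := gP (code b); move=> /(_ b Bb erefl); apply => //.
by exists g' => // y /bsub.
Qed.

Lemma test_fun_exhaustion U : open U -> compact (closure U) ->
  exists h : nat -> test_fun S R,
    [/\ forall N x, 0 <= sval (h N) x,
        forall x, {homo (fun N => sval (h N) x) : n p / (n <= p)%N >-> n <= p} &
        forall x, exists N, forall p, (N <= p)%N -> sval (h p) x = \1_U x].
Proof.
move=> oU cU; have [g [gU gx]] := bump_sequence oU.
have g0 k x : 0 <= g k x by case: (gU k).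
pose G N x : R := \sum_(i < N) g i x.
have G0 N x : 0 <= G N x by apply: sumr_ge0.
(* The factor [N] and the truncation at 1 make the sequence reach the indicator of [U] after
   finitely many steps at each point. *)
pose h N x : R := Num.min (N%:R * G N x) 1.
have hU N x : ~ U x -> h N x = 0.
  move=> Ux; rewrite /h /G big1 ?mulr0 => [|i _]; first by rewrite min_l.
  by case: (gU i) => _ _; exact.
have hP N : continuous (h N) /\ compact (closure [set x | h N x != 0]).
  split.
    move=> x; apply: (@continuous_min R S (fun x => N%:R * G N x) (fun=> 1)).
      apply: cvgM; first exact: cvg_cst.
      apply: (@cvg_big R _ +%R) => [|i _]; first exact: add_continuous.
      by case: (gU i) => c _ _; exact: c.
    exact: cvg_cst.
  apply: (subclosed_compact (@closed_closure _ _) cU); apply: closureS.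
  by move=> x /= hx; apply: contrapT => Ux; rewrite hU ?eqxx in hx.
exists (fun N => exist _ (h N) (hP N)); split => /=.
- by move=> N x; rewrite /h le_min ler01 mulr_ge0.
- move=> x n p np; rewrite /h le_min !ge_min lexx orbT andbT; apply/orP; left.
  apply: ler_pM => //; first by rewrite ler_nat.
  rewrite /G -!(big_mkord xpredT (fun i => g i x)) (big_cat_nat _ np)//= lerDl.
  by apply: sumr_ge0.
- move=> x; have [Ux|Ux] := pselect (U x); last first.
    by exists 0%N => p _; rewrite hU// indic_out.
  (* For [p > k] the sum is at least 1/2, and [p >= 2] lifts its multiple to 1. *)
  have [k gk] := gx x Ux; exists (maxn k.+1 2) => p.
  rewrite geq_max => /andP[kp p2]; rewrite indic_in// /h min_r//.
  have Gk : 1 / 2 <= G p x.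
    rewrite /G (bigD1 (Ordinal kp))//=; apply: le_trans (ltW gk) _.
    by rewrite lerDl; apply: sumr_ge0.
  have : (2 : R) <= p%:R by rewrite ler_nat.
  by nra.
Qed.

Lemma config_lty (s : config S R) (B : set (borel S)) :
  measurable B -> compact (closure (B : set S)) -> (s B < +oo)%E.
Proof.
move=> mB cB; apply: le_lt_trans (config_locally_finite s cB).
apply: le_measure; rewrite ?inE//; last exact: subset_closure.
exact: closed_borel (@closed_closure _ _).
Qed.

Lemma measurable_count_open (U : set S) : open U -> compact (closure U) ->
  measurable_fun setT (fun s : config_space S R => (s : config S R) U).
Proof.
move=> oU cU; have [h [h0 hnd hlim]] := test_fun_exhaustion oU cU.
have mU : measurable (U : set (borel S)) by exact: sub_sigma_algebra.
have h1 N x : sval (h N) x <= \1_U x.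
  have [M hM] := hlim x; rewrite -(hM (maxn N M)) ?leq_maxr//.
  by apply: hnd; exact: leq_maxl.
have mh N : measurable_fun setT (sval (h N) : borel S -> R).
  by apply: borel_measurable_continuous; case: (svalP (h N)).
apply: (emeasurable_fun_cvg (fun N (s : config_space S R) => (vague_eval s (h N) : R)%:E)) => [N|s _].
  have /measurable_EFinP := measurable_vague_eval (h N); exact.
have intU : (s : config S R) U = (\int[s]_x (\1_U x)%:E)%E by rewrite integral_indic// setIT.
have le_count N : (\int[s]_x (sval (h N) x)%:E <= (s : config S R) U)%E.
  rewrite intU; apply: ge0_le_integral => //.
  - by move=> x _; rewrite lee_fin.
  - exact/measurable_EFinP.
  - exact/measurable_EFinP/measurable_indic.
  - by move=> x _; rewrite lee_fin.
(* [vague_eval] is real valued, with a junk value for an infinite integral; the finite count of [U]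
   excludes this case. *)
have E N : (vague_eval s (h N) : R)%:E = (\int[s]_x (sval (h N) x)%:E)%E.
  rewrite /vague_eval /Rintegral fineK// ge0_fin_numE; last first.
    by apply: integral_ge0 => x _; rewrite lee_fin.
  exact: le_lt_trans (le_count N) (config_lty s mU cU).
under eq_fun do rewrite E.
rewrite intU (eq_integral (fun x : borel S => limn (fun N => (sval (h N) x)%:E))); last first.
  move=> x _; have [M hM] := hlim x; apply/esym/cvg_lim => //.
  by apply: cvg_near_cst; exists M => // N /= MN; rewrite hM.
apply: cvg_monotone_convergence => //.
- by move=> N; exact/measurable_EFinP.
- by move=> N x _; rewrite lee_fin.
- by move=> x _ n p np; rewrite lee_fin; exact: hnd.
Qed.

(** Dynkin's argument inside an open, relatively compact [W], where counts are finite and a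
    complement becomes a difference of counts. *)
Lemma measurable_count (B : set (borel S)) :
  measurable B -> compact (closure (B : set S)) ->
  measurable_fun setT (fun s : config_space S R => (s : config S R) B).
Proof.
move=> mB cB; have [W [oW BW cW]] := open_rel_compact_nbhd S_locally_compact cB.
have mW : measurable (W : set (borel S)) by exact: sub_sigma_algebra.
have sub_cW (A : set S) : A `<=` W -> compact (closure A).
  by move=> AW; apply: (subclosed_compact (@closed_closure _ _) cW); exact: closureS.
rewrite -(setIidl (subset_trans (@subset_closure _ _) BW)).
have openI_closed : setI_closed (@open S) by move=> A1 A2; exact: openI.
apply: (dynkin_induction (T := borel S) (G := @open S) (P := fun A : set (borel S) =>
  measurable_fun setT (fun s : config_space S R => (s : config S R) (A `&` W)))) => //.
- by rewrite setTI; exact: measurable_count_open.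
- move=> A oA; apply: measurable_count_open; first exact: openI.
  exact: sub_cW.
- move=> A mA mAW; rewrite (_ : (fun s => _) =
    (fun s : config_space S R => (s : config S R) W - (s : config S R) (A `&` W))%E).
    by apply: emeasurable_funB => //; exact: measurable_count_open.
  apply/funext => s; rewrite setIC -setDE measureD//; first by rewrite setIC.
  exact: config_lty.
- move=> F mF tF mFW; rewrite (_ : (fun s => _) =
    (fun s : config_space S R => \sum_(k <oo) (s : config S R) (F k `&` W))%E).
    by apply: ge0_emeasurable_sum => //.
  apply/funext => s; rewrite setI_bigcupl measure_semi_bigcup//.
  + by move=> k; exact: measurableI.
  + exact: trivIset_setIr.
  + by apply: bigcupT_measurable => k; exact: measurableI.
Qed.

End VagueMeasurability.

(** * Factorial moments and restriction to the cell counts *)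

Lemma sum1_seq (R : realType) (T : Type) (r : seq T) :
  (\sum_(i <- r) 1 = (size r)%:R%:E :> \bar R)%E.
Proof.
by elim: r => [|i r ih]; rewrite ?big_nil// big_cons ih /= -EFinD -natr1 addrC.
Qed.

Lemma config_nat (R : realType) (S : ptopologicalType) (s : config S R)
  (B : set (borel S)) : (s B < +oo)%E -> exists n : nat, s B = n%:R%:E.
Proof.
have [J [x sx]] := config_sum_dirac s => sB.
pose P := [set j | B (x j)].
have sP : s B = \esum_(j in P) 1%E.
  rewrite sx [RHS]esum_mkcond; apply: eq_esum => j _; rewrite diracE.
  have [Bj|Bj] := pselect (B (x j)); first by rewrite !mem_set.
  by rewrite !memNset.
have [finP|infP] := pselect (finite_set P).
  exists (size (finmap.enum_fset (fset_set P))).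
  by rewrite sP esum_fset// fsbig_finite// sum1_seq.
have s0 : (0 <= s B)%E by [].
(* Infinitely many points in [B] would include a finite set of them larger than the count itself. *)
have [D DP Dn] := infinite_set_fset (Num.truncn (fine (s B))).+1 infP.
have : (s B < s B)%E; last by rewrite ltxx.
rewrite {2}sP; apply: (@lt_le_trans _ _ (size (finmap.enum_fset D))%:R%:E).
  rewrite -[ltLHS]fineK ?ge0_fin_numE// lte_fin.
  by rewrite (lt_le_trans (truncnS_gt _))// ler_nat.
apply: esum_ge; exists [set` finmap.enum_fset D].
  by split => //; exact: finite_seq.
by rewrite -fsbig_seq ?sum1_seq//; exact: finmap.fset_uniq.
Qed.

(** A product of differences has no evident sign; as a falling factorial it is nonnegative, which
    the integrals of factorial moments rely on. *)
Lemma falling_fact_nat (R : realType) (n k : nat) :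
  falling_fact (n%:R%:E : \bar R) k = (n ^_ k)%:R%:E.
Proof.
elim: k => [|k ih]; first by rewrite /falling_fact big_ord0.
rewrite /falling_fact big_ord_recr /= -/(falling_fact _ k) ih.
have [kn|nk] := leqP k n; last by rewrite !ffact_small ?mul0e// ltnW.
by rewrite -EFinB -EFinM -natrB// -natrM ffactnSr.
Qed.

Lemma emeasurable_bigprod d (T : measurableType d) (R : realType) (I : Type)
    (r : seq I) (h : I -> T -> \bar R) : (forall i, measurable_fun setT (h i)) ->
  measurable_fun setT (fun x => \prod_(i <- r) h i x)%E.
Proof.
move=> mh; elim: r => [|i r ih].
  by under eq_fun do rewrite big_nil; exact: measurable_cst.
by under eq_fun do rewrite big_cons; exact: emeasurable_funM.
Qed.

Section RestrictedIntegral.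
Context {R : realType} {S : ptopologicalType} {I : pointedType}.
Variable lam : {measure set (borel S) -> \bar R}.
Variable cell : node I -> set S.
Hypothesis S_hausdorff : hausdorff_space S.
Hypothesis S_locally_compact : locally_compact [set: S].
Hypothesis S_countable : @second_countable S.
Hypothesis cellP : nested_partitions lam cell.
Variable l : nat.

Let G : set (set (config S R)) := cell_counts cell l.

Lemma cell_count_nat n (s : config S R) : exists k : nat, s (cell n) = k%:R%:E.
Proof.
apply: config_nat; apply: config_lty; first exact: (cell_measurable cellP).
exact: (cell_compact cellP).
Qed.

Let G_borel : @measurable _ (g_sigma_algebraType G) `<=` @measurable _ (config_space S R).
Proof.
apply: smallest_sub; first exact: sigma_algebra_measurable.
move=> _ [n [k [_ ->]]].
have := measurable_count (R := R) S_hausdorff S_locally_compact S_countable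
  (cell_measurable cellP n) (cell_compact cellP (n := n)).
move=> /(_ measurableT [set k%:R%:E] (emeasurable_set1 _)); rewrite setTI.
exact.
Qed.

(** Counts take natural values only, so a preimage is a countable union of generators of the
    restricted sigma-algebra. *)
Let measurable_falling n k : level n = l -> measurable_fun setT
  (fun s : g_sigma_algebraType G => falling_fact ((s : config S R) (cell n)) k).
Proof.
move=> nl _ Y _; rewrite setTI.
rewrite (_ : _ @^-1` _ = \bigcup_(q in [set q : nat | Y (falling_fact q%:R%:E k)])
  [set s : config S R | s (cell n) = q%:R%:E]).
  by apply: bigcup_measurable => q _; apply: sub_sigma_algebra; exists n, q.
apply/seteqP; split => [s /= Ys|s [q /= Yq ->]//].
by have [q sq] := cell_count_nat n s; exists q; rewrite /= -?sq.
Qed.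

Lemma integral_restrict (mu : probability (config_space S R) R) j
    (n : 'I_j -> node I) (k : 'I_j -> nat) : (forall i, level (n i) = l) ->
  (\int[restrict_to (G := cell_counts cell l) mu]_s
      \prod_(i < j) falling_fact ((s : config S R) (cell (n i))) (k i) =
   \int[mu]_s \prod_(i < j) falling_fact ((s : config S R) (cell (n i))) (k i))%E.
Proof.
move=> nl; pose id' : config_space S R -> g_sigma_algebraType G := id.
have mid : measurable_fun setT id'.
  by move=> _ A mA; rewrite setTI; exact: G_borel.
(* [restrict_to mu] is convertible to the image of [mu] under the identity. *)
apply: etrans (ge0_integral_pushforward mid mu measurableT _ _) _ => //.
- apply: emeasurable_bigprod => i; exact: measurable_falling.
- move=> s _; apply: prode_ge0 => i _.
  by have [q ->] := cell_count_nat (n i) s; rewrite falling_fact_nat lee_fin.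
Qed.

End RestrictedIntegral.

(** * Correlation functions *)

Lemma integral_esum (R : realType) d (X : measurableType d) (iota : X -> nat)
    (mu : {measure set X -> \bar R}) (D : set X) (h : X -> \bar R) :
  injective iota -> (forall x : X, measurable [set x]) -> (forall x, mu [set x] = 1%E) ->
  (forall x, 0 <= h x)%E -> (\int[mu]_(x in D) h x = \esum_(x in D) h x)%E.
Proof.
move=> iota_inj X_set1 mu1 h0.
pose F k := D `&` [set x | iota x = k].
have DF : D = \bigcup_k F k.
  by apply/seteqP; split => [x Dx|x [k _ []]//]; exists (iota x).
have tF : trivIset setT F.
  by move=> k k' _ _ [x [[_ <-] [_ <-]]].
have mD (A : set X) : measurable A := discrete_measurable iota_inj X_set1 A.
rewrite DF ge0_integral_bigcup//.
  rewrite esum_bigcupT// nneseries_esumT; last first.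
    by move=> k; exact: integral_ge0.
  apply: eq_esum => k _; have [->|/set0P[x [Dx xk]]] := eqVneq (F k) set0.
    by rewrite integral_set0 esum_set0.
  have -> : F k = [set x].
    apply/seteqP; split => [y [_ yk]|_ ->//]; apply: iota_inj.
    by rewrite yk xk.
  rewrite esum_set1//; transitivity (\int[mu]_(y in [set x]) cst (h x) y)%E.
    by apply: eq_integral => y; rewrite inE => ->.
  by rewrite integral_cst// mu1 mule1.
Qed.

(* The correlation identities only see powers of distinct sets, so the factors of a
   product set have to be sorted first. *)
Lemma tuple_blocks (T : eqType) m (t : 'I_m -> T) :
  exists (j : nat) (B : 'I_j -> T) (k : 'I_j -> nat) (sg : 'S_m),
    [/\ injective B, forall i, exists n, B i = t n, forall i, (0 < k i)%N,
        (\sum_(i < j) k i)%N = m &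
        forall U (d : U) (g : T -> U) (n : 'I_m),
          nth d (flatten [seq nseq (k i) (g (B i)) | i <- enum 'I_j]) n = g (t (sg n))].
Proof.
pose s : seq T := [tuple t i | i < m]; pose u := undup s.
pose B (i : 'I_(size u)) := tnth (in_tuple u) i.
pose k i := count_mem (B i) s.
pose w := flatten [seq nseq (k i) (B i) | i <- enum 'I_(size u)].
have wE : w = flatten [seq nseq (count_mem x s) x | x <- u].
  rewrite /w -[X in _ = flatten (map _ X)](map_tnth_enum (in_tuple u)) -map_comp.
  by [].
have ws : perm_eq w s by rewrite wE perm_count_undup.
have [sg wsg] : exists sg : 'S_m, w = [tuple tnth [tuple t i | i < m] (sg i) | i < m].
  exact/tuple_permP.
have Bs i : B i \in s by rewrite -mem_undup mem_tnth.
exists (size u), B, k, sg; split.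
- by apply/tuple_uniqP; exact: undup_uniq.
- by move=> i; have /tnthP[n ->] := Bs i; exists n; rewrite tnth_mktuple.
- by move=> i; rewrite /k -has_count has_pred1.
- have := perm_size ws; rewrite /w size_flatten /shape -map_comp sumnE big_map.
  rewrite big_enum /= size_tuple => <-.
  by apply: eq_bigr => i _; rewrite /= size_nseq.
- move=> U d g n.
  rewrite (_ : [seq _ | i <- _] = map (map g) [seq nseq (k i) (B i) | i <- enum 'I_(size u)]).
    rewrite -map_flatten -/w wsg (nth_map (t n)) ?size_tuple//.
    by rewrite -tnth_nth !tnth_mktuple.
  by rewrite -map_comp; apply: eq_map => i /=; rewrite map_nseq.
Qed.

Section PowerMeasureBox.
Context {R : realType} d {T : measurableType d}.

Lemma power_sfm_box (mu : {sigma_finite_measure set T -> \bar R}) m (A : 'I_m -> set T) :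
  (forall i, measurable (A i)) -> (power_sfm mu m (box A) = \prod_i mu (A i))%E.
Proof.
elim: m A => [|m ih] A mA.
  by rewrite power_sfm0 big_ord0 diracE mem_set// => -[].
rewrite power_sfmS /pushforward big_ord_recl -ih//.
have -> : @tcons _ T m @^-1` box A = A ord0 `*` box (fun i => A (lift ord0 i)).
  apply/seteqP; split => -[x y] /=.
    move=> h; split; first exact: (h ord0).
    by move=> i; have := h (lift ord0 i); rewrite tnthS.
  by move=> [Ax h] i; have [j ->|->] := unliftP ord0 i; rewrite ?tnthS//; exact: h.
by rewrite product_measure1E//; exact: measurable_box.
Qed.

Lemma power_measureP (mu : {measure set T -> \bar R}) m : sigma_finite setT mu ->
  exists P : {sigma_finite_measure set (m.-tuple T) -> \bar R},
    (P : set _ -> \bar R) = power_measure mu m /\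
    forall A : 'I_m -> set T, (forall i, measurable (A i)) ->
      (P (box A) = \prod_i mu (A i))%E.
Proof.
move=> /sigma_finite_measureP[nu numu]; exists (power_sfm nu m).
split=> [|A mA]; first by rewrite power_sfmE numu.
rewrite power_sfm_box//.
by apply: eq_bigr => i _; rewrite -numu.
Qed.

End PowerMeasureBox.

Lemma blocks_box (S : ptopologicalType) m j (A : 'I_j -> set S) (k : 'I_j -> nat)
    (B : 'I_m -> set S) :
  (forall n : 'I_m, nth set0 (flatten [seq nseq (k i) (A i) | i <- enum 'I_j]) n = B n) ->
  (blocks A k : set (m.-tuple (borel S))) = box (B : 'I_m -> set (borel S)).
Proof.
by move=> AB; apply/seteqP; split => x h n; have := h n; rewrite AB.
Qed.

Section LevelKernel.
Context {R : realType} {S : ptopologicalType} {I : pointedType}.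
Variable lam : {measure set (borel S) -> \bar R}.
Variable cell : node I -> set S.
Hypothesis cellP : nested_partitions lam cell.
Variables (l m : nat).
Hypothesis l_gt0 : (0 < l)%N.

Let X := borel (level_space I l).

Lemma level_countingP : exists P : {measure set (m.-tuple X) -> \bar R},
  (P : set _ -> \bar R) = power_measure counting m /\
  [/\ forall x : m.-tuple X, measurable [set x],
      forall x, P [set x] = 1%E & exists iota : m.-tuple X -> nat, injective iota].
Proof.
have [iota iota_inj] : exists iota : X -> nat, injective iota.
  exact: (level_index_countable cellP l).
have X1 := @level_space_set1 I l.
have [P [PE Pbox]] := power_measureP m (counting_sigma_finite (R := R) iota_inj X1).
have set1E (x : m.-tuple X) : [set x] = box (fun i => [set tnth x i]).
  by apply/seteqP; split => [_ -> //|y yx]; exact: eq_from_tnth.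
exists P; split=> //; split.
- by move=> x; rewrite set1E; apply: measurable_box => i; exact: X1.
- move=> x; rewrite set1E; apply: etrans (Pbox _ (fun i => X1 (tnth x i))) _.
  by rewrite big1// => i _; exact: counting_set1.
- exists (fun x : m.-tuple X => pickle (map iota x)).
  by move=> x y /(pcan_inj pickleK)/(inj_map iota_inj)/val_inj.
Qed.

(** On a discrete space the sets of a correlation identity may be singletons, so the value at a
    tuple is an expected product of falling factorials. Thus [rhoF] may be replaced by the
    determinant, and its sum by an integral of a nonnegative function. *)
Lemma correlation_discrete (nu : probability (config_space (level_space I l) R) R)
    (rho rho' : m.-tuple (level_space I l) -> R) :
  correlation_function counting nu rho -> correlation_function counting nu rho' ->
  forall x, 0 <= rho x /\ rho x = rho' x.
Proof.
move=> [_ rho_sym rhoP] [_ rho'_sym rho'P] x.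
have [P [PE [P1 Pm1 _]]] := level_countingP.
have [j [B [k [sg [Binj _ k0 ksum Bk]]]]] := tuple_blocks (tnth x).
pose y : m.-tuple X := [tuple tnth x (sg i) | i < m].
have blocksE : (blocks (fun i => [set B i]) k : set (m.-tuple X)) = [set y].
  rewrite (@blocks_box _ _ _ _ _ (fun n => [set tnth x (sg n)])) => [|n].
    apply/seteqP; split => [z /= zx|_ ->] /=; last by move=> n; rewrite tnth_mktuple.
    by apply: eq_from_tnth => n; rewrite tnth_mktuple zx.
  exact: (Bk _ set0 (fun z => [set z])).
have X1 := @level_space_set1 I l.
have triv : trivIset [set: 'I_j] (fun i => [set B i]).
  by move=> i i' _ _ [z [-> /Binj]].
have int1 (h : m.-tuple X -> R) : (\int[power_measure counting m]_(z in [set y]) (h z)%:E =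
    (h y)%:E)%E.
  rewrite -PE; transitivity (\int[P]_(z in [set y]) cst (h y)%:E z)%E.
    by apply: eq_integral => z; rewrite inE => ->.
  by rewrite integral_cst// Pm1 mule1.
have mB i : measurable ([set B i] : set X) by exact: X1.
have e' := rho'P j (fun i => [set B i]) k mB triv k0 ksum.
have e := rhoP j (fun i => [set B i]) k mB triv k0 ksum.
rewrite blocksE int1 in e; rewrite blocksE int1 e in e'.
rewrite -(rho_sym sg x) -(rho'_sym sg x); split; last by case: e'.
rewrite -lee_fin -e; apply: integral_ge0 => s _; apply: prode_ge0 => i _.
have [q ->] := config_nat (config_locally_finite s (@compact_set1 _ (B i))).
by rewrite falling_fact_nat lee_fin.
Qed.

End LevelKernel.

Lemma cell_products_saturated (R : realType) (S : ptopologicalType) (I : pointedType)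
    (lam : {measure set (borel S) -> \bar R}) (cell : node I -> set S) (l m : nat)
    (a : 'I_m -> node I) (C : set (m.-tuple S)) (x y : m.-tuple S) :
  nested_partitions lam cell -> (forall n, level (a n) = l) ->
  <<s cell_products cell l m >> C ->
  (forall n, cell (a n) (tnth x n)) -> (forall n, cell (a n) (tnth y n)) -> C x -> C y.
Proof.
move=> cellP al; pose P : set (set (m.-tuple S)) := [set C | forall x y,
  (forall n, cell (a n) (tnth x n)) -> (forall n, cell (a n) (tnth y n)) -> C x -> C y].
suff : <<s cell_products cell l m >> `<=` P by move=> h /h /(_ x y); exact.
apply: smallest_sub; last first.
  move=> _ [A cA ->] x' y' ax ay Ax n; have [c cl cE] := cA n.
  have := Ax n; rewrite -cE => cx.
  by rewrite (cell_inj cellP _ cx (ax n)) ?al//; exact: ay.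
split => //.
- move=> B PB x' y' ax ay [_ nB]; split=> // By.
  by apply: nB; exact: (PB y' x').
- move=> F PF x' y' ax ay [k _ Fk]; exists k => //.
  exact: (PF k x' y').
Qed.

(** * Reduction of both sides to determinant integrals *)

Theorem theorem2p2 (R : realType) (S : ptopologicalType)
  (lam : {measure set (borel S) -> \bar R})
  (alpha : R) (K : S -> S -> R[i])
  (I : pointedType) (cell : node I -> set S) (f : node I -> S -> R)
  (mu : probability (config_space S R) R)
  (l m : nat)
  (nu : probability (config_space (level_space I l) R) R)
  (A : 'I_m -> set S)
  (rhoG : m.-tuple S -> R) (rhoF : m.-tuple (level_space I l) -> R) :
  hausdorff_space S -> locally_compact [set: S] -> @second_countable S ->
  radon_measure lam ->
  (forall O : set S, open O -> O !=set0 -> (0 < lam O)%E) ->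
  admissible_alpha alpha ->
  kernel_measurable K -> hermitian_kernel K -> locally_trace_class lam K ->
  spectral_condition lam alpha K -> trace_formula lam K ->
  nested_partitions lam cell -> adapted_basis lam cell f ->
  alpha_determinantal alpha K lam mu ->
  (0 < l)%N -> (0 < m)%N ->
  alpha_determinantal alpha (level_kernel lam cell f K) counting nu ->
  (forall n, Delta cell l (A n)) ->
  restricted_correlation_function cell lam mu l rhoG ->
  correlation_function counting nu rhoF ->
  (\int[power_measure lam m]_(x in
        [set x : m.-tuple (borel S) | forall n, A n (tnth x n)]) (rhoG x)%:E =
   \esum_(i in [set i : m.-tuple (level_space I l) |
                  forall n, level_supp cell (tnth i n) `<=` A n])
      (rhoF i)%:E)%E.
Proof.
move=> hS lcS scS [lamK _] _ _ mK _ tcK _ tfK cellP fP muP l0 m0 nuP AP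
  [mG symG rhoGP] rhoFP.
have [a aP] := choice (fun n => let: ex_intro2 c cl cA := AP n in
  ex_intro (fun c => level c = l /\ cell c = A n) c (conj cl cA)).
have al n : level (a n) = l by case: (aP n).
have {AP}aA n : A n = cell (a n) by case: (aP n).
have [j [B [k [sg [Binj Ba k0 ksum Bk]]]]] := tuple_blocks a.
(* The factors in sorted order, equal cells being consecutive as in [blocks]. *)
pose b n := a (sg n).
have bl n : level (b n) = l by exact: al.
have Bl i : level (B i) = l.
  by have [n ->] := Ba i.
have blocksE : (blocks (fun i => cell (B i)) k : set (m.-tuple (borel S))) =
    box (fun n => cell (b n) : set (borel S)).
  by apply: blocks_box => n; exact: (Bk _ set0 cell).
have triv : trivIset [set: 'I_j] (fun i => cell (B i)).
  move=> i i' _ _ [x [Bx Bx']]; apply: Binj.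
  by apply: (cell_inj cellP _ Bx Bx'); rewrite !Bl.
have [rho [_ rho_sym rhoP] rhoE] := muP m m0.
have [rho' rho'P rho'E] := nuP m m0.
have mc n := cell_measurable cellP n.
(* The two functions need not agree pointwise; on a sorted box both integrals equal the same
   factorial moment of [mu], once that moment is moved to the smaller sigma-algebra. *)
have box_b : (\int[power_measure lam m]_(x in box (fun n => cell (b n) : set (borel S)))
    (rhoG x)%:E =
  \int[power_measure lam m]_(x in box (fun n => cell (b n) : set (borel S)))
    (rho x)%:E)%E.
  rewrite -blocksE.
  rewrite -(rhoP j (fun i => cell (B i)) k (fun i => mc (B i)) triv k0 ksum).
  rewrite -(integral_restrict hS lcS scS cellP mu k Bl).
  apply/esym/rhoGP => // i; apply: sub_sigma_algebra; exists (B i) => //; exact: Bl.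
have [P [PE Pbox]] := power_measureP m (lam_sigma_finite lamK cellP).
(* [rhoG] is constant on products of cells, so its integral over one of them does not
   depend on the order of the factors. *)
have int_box (c : 'I_m -> node I) (x : m.-tuple S) : (forall n, level (c n) = l) ->
    (forall n, cell (c n) (tnth x n)) ->
    (\int[power_measure lam m]_(y in box (fun n => cell (c n) : set (borel S)))
      (rhoG y)%:E = (rhoG x)%:E * \prod_n lam (cell (c n)))%E.
  move=> cl cx; rewrite -PE -Pbox; last by move=> n; exact: mc.
  rewrite -integral_cst; last by apply: measurable_box => n; exact: mc.
  apply: eq_integral => y; rewrite inE => cy; congr (_%:E).
  have mx : <<s cell_products cell l m >> (rhoG @^-1` [set rhoG x]).
    by have := mG measurableT [set rhoG x] (measurable_set1 _); rewrite setTI.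
  exact: (cell_products_saturated cellP cl mx cx cy).
have [x ax] : exists x : m.-tuple S, forall n, cell (a n) (tnth x n).
  have [x xP] := choice (fun n => cell_neq0 cellP (a n)).
  by exists [tuple x i | i < m] => n; rewrite tnth_mktuple.
have box_ab : (\int[power_measure lam m]_(x in box (fun n => cell (a n) : set (borel S)))
    (rhoG x)%:E =
  \int[power_measure lam m]_(x in box (fun n => cell (b n) : set (borel S)))
    (rhoG x)%:E)%E.
  rewrite (int_box a x)// (int_box b [tuple tnth x (sg i) | i < m])//; last first.
    by move=> n; rewrite tnth_mktuple; exact: ax.
  by rewrite symG; congr (_ * _)%E; exact: (reindex_inj (@perm_inj _ sg)).
have [iF iG FG] := det_alpha_integral_level alpha lamK cellP fP l0 mK tfK tcK bl.
have [Q [QE [Q1 Qm1 [iota iota_inj]]]] := level_countingP cellP l m.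
have rhoF' := correlation_discrete cellP rhoFP rho'P.
pose idx : set (m.-tuple (borel (level_space I l))) :=
  box (fun n => [set i | base_node i = b n] : set (borel (level_space I l))).
(* On the index side the sorting is a permutation of the tuples, under which [rhoF] is symmetric. *)
transitivity (\esum_(i in idx) (rhoF i)%:E)%E; last first.
  pose e (i : m.-tuple (level_space I l)) : m.-tuple (level_space I l) :=
    [tuple tnth i (sg n) | n < m].
  rewrite (_ : [set i | _] = [set i : m.-tuple (level_space I l) |
      forall n, base_node (tnth i n) = a n]); last first.
    apply/seteqP; split => i h n; have [h1 h2] := level_supp_sub cellP fP l0 (tnth i n) (al n).
      by apply: h1; rewrite -aA; exact: h.
    by rewrite aA; apply: h2; exact: h.
  rewrite (reindex_esum [set i | forall n, base_node (tnth i n) = a n] idx e).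
    by apply: eq_esum => i _; have [_ sym_rhoF _] := rhoFP; rewrite sym_rhoF.
  split.
  - by move=> i h n; rewrite tnth_mktuple; exact: h.
  - move=> i i' _ _ ee; apply: eq_from_tnth => n.
    by have := congr1 (fun z => tnth z (perm_inv sg n)) ee; rewrite !tnth_mktuple permKV.
  - move=> i h; exists [tuple tnth i (perm_inv sg n) | n < m] => /=.
      by move=> n; rewrite tnth_mktuple h /b permKV.
    by apply: eq_from_tnth => n; rewrite !tnth_mktuple permK.
rewrite -(integral_esum (mu := Q) idx iota_inj Q1 Qm1) => [|i]; last first.
  by rewrite lee_fin; case: (rhoF' i).
rewrite QE (_ : [set x | _] = box (fun n => cell (a n) : set (borel S))); last first.
  by apply/seteqP; split => y h n; have := h n; rewrite aA.
rewrite box_ab box_b; rewrite -PE in iF FG *; rewrite -QE in iG FG *.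
have reF y : Re (det_alpha alpha (\matrix_(i, j) K (tnth y i) (tnth y j))) = rho y.
  by rewrite -rhoE.
have reG y : Re (det_alpha alpha (\matrix_(i, j)
    level_kernel lam cell f K (tnth y i) (tnth y j))) = rhoF y.
  by rewrite -rho'E; case: (rhoF' y) => _ ->.
have [iF' _] := iF; have [iG' _] := iG.
(* [Cintegral] applies [fine], so its equation gives one between extended reals only if both
   integrals are finite. *)
have : (\int[P]_(y in box (fun n => cell (b n) : set (borel S))) (rho y)%:E)%E \is a fin_num.
  have := integrable_fin_num (measurable_box (fun n => mc (b n))) iF'.
  by under eq_integral do rewrite reF.
have : (\int[Q]_(i in idx) (rhoF i)%:E)%E \is a fin_num.
  have := integrable_fin_num (discrete_measurable iota_inj Q1 idx) iG'.
  by under eq_integral do rewrite reG.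
have := congr1 (@complex.Re R) FG; rewrite /Cintegral /=.
under eq_integral do rewrite reF; under [in RHS]eq_integral do rewrite reG.
by move=> fineE finQ finP; rewrite -[LHS]fineK// -[RHS]fineK// fineE.
Qed.
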